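(* The components of the intertwiner $\Upsilon=\sum_{\mu\in\mathbb N\Pi}\Upsilon_\mu$ satisfy $\Upsilon_\mu\in\mathbf U^-_{\mathcal A}$ for all $\mu\in\mathbb N\Pi$.
   Context: Let $q$ be an indeterminate, $\mathcal A=\mathbb Z[q,q^{-1}]$, and fix $r\in\mathbb N=\{0,1,2,\dots\}$. Put $\mathbb I=\{-r,\dots,r\}$, $\mathbb I^\imath=\{1,\dots,r\}$, $(\varepsilon_a,\varepsilon_b)=\delta_{ab}$ for $a,b\in\{-r-\frac12,\dots,r+\frac12\}$, $\alpha_i=\varepsilon_{i-\frac12}-\varepsilon_{i+\frac12}$ ($i\in\mathbb I$), $\Pi=\{\alpha_i\}$, $\mathrm{ht}(\sum c_i\alpha_i)=\sum c_i$. $\mathbf U=\mathbf U_q(\mathfrak{sl}_{2r+2})$ is the $\mathbb Q(q)$-algebra generated by $E_{\alpha_i},F_{\alpha_i},K_{\alpha_i}^{\pm1}$ ($i\in\mathbb I$) with commuting $K$'s, $K_{\alpha_i}E_{\alpha_j}K_{\alpha_i}^{-1}=q^{(\alpha_i,\alpha_j)}E_{\alpha_j}$, $K_{\alpha_i}F_{\alpha_j}K_{\alpha_i}^{-1}=q^{-(\alpha_i,\alpha_j)}F_{\alpha_j}$, $[E_{\alpha_i},F_{\alpha_j}]=\delta_{ij}\frac{K_{\alpha_i}-K_{\alpha_i}^{-1}}{q-q^{-1}}$ and the quantum Serre relations. $\mathbf U^+,\mathbf U^0,\mathbf U^-$ are the subalgebras generated by the $E$'s, $K^{\pm1}$'s,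 $F$'s; $\mathbf U^-_{-\mu}$ is the weight $-\mu$ part. $\mathbf U^-_{\mathcal A}$ is the $\mathcal A$-subalgebra of $\mathbf U^-$ generated by the divided powers $F_{\alpha_i}^{(a)}=F_{\alpha_i}^a/[a]!$, $a\ge0$, $i\in\mathbb I$, where $[a]=(q^a-q^{-a})/(q-q^{-1})$. $\psi$ is the anti-linear ($q\mapsto q^{-1}$) bar involution of $\mathbf U$ fixing $E_{\alpha_i},F_{\alpha_i}$ and inverting $K_{\alpha_i}$. $\mathbf U^\imath$ is the $\mathbb Q(q)$-subalgebra of $\mathbf U$ generated, for $i\in\mathbb I^\imath$, by $k_{\alpha_i}^{\pm1}=(K_{\alpha_i}K_{\alpha_{-i}}^{-1})^{\pm1}$, $e_{\alpha_i}=E_{\alpha_i}+K_{\alpha_i}^{-1}F_{\alpha_{-i}}$, $f_{\alpha_i}=F_{\alpha_i}K_{\alpha_{-i}}^{-1}+E_{\alpha_{-i}}$, and by $t=E_{\alpha_0}+qF_{\alpha_0}K_{\alpha_0}^{-1}+K_{\alpha_0}^{-1}$. (The paper presents $\mathbf U^\imath$ by generators and relations and embeds it in $\mathbf U$ this way.) It has its own anti-linear bar involution $\psi_\imath$, fixing $e_{\alpha_i},f_{\alpha_i},t$ and inverting $k_{\alpha_i}$. The intertwiner $\Upsilon=\sum_{\mu\in\mathbb N\Pi}\Upsilon_\mu$, $\Upsilon_\mu\in\mathbf U^-_{-\mu}$ (in the completion of $\mathbf U$ with respect to $\mathbf U^+\mathbf U^0\sum_{\mathrm{ht}(\mu)\ge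 N}\mathbf U^-_{-\mu}$), is the unique such element with $\Upsilon_0=1$ and $\psi_\imath(u)\Upsilon=\Upsilon\psi(u)$ for all $u\in\mathbf U^\imath$. *)

(* Defs.v *)
From HB Require Import structures.
From mathcomp Require Import all_boot all_order all_algebra.
From mathcomp Require Import generic_quotient boolp.

Set Implicit Arguments.
Unset Strict Implicit.
Unset Printing Implicit Defensive.

Import Order.TTheory GRing.Theory Num.Theory.
Local Open Scope ring_scope.

Local Open Scope quotient_scope.

Notation Qq := {fraction {poly rat}}.

Definition q : Qq := FracField.tofrac 'X.

(* c belongs to Z[q, q^-1] *)
Definition is_laurent (c : Qq) : Prop :=
  exists (p : {poly int}) (n : nat),
    c = FracField.tofrac (map_poly intr p) / q ^+ n.

Definition qint (a : nat) : Qq := (q ^+ a - q ^- a) / (q - q^-1).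
Definition qfact (a : nat) : Qq := \prod_(1 <= k < a.+1) qint k.

Definition eval_qV (p : {poly rat}) : Qq :=
  (map_poly (fun c : rat => FracField.tofrac c%:P) p).[q^-1].

(* the field automorphism q |-> q^-1 of Q(q), see [qbar_rmorphism] *)
Definition qbar (x : Qq) : Qq := eval_qV \n_(repr x) / eval_qV \d_(repr x).

Lemma q_neq0 : q != 0.
Proof. by rewrite /q tofrac_eq0 polyX_eq0. Qed.

Local Definition qmor : {rmorphism rat -> Qq} :=
  GRing.RMorphism.clone _ _ (FracField.tofrac (R := {poly rat}) \o polyC) _.

Lemma eval_qVE p : eval_qV p = horner_morph (fun a => mulrC q^-1 (qmor a)) p.
Proof. by []. Qed.

Lemma eval_qVM : {morph eval_qV : x y / x * y}.
Proof. by move=> x y; rewrite !eval_qVE rmorphM. Qed.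

Lemma eval_qVD : {morph eval_qV : x y / x + y}.
Proof. by move=> x y; rewrite !eval_qVE rmorphD. Qed.

Lemma eval_qV1 : eval_qV 1 = 1.
Proof. by rewrite eval_qVE rmorph1. Qed.

Lemma eval_qVX : eval_qV 'X = q^-1.
Proof. by rewrite eval_qVE horner_morphX. Qed.

Lemma eval_qV_eq0 p : (eval_qV p == 0) = (p == 0).
Proof.
apply/idP/idP => [|/eqP->]; last first.
  by rewrite eval_qVE rmorph0.
apply: contraTT => p0.
pose n := size p.
pose s : {poly rat} := \poly_(i < n) p`_(n.-1 - i).
have n0 : (0 < n)%N by rewrite size_poly_gt0.
have sE : FracField.tofrac s = eval_qV p * q ^+ n.-1.
  rewrite /s poly_def rmorph_sum (reindex_inj rev_ord_inj) /=.
  rewrite /eval_qV (@horner_coef_wide _ n) ?size_poly //.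
  rewrite mulr_suml; apply: eq_bigr => i _.
  have ile : (i <= n.-1)%N by rewrite -ltnS prednK.
  have -> : (n - i.+1 = n.-1 - i)%N by rewrite subnS -subn1 -subnAC subn1.
  rewrite subKn // -mul_polyC rmorphM rmorphXn /= (coef_map qmor) /=.
  rewrite -mulrA; congr (_ * _).
  by rewrite exprVn -[in RHS](subnK ile) exprD mulrCA mulVf ?mulr1 ?expf_neq0 ?q_neq0.
have s0 : s != 0.
  apply/negP => /eqP /(congr1 (fun t : {poly rat} => t`_0)).
  rewrite coef_poly n0 subn0 coef0 => /eqP.
  by rewrite -lead_coefE lead_coef_eq0 (negPf p0).
move: s0; rewrite -(tofrac_eq0 s) sE mulf_eq0 negb_or.
by case/andP => pqV _; exact: pqV.
Qed.

Lemma frac_repr (x : Qq) :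
  x = FracField.tofrac \n_(repr x) / FracField.tofrac \d_(repr x).
Proof.
rewrite -[LHS]reprK; set y := repr x.
apply: (mulIf (x := FracField.tofrac \d_y)); first by rewrite tofrac_eq0; apply: denom_ratioP.
rewrite divfK; last by rewrite tofrac_eq0; apply: denom_ratioP.
unlock FracField.tofrac; rewrite -[LHS]FracField.pi_mul.
apply/eqmodP; rewrite /= FracField.equivfE /FracField.mulf.
by rewrite !numden_Ratio ?mulr1 ?oner_neq0 ?denom_ratioP // [X in X == _]mulrC.
Qed.

Lemma fracP (x : Qq) : exists (n d : {poly rat}),
  d != 0 /\ x = FracField.tofrac n / FracField.tofrac d.
Proof. by exists \n_(repr x), \d_(repr x); split; [exact: denom_ratioP | exact: frac_repr]. Qed.

Lemma qbar_frac (n d : {poly rat}) : d != 0 ->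
  qbar (FracField.tofrac n / FracField.tofrac d) = eval_qV n / eval_qV d.
Proof.
move=> d0; set x := _ / _; rewrite /qbar.
have y0 := denom_ratioP (repr x).
have xE := frac_repr x.
have : FracField.tofrac (n * \d_(repr x)) = FracField.tofrac (\n_(repr x) * d).
  rewrite !rmorphM /=; apply/eqP; rewrite -eqr_div ?tofrac_eq0 //.
  by rewrite -xE.
move=> /eqP; rewrite tofrac_eq => /eqP /(congr1 eval_qV).
rewrite !eval_qVM => e; apply/eqP; rewrite eqr_div ?eval_qV_eq0 //.
by rewrite e.
Qed.

Lemma qbar_q : qbar q = q^-1.
Proof.
rewrite -[q in LHS]divr1 -[1]/(FracField.tofrac 1) qbar_frac ?oner_neq0 //.
by rewrite eval_qVX eval_qV1 divr1.
Qed.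

Lemma qbar_rmorphism : zmod_morphism qbar /\ monoid_morphism qbar.
Proof.
have D : {morph qbar : x y / x + y}.
  move=> x y; have [n [d [d0 ->]]] := fracP x; have [m [e [e0 ->]]] := fracP y.
  rewrite addf_div ?tofrac_eq0 // -!rmorphM -rmorphD !qbar_frac ?mulf_neq0 //.
  by rewrite addf_div ?eval_qV_eq0 // eval_qVD !eval_qVM.
have M : {morph qbar : x y / x * y}.
  move=> x y; have [n [d [d0 ->]]] := fracP x; have [m [e [e0 ->]]] := fracP y.
  rewrite mulf_div -!rmorphM !qbar_frac ?mulf_neq0 //.
  by rewrite mulf_div !eval_qVM.
have B1 : qbar 1 = 1.
  by rewrite -[1 in LHS]divr1 -[1]/(FracField.tofrac 1) qbar_frac ?oner_neq0 //
     divff ?eval_qV_eq0 ?oner_neq0.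
split; last by split.
move=> x y; apply: (addIr (qbar y)).
by rewrite -D !subrK.
Qed.

(* The index i : 'I_(r.*2.+1) stands for the integer i - r of {-r, ..., r};
   so r stands for 0 and [rev_ord i] for the opposite of i.  The index
   a : 'I_(r.*2.+2) stands for the half-integer a - r - 1/2. *)
Notation idx r := 'I_(r.*2.+1).
Notation lattice r := 'rV[int]_(r.*2.+2).

Definition idx0 r : idx r := inord r.
(* i lies in {1, ..., r} *)
Definition idx_pos r (i : idx r) : bool := (r < i)%N.

Definition eps r (a : 'I_(r.*2.+2)) : lattice r := 'e_a.
Definition alpha r (i : idx r) : lattice r :=
  eps (widen_ord (leqnSn _) i) - eps (lift ord0 i).
Definition pairing r (x y : lattice r) : int := \sum_a x 0 a * y 0 a.

(* the element \sum_i mu i * alpha i of N Pi *)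
Notation NPi r := {ffun idx r -> nat}.
Definition weight r (mu : NPi r) : lattice r := \sum_i alpha i *+ mu i.
Definition ht r (mu : NPi r) : nat := (\sum_i mu i)%N.

Inductive gen r := GE of idx r | GF of idx r | GK of idx r | GKV of idx r.

Inductive expr r :=
  | EGen of gen r
  | EConst of Qq
  | EAdd of expr r & expr r
  | EMul of expr r & expr r.
Arguments EConst {r}.

Declare Scope expr_scope.
Delimit Scope expr_scope with expr.
Bind Scope expr_scope with expr.
Notation "x + y" := (EAdd x y) : expr_scope.
Notation "x * y" := (EMul x y) : expr_scope.
Notation "x - y" := (EAdd x (EMul (EConst (-1)) y)) : expr_scope.
Notation "c *: x" := (EMul (EConst c) x) : expr_scope.

(* The congruence on the noncommutative polynomial expressions generated by
   the axioms of Q(q)-algebras and by the defining relations of U. *)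
Inductive Ueq r : expr r -> expr r -> Prop :=
  | Ueq_refl x : Ueq x x
  | Ueq_sym x y : Ueq x y -> Ueq y x
  | Ueq_trans x y z : Ueq x y -> Ueq y z -> Ueq x z
  | Ueq_add x x' y y' : Ueq x x' -> Ueq y y' -> Ueq (x + y) (x' + y')
  | Ueq_mul x x' y y' : Ueq x x' -> Ueq y y' -> Ueq (x * y) (x' * y')
  | Ueq_addA x y z : Ueq (x + (y + z)) (x + y + z)
  | Ueq_addC x y : Ueq (x + y) (y + x)
  | Ueq_add0 x : Ueq (EConst 0 + x) x
  | Ueq_mulA x y z : Ueq (x * (y * z)) (x * y * z)
  | Ueq_mul1 x : Ueq (EConst 1 * x) x
  | Ueq_mul0 x : Ueq (EConst 0 * x) (EConst 0)
  | Ueq_mulDl x y z : Ueq ((x + y) * z) (x * z + y * z)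
  | Ueq_mulDr x y z : Ueq (z * (x + y)) (z * x + z * y)
  | Ueq_constD (c d : Qq) : Ueq (EConst (c + d)) (EConst c + EConst d)
  | Ueq_constM (c d : Qq) : Ueq (EConst (c * d)) (EConst c * EConst d)
  | Ueq_constC c x : Ueq (EConst c * x) (x * EConst c)
  | Ueq_KKV i : Ueq (EGen (GK i) * EGen (GKV i)) (EConst 1)
  | Ueq_KVK i : Ueq (EGen (GKV i) * EGen (GK i)) (EConst 1)
  | Ueq_KK i j : Ueq (EGen (GK i) * EGen (GK j)) (EGen (GK j) * EGen (GK i))
  | Ueq_KE i j : Ueq (EGen (GK i) * EGen (GE j) * EGen (GKV i))
      (q ^ pairing (alpha i) (alpha j) *: EGen (GE j))
  | Ueq_KF i j : Ueq (EGen (GK i) * EGen (GF j) * EGen (GKV i))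
      (q ^ (- pairing (alpha i) (alpha j)) *: EGen (GF j))
  | Ueq_EF i j :
      Ueq (EGen (GE i) * EGen (GF j) - EGen (GF j) * EGen (GE i))
          ((i == j)%:R / (q - q^-1) *: (EGen (GK i) - EGen (GKV i)))
  | Ueq_serreE1 (i j : idx r) : `|i - j|%N = 1%N ->
      Ueq (EGen (GE i) * EGen (GE i) * EGen (GE j)
             + EGen (GE j) * EGen (GE i) * EGen (GE i))
          (qint 2 *: (EGen (GE i) * EGen (GE j) * EGen (GE i)))
  | Ueq_serreE0 (i j : idx r) : (1 < `|i - j|)%N ->
      Ueq (EGen (GE i) * EGen (GE j)) (EGen (GE j) * EGen (GE i))
  | Ueq_serreF1 (i j : idx r) : `|i - j|%N = 1%N ->
      Ueq (EGen (GF i) * EGen (GF i) * EGen (GF j)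
             + EGen (GF j) * EGen (GF i) * EGen (GF i))
          (qint 2 *: (EGen (GF i) * EGen (GF j) * EGen (GF i)))
  | Ueq_serreF0 (i j : idx r) : (1 < `|i - j|)%N ->
      Ueq (EGen (GF i) * EGen (GF j)) (EGen (GF j) * EGen (GF i)).

HB.instance Definition _ r := gen_eqMixin (expr r).
HB.instance Definition _ r := gen_choiceMixin (expr r).

Definition Ueqb r (x y : expr r) : bool := `[< Ueq x y >].

Lemma Ueqb_refl r : reflexive (@Ueqb r).
Proof. by move=> x; apply/asboolP; exact: Ueq_refl. Qed.

Lemma Ueqb_sym r : symmetric (@Ueqb r).
Proof. by move=> x y; apply/asboolP/asboolP; apply: Ueq_sym. Qed.

Lemma Ueqb_trans r : transitive (@Ueqb r).
Proof.
move=> y x z /asboolP xy /asboolP yz; apply/asboolP.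
exact: Ueq_trans xy yz.
Qed.

Canonical Ueqb_equiv r :=
  EquivRel (@Ueqb r) (@Ueqb_refl r) (@Ueqb_sym r) (@Ueqb_trans r).

Definition U r : Type := {eq_quot (@Ueqb r)}.

HB.instance Definition _ r := EqQuotient.on (U r).
HB.instance Definition _ r := Choice.on (U r).

Section QuotientAlgebra.
Variable r : nat.
Local Notation pi := (\pi_(U r)).

Lemma U_eqP (x y : expr r) : Ueq x y -> pi x = pi y.
Proof. by move=> xy; apply/eqmodP/asboolP. Qed.

Lemma U_reprP (x : expr r) : Ueq (repr (pi x)) x.
Proof. by apply/asboolP; have /eqmodP := reprK (pi x). Qed.

Definition Uconst (c : Qq) : U r := pi (EConst c).
Definition Uadd (x y : U r) : U r := pi (repr x + repr y)%expr.
Definition Umul (x y : U r) : U r := pi (repr x * repr y)%expr.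

Lemma UaddE x y : Uadd (pi x) (pi y) = pi (x + y)%expr.
Proof. by apply: U_eqP; apply: Ueq_add; exact: U_reprP. Qed.

Lemma UmulE x y : Umul (pi x) (pi y) = pi (x * y)%expr.
Proof. by apply: U_eqP; apply: Ueq_mul; exact: U_reprP. Qed.

Definition Uopp (x : U r) : U r := Umul (Uconst (-1)) x.
Definition Uscale (c : Qq) (x : U r) : U r := Umul (Uconst c) x.

Lemma UaddA : associative Uadd.
Proof.
elim/quotW=> x; elim/quotW=> y; elim/quotW=> z.
rewrite (UaddE y) (UaddE x) (UaddE x) (UaddE (x + y)%expr).
by apply: U_eqP; exact: Ueq_addA.
Qed.

Lemma UaddC : commutative Uadd.
Proof.
by elim/quotW=> x; elim/quotW=> y; rewrite !UaddE; apply: U_eqP; exact: Ueq_addC.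
Qed.

Lemma Uadd0 : left_id (Uconst 0) Uadd.
Proof. by elim/quotW=> x; rewrite UaddE; apply: U_eqP; exact: Ueq_add0. Qed.

Lemma UmulA : associative Umul.
Proof.
elim/quotW=> x; elim/quotW=> y; elim/quotW=> z.
rewrite (UmulE y) (UmulE x) (UmulE x) (UmulE (x * y)%expr).
by apply: U_eqP; exact: Ueq_mulA.
Qed.

Lemma Umul1 : left_id (Uconst 1) Umul.
Proof. by elim/quotW=> x; rewrite UmulE; apply: U_eqP; exact: Ueq_mul1. Qed.

Lemma UconstC c x : Umul (Uconst c) x = Umul x (Uconst c).
Proof.
by elim/quotW: x => x; rewrite !UmulE; apply: U_eqP; exact: Ueq_constC.
Qed.

Lemma Umulr1 : right_id (Uconst 1) Umul.
Proof. by move=> x; rewrite -UconstC Umul1. Qed.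

Lemma UmulDl : left_distributive Umul Uadd.
Proof.
elim/quotW=> x; elim/quotW=> y; elim/quotW=> z.
rewrite (UaddE x) (UmulE x) (UmulE y) (UaddE (x * z)%expr) UmulE.
by apply: U_eqP; exact: Ueq_mulDl.
Qed.

Lemma UmulDr : right_distributive Umul Uadd.
Proof.
elim/quotW=> z; elim/quotW=> x; elim/quotW=> y.
rewrite (UaddE x) (UmulE z x) (UmulE z y) (UaddE (z * x)%expr) UmulE.
by apply: U_eqP; exact: Ueq_mulDr.
Qed.

Lemma UconstD : {morph Uconst : c d / c + d >-> Uadd c d}.
Proof. by move=> c d; rewrite UaddE; apply: U_eqP; exact: Ueq_constD. Qed.

Lemma UconstM : {morph Uconst : c d / c * d >-> Umul c d}.
Proof. by move=> c d; rewrite UmulE; apply: U_eqP; exact: Ueq_constM. Qed.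

Lemma UaddN : left_inverse (Uconst 0) Uopp Uadd.
Proof.
move=> x; rewrite -[X in Uadd _ X]Umul1 -UmulDl -UconstD addNr.
by elim/quotW: x => x; rewrite UmulE; apply: U_eqP; exact: Ueq_mul0.
Qed.

(* the counit, used to see that U is not the zero ring *)
Fixpoint counit (x : expr r) : Qq :=
  match x with
  | EGen (GE _) | EGen (GF _) => 0
  | EGen (GK _) | EGen (GKV _) => 1
  | EConst c => c
  | EAdd x y => counit x + counit y
  | EMul x y => counit x * counit y
  end.

Lemma counitP x y : Ueq x y -> counit x = counit y.
Proof.
elim=> {x y}.
- by [].
- by move=> x y _ ->.
- by move=> x y z _ -> _ ->.
- by move=> x x' y y' _ /= -> _ ->.
- by move=> x x' y y' _ /= -> _ ->.
- by move=> x y z; exact: addrA.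
- by move=> x y; exact: addrC.
- by move=> x; exact: add0r.
- by move=> x y z; exact: mulrA.
- by move=> x; exact: mul1r.
- by move=> x; exact: mul0r.
- by move=> x y z; exact: mulrDl.
- by move=> x y z; exact: mulrDr.
- by [].
- by [].
- by move=> c x; exact: mulrC.
- by move=> i; exact: mul1r.
- by move=> i; exact: mul1r.
- by [].
- by move=> i j /=; rewrite !mulr0 mul0r.
- by move=> i j /=; rewrite !mulr0 mul0r.
- by move=> i j /=; rewrite mulr1 subrr !mulr0 addr0.
- by move=> i j _ /=; rewrite !mulr0 addr0.
- by [].
- by move=> i j _ /=; rewrite !mulr0 addr0.
- by [].
Qed.

Lemma Uoner_neq0 : Uconst 1 != Uconst 0.
Proof.
apply/negP => /eqP /eqmodP /asboolP /counitP /= /eqP.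
by rewrite oner_eq0.
Qed.

HB.instance Definition _ :=
  GRing.isZmodule.Build (U r) UaddA UaddC Uadd0 UaddN.
HB.instance Definition _ := GRing.Zmodule_isNzRing.Build (U r)
  UmulA Umul1 Umulr1 UmulDl UmulDr Uoner_neq0.

Lemma UscaleA a b (x : U r) : Uscale a (Uscale b x) = Uscale (a * b) x.
Proof. by rewrite /Uscale UmulA UconstM. Qed.

Lemma Uscale1 : left_id 1 Uscale.
Proof. exact: Umul1. Qed.

Lemma UscaleDr : right_distributive Uscale +%R.
Proof. by move=> c; exact: UmulDr. Qed.

Lemma UscaleDl (x : U r) : {morph Uscale^~ x : a b / a + b}.
Proof. by move=> a b; rewrite /Uscale UconstD; exact: UmulDl. Qed.

HB.instance Definition _ := GRing.Zmodule_isLmodule.Build Qq (U r)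
  UscaleA Uscale1 UscaleDr UscaleDl.

Lemma UscaleAl c (x y : U r) : c *: (x * y) = (c *: x) * y.
Proof. exact: UmulA. Qed.

HB.instance Definition _ := GRing.Lmodule_isLalgebra.Build Qq (U r) UscaleAl.

Lemma UscaleAr c (x y : U r) : c *: (x * y) = x * (c *: y).
Proof.
by rewrite -[LHS]/(Umul _ (Umul x y)) UmulA UconstC -UmulA.
Qed.

HB.instance Definition _ := GRing.Lalgebra_isAlgebra.Build Qq (U r) UscaleAr.

End QuotientAlgebra.

Definition E r (i : idx r) : U r := \pi_(U r) (EGen (GE i)).
Definition F r (i : idx r) : U r := \pi_(U r) (EGen (GF i)).
Definition K r (i : idx r) : U r := \pi_(U r) (EGen (GK i)).
Definition KV r (i : idx r) : U r := \pi_(U r) (EGen (GKV i)).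

(* the subalgebra generated by S, over the ring of the scalars satisfying C *)
Inductive subalg r (C : Qq -> Prop) (S : U r -> Prop) : U r -> Prop :=
  | subalg_gen x : S x -> subalg C S x
  | subalg_const c : C c -> subalg C S c%:A
  | subalg_add x y : subalg C S x -> subalg C S y -> subalg C S (x + y)
  | subalg_mul x y : subalg C S x -> subalg C S y -> subalg C S (x * y).

Definition any_scalar (c : Qq) : Prop := True.

Definition Uplus r : U r -> Prop :=
  subalg any_scalar (fun x => exists i, x = E i).
Definition Uzero r : U r -> Prop :=
  subalg any_scalar (fun x => exists i, x = K i \/ x = KV i).
Definition Uminus r : U r -> Prop :=
  subalg any_scalar (fun x => exists i, x = F i).

(* the weight space of weight - mu in U^- *)
Definition Uminus_wt r (mu : NPi r) (x : U r) : Prop :=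
  Uminus x /\
  forall i, K i * x * KV i = q ^ (- pairing (alpha i) (weight mu)) *: x.

Definition divpow r (i : idx r) (a : nat) : U r := (qfact a)^-1 *: F i ^+ a.

Definition UminusA r : U r -> Prop :=
  subalg is_laurent (fun x => exists i a, x = divpow i a).

Definition ki r (i : idx r) : U r := K i * KV (rev_ord i).
Definition kiV r (i : idx r) : U r := K (rev_ord i) * KV i.
Definition ei r (i : idx r) : U r := E i + KV i * F (rev_ord i).
Definition fi r (i : idx r) : U r := F i * KV (rev_ord i) + E (rev_ord i).
Definition ti r : U r :=
  E (idx0 r) + q *: (F (idx0 r) * KV (idx0 r)) + KV (idx0 r).

Definition Ui r : U r -> Prop :=
  subalg any_scalar (fun x => x = ti r \/
    exists2 i, idx_pos i & [\/ x = ki i, x = kiV i, x = ei i | x = fi i]).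

(* f restricts to an anti-linear involutive ring automorphism of D *)
Record antilinear_involution r (D : U r -> Prop) (f : U r -> U r) : Prop := {
  bar_closed : forall x, D x -> D (f x);
  bar1 : f 1 = 1;
  barD : forall x y, D x -> D y -> f (x + y) = f x + f y;
  barM : forall x y, D x -> D y -> f (x * y) = f x * f y;
  barZ : forall c x, D x -> f (c *: x) = qbar c *: f x;
  barK : forall x, D x -> f (f x) = x
}.

Definition is_bar r (psi : U r -> U r) : Prop :=
  antilinear_involution (fun=> True) psi /\
  forall i, [/\ psi (E i) = E i, psi (F i) = F i & psi (K i) = KV i].

(* The values of psii outside of U^imath are irrelevant. *)
Definition is_bari r (psii : U r -> U r) : Prop :=
  [/\ antilinear_involution (@Ui r) psii,
      psii (ti r) = ti r &
      forall i, idx_pos i ->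
        [/\ psii (ei i) = ei i, psii (fi i) = fi i & psii (ki i) = kiV i]].

(* the subspace U^+ U^0 \sum_(ht mu >= N) U^-_(-mu) *)
Inductive Ufilt r (N : nat) : U r -> Prop :=
  | Ufilt0 : Ufilt N 0
  | UfiltD u v w mu y : Uplus u -> Uzero v -> Uminus_wt mu w ->
      (N <= ht mu)%N -> Ufilt N y -> Ufilt N (u * v * w + y).

(* An element of the completion is represented by a sequence of U which is
   Cauchy for the filtration Ufilt; two such sequences represent the same
   element when their difference tends to 0, and products are computed
   termwise. *)
Definition eq_completion r (x y : nat -> U r) : Prop :=
  forall N, exists n0, forall n, (n0 <= n)%N -> Ufilt N (x n - y n).

(* the sum of the Y mu with ht mu <= n, which all have mu i <= n *)
Definition partial_sum r (Y : NPi r -> U r) (n : nat) : U r :=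
  \sum_(m : {ffun idx r -> 'I_n.+1} | (ht [ffun i => m i : nat] <= n)%N)
    Y [ffun i => m i : nat].

(* [Y mu] is the component of weight - mu of the intertwiner. *)
Record is_intertwiner r (psi psii : U r -> U r) (Y : NPi r -> U r) : Prop := {
  intertwiner_wt : forall mu, Uminus_wt mu (Y mu);
  intertwiner0 : Y [ffun=> 0%N] = 1;
  intertwinerP : forall u, Ui u ->
    eq_completion (fun n => psii u * partial_sum Y n)
                  (fun n => partial_sum Y n * psi u)
}.

(* Main.v *)
(* In a tensor power M of the exterior algebra of the natural representation, let v and w be tensor
   products of highest, respectively lowest, weight vectors of the same exterior powers, and let L be
   the lattice generated from w by the divided powers of the E_i; it is also the one generated from v
   by the divided powers of the F_i.  Then Upsilon w = w, and every weight vector x in L is of the form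
   psi(u) w with u in U^imath and psi_imath(u) w in L: the divided powers of the E_i are the leading
   terms, for the height of weights, of elements of U^imath fixed by psi_imath, so that x is reached by
   induction on its height.  Hence Upsilon x = Upsilon psi(u) w = psi_imath(u) Upsilon w =
   psi_imath(u) w lies in L.  For x = v, the weight components Upsilon_mu v belong to L, that is,
   Upsilon_mu v = y v for some y of weight - mu in U^-_A.  Finally Upsilon_mu = y when M and v are large
   enough, because elements of U^- of bounded height are then determined by their values at v: ordered
   monomials in the root vectors span U^-, and they have linearly independent images. *)

From HB Require Import structures.
Require Import Defs.
From mathcomp Require Import all_boot all_order all_algebra.
From mathcomp Require Import generic_quotient boolp ring zify mxtens.

Set Implicit Arguments.
Unset Strict Implicit.
Unset Printing Implicit Defensive.

Import Order.TTheory GRing.Theory Num.Theory.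
Local Open Scope ring_scope.

(** * Quantum integers over a field with a generic parameter *)

(** The obstacle is the generator t. Its plain divided powers are not integral: on the trivial
    module t acts as 1, hence t^2/[2] as 1/[2]. They are replaced by products of factors t -
    [c + 2i] divided by [a]!, which have the required leading term on weights whose pairing with
    alpha_0 has the parity of c + 1; this is why parity is recorded along with height. Each bar
    invariant element b must have the leading term E_j^(a) twice: in its own action, which governs
    psi_imath(u) w, and in that of psi(b), which governs psi(u) w. The two actions differ by
    exchanging q and K^-1 with q^-1 and K, so one computation with a parameter s in {v, v^-1} covers
    both. Neither irreducibility nor canonical bases enter: extremal vectors are joined by maximal
    divided powers, whose coefficients in tensor products are powers of q, and injectivity in
    bounded height is an explicit computation in exterior powers. As the modules are
    finite-dimensional, deep terms of the completion act by 0, and convergence becomes equality. *)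

Definition generic (K : fieldType) (v : K) : Prop :=
  v != 0 /\ forall n, (0 < n)%N -> v ^+ n != 1.

(** The ring Z[v, v^-1] in a form that has closure built in and gives direct inductions;
    [is_laurentP] converts to [is_laurent]. *)
Inductive laurent (K : fieldType) (v : K) : K -> Prop :=
  | laurent_intr z : laurent v z%:~R
  | laurent_gen : laurent v v
  | laurent_genV : laurent v v^-1
  | laurentD c d : laurent v c -> laurent v d -> laurent v (c + d)
  | laurentM c d : laurent v c -> laurent v d -> laurent v (c * d).

Section QuantumIntegers.
Variables (K : fieldType) (v : K).
Hypothesis gv : generic v.

Lemma gen_neq0 : v != 0. Proof. by case: gv. Qed.

Lemma genz_neq0 (z : int) : v ^ z != 0.
Proof. by rewrite expfz_neq0 ?gen_neq0. Qed.

Lemma genzD (m n : int) : v ^ (m + n) = v ^ m * v ^ n.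
Proof. by rewrite expfzDr ?gen_neq0. Qed.

Lemma genz_inj : injective (fun z : int => v ^ z).
Proof.
have P (m n : int) : v ^ m = v ^ n -> (m <= n) -> m = n.
  move=> e mn; have : v ^ (n - m) = 1.
    by rewrite genzD -e -genzD subrr.
  case En : (n - m) => [[|k]|k].
  - by move=> _; lia.
  - by move=> /eqP; rewrite -exprnP; case: gv => _ /(_ k.+1 isT) /negPf ->.
  - by lia.
move=> m n /= e; case/orP: (le_total m n) => mn; first exact: P.
by symmetry; apply: P.
Qed.

Lemma gen_subV_neq0 : v - v^-1 != 0.
Proof.
rewrite subr_eq0; apply/eqP => e.
have /genz_inj : v ^ 1%:Z = v ^ (-1) by rewrite expr1z -invr_expz expr1z.
by [].
Qed.

Lemma gen_sqrB1_neq0 : v * v - 1 != 0.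
Proof.
have := gen_subV_neq0; apply: contra => /eqP h.
by rewrite subr_eq0 -(inj_eq (mulfI gen_neq0)) divff ?gen_neq0 // -subr_eq0 h.
Qed.

Definition qi (z : int) : K := (v ^ z - v ^ (- z)) / (v - v^-1).

Lemma qi0 : qi 0 = 0.
Proof. by rewrite /qi oppr0 subrr mul0r. Qed.

Lemma qi1 : qi 1 = 1.
Proof. by rewrite /qi expr1z -invr_expz expr1z divff ?gen_subV_neq0. Qed.

Lemma qiN z : qi (- z) = - qi z.
Proof. by rewrite /qi opprK -mulNr opprB. Qed.

Lemma qi_neq0 z : z != 0 -> qi z != 0.
Proof.
move=> z0; rewrite mulf_neq0 ?invr_neq0 ?gen_subV_neq0 // subr_eq0.
apply/eqP => /genz_inj e; move: z0; rewrite (_ : z = 0) ?eqxx //.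
by clear -e; lia.
Qed.

Lemma qiS_neq0 (n : nat) : qi n.+1 != 0.
Proof. exact: qi_neq0. Qed.

Lemma qiD (m n : int) : qi (m + n) = v ^ n * qi m + v ^ (- m) * qi n.
Proof.
rewrite /qi opprD !genzD -!invr_expz.
have := genz_neq0 m; have := genz_neq0 n; have := gen_sqrB1_neq0; have := gen_neq0.
move: (v ^ m) (v ^ n) => x y q0 qq y0 x0.
by field; rewrite q0 qq y0 x0.
Qed.

Definition qf (a : nat) : K := \prod_(k < a) qi k.+1.

Lemma qf0 : qf 0 = 1. Proof. by rewrite /qf big_ord0. Qed.
Lemma qfS a : qf a.+1 = qi a.+1 * qf a.
Proof. by rewrite /qf big_ord_recr /= mulrC. Qed.

Lemma laurent0 : laurent v 0. Proof. exact: (laurent_intr _ 0). Qed.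
Lemma laurent1 : laurent v 1. Proof. exact: (laurent_intr _ 1). Qed.

Lemma laurentN c : laurent v c -> laurent v (- c).
Proof. by rewrite -mulN1r; apply: laurentM; exact: (laurent_intr _ (-1)). Qed.

Lemma laurentX c n : laurent v c -> laurent v (c ^+ n).
Proof.
by move=> lc; elim: n => [|n IH]; rewrite ?exprS; [exact: laurent1 | exact: laurentM].
Qed.

Lemma laurent_genz (z : int) : laurent v (v ^ z).
Proof.
case: z => n; rewrite ?NegzE -?exprnN -?exprVn; apply: laurentX.
  exact: laurent_gen.
exact: laurent_genV.
Qed.

(** Gaussian binomial with an arbitrary integer on top: in [sl2_formula] that argument involves a
    weight and may be negative. *)
Definition qbin (z : int) (t : nat) : K := \prod_(j < t) (qi (z - j%:Z) / qi j.+1).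

Lemma qbin0 z : qbin z 0 = 1. Proof. by rewrite /qbin big_ord0. Qed.

Lemma qbinS z t : qbin z t.+1 = qbin z t * (qi (z - t%:Z) / qi t.+1).
Proof. by rewrite /qbin big_ord_recr. Qed.

Lemma qbinSS z t : qbin (z + 1) t.+1 = qbin z t * (qi (z + 1) / qi t.+1).
Proof.
elim: t => [|t IH]; first by rewrite qbinS !qbin0 subr0.
rewrite qbinS IH qbinS (_ : z + 1 - t.+1%:Z = z - t%:Z); last by lia.
move: (qbin z t) (qi (z + 1)) (qi (z - t%:Z)) ((qi t.+1)^-1) ((qi t.+2)^-1) => a b c d e.
by ring.
Qed.

Lemma qbin_pascal z t :
  qbin (z + 1) t.+1 = v ^ t.+1 * qbin z t.+1 + v ^ (t%:Z - z) * qbin z t.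
Proof.
rewrite qbinSS qbinS.
rewrite (_ : z + 1 = (z - t%:Z) + t.+1%:Z); last by lia.
rewrite [in LHS]qiD opprB; have := qiS_neq0 t.
move: (qbin z t) (qi (z - t%:Z)) (v ^ (t%:Z - z)) (v ^ t.+1) (qi t.+1) => a b c d e e0.
by field.
Qed.

(** Pascal's rule is run upwards from [z = 0] for positive [z], and solved for its lower term for
    negative [z]; only powers of [v] are divided by. *)
Lemma laurent_qbin z t : laurent v (qbin z t).
Proof.
elim: t z => [|t IH] z; first by rewrite qbin0; exact: laurent1.
have Z0 : laurent v (qbin 0 t.+1).
  by rewrite /qbin big_ord_recl subr0 qi0 !mul0r; exact: laurent0.
case: (intP z) => [//|n|n].
- elim: n => [|n IHn].
    rewrite -[1%:Z]add0r qbin_pascal.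
    by apply: laurentD; apply: laurentM => //; exact: laurent_genz.
  rewrite -addn1 PoszD qbin_pascal.
  by apply: laurentD; apply: laurentM => //; exact: laurent_genz.
- have step (y : int) : laurent v (qbin (y + 1) t.+1) -> laurent v (qbin y t.+1).
    move=> h; have -> : qbin y t.+1 = v ^ (- t.+1%:Z) *
        (qbin (y + 1) t.+1 - v ^ (t%:Z - y) * qbin y t).
      rewrite qbin_pascal addrK mulrA -invr_expz mulVf ?mul1r //.
      exact: genz_neq0.
    apply: laurentM; first exact: laurent_genz.
    by apply/laurentD/laurentN/laurentM => //; exact: laurent_genz.
  elim: n => [|n IHn]; apply: step; first by [].
  by rewrite (_ : - (n.+2%:Z) + 1 = - (n.+1%:Z)) //; lia.
Qed.

End QuantumIntegers.

(** * The weight lattice *)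

Definition lo r (i : idx r) : 'I_(r.*2.+2) := widen_ord (leqnSn _) i.
Definition hi r (i : idx r) : 'I_(r.*2.+2) := lift ord0 i.

Section Lattice.
Variable r : nat.
Implicit Types (x y z : lattice r) (i j : idx r).

Lemma lo_val i : lo i = i :> nat. Proof. by []. Qed.
Lemma hi_val i : hi i = i.+1 :> nat. Proof. by []. Qed.

Lemma pairingDr x y z : pairing x (y + z) = pairing x y + pairing x z.
Proof. by rewrite -big_split; apply: eq_bigr => a _; rewrite !mxE mulrDr. Qed.

Lemma pairingNr x y : pairing x (- y) = - pairing x y.
Proof. by rewrite -sumrN; apply: eq_bigr => a _; rewrite !mxE mulrN. Qed.

Lemma pairingBr x y z : pairing x (y - z) = pairing x y - pairing x z.
Proof. by rewrite pairingDr pairingNr. Qed.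

Lemma pairing0r x : pairing x 0 = 0.
Proof. by apply: big1 => a _; rewrite !mxE mulr0. Qed.

Lemma pairingMnr x y n : pairing x (y *+ n) = pairing x y *+ n.
Proof. by elim: n => [|n IH]; rewrite ?pairing0r // !mulrS pairingDr IH. Qed.

Lemma pairingC x y : pairing x y = pairing y x.
Proof. by apply: eq_bigr => a _; rewrite mulrC. Qed.

Lemma pairing_alpha i x : pairing (alpha i) x = x 0 (lo i) - x 0 (hi i).
Proof.
have P (a : 'I_(r.*2.+2)) : \sum_b eps a 0 b * x 0 b = x 0 a.
  rewrite (bigD1 a) //= big1 ?addr0 => [|b ba]; rewrite !mxE !eqxx /= ?mul1r //.
  by rewrite (negPf ba) mul0r.
rewrite /pairing -(P (lo i)) -(P (hi i)) -sumrB.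
by apply: eq_bigr => a _; rewrite /alpha !mxE mulrBl.
Qed.

Lemma alphaE i (a : 'I_(r.*2.+2)) :
  alpha i 0 a = (a == i :> nat)%:R - (a == i.+1 :> nat)%:R.
Proof. by rewrite /alpha !mxE eqxx /=. Qed.

Lemma cartan i j : pairing (alpha i) (alpha j) =
  (i == j)%:R *+ 2 - (i == j.+1 :> nat)%:R - (j == i.+1 :> nat)%:R.
Proof.
rewrite pairing_alpha !alphaE lo_val hi_val eqSS (eq_sym i.+1) -val_eqE /=.
by rewrite mulr2n; lia.
Qed.

Lemma cartan_diag i : pairing (alpha i) (alpha i) = 2.
Proof. by rewrite cartan eqxx; lia. Qed.

Lemma cartan_adj i j : (`|i - j|%N = 1)%N -> pairing (alpha i) (alpha j) = -1.
Proof.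
move=> h; rewrite cartan; have -> : (i == j) = false by rewrite -val_eqE /=; lia.
by lia.
Qed.

Lemma cartan_far i j : (1 < `|i - j|)%N -> pairing (alpha i) (alpha j) = 0.
Proof.
move=> h; rewrite cartan; have -> : (i == j) = false by rewrite -val_eqE /=; lia.
by lia.
Qed.

(** The linear form with value 1 on every simple root: it extends the height to the whole weight
    lattice, so that weights of modules can be compared. *)
Definition hgt x : int := - \sum_a x 0 a * (a : nat)%:Z.

Lemma hgtD x y : hgt (x + y) = hgt x + hgt y.
Proof.
rewrite /hgt -opprD -big_split; congr (- _).
by apply: eq_bigr => a _; rewrite !mxE mulrDl.
Qed.

Lemma hgtN x : hgt (- x) = - hgt x.
Proof. by rewrite /hgt opprK -sumrN; apply: eq_bigr => a _; rewrite !mxE mulNr opprK. Qed.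

Lemma hgt0 : hgt 0 = 0.
Proof. by rewrite /hgt big1 ?oppr0 // => a _; rewrite !mxE mul0r. Qed.

Lemma hgtMn x n : hgt (x *+ n) = hgt x *+ n.
Proof. by elim: n => [|n IH]; rewrite ?hgt0 // !mulrS hgtD IH. Qed.

Lemma hgt_alpha i : hgt (alpha i) = 1.
Proof.
rewrite /hgt (bigD1 (lo i)) //= (bigD1 (hi i)) /=; last first.
  by rewrite -val_eqE /= /bump; lia.
rewrite big1 => [|a /andP [h1 h2]]; rewrite !alphaE ?lo_val ?hi_val ?eqxx.
  by rewrite (gtn_eqF (ltnSn i)) (ltn_eqF (ltnSn i)) /bump /= add1n; lia.
by move: h1 h2; rewrite -!val_eqE /= => /negPf -> /negPf ->; rewrite subrr mul0r.
Qed.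

End Lattice.

(** * Weight representations by matrices *)

(** A basis of weight vectors is part of the data. The [K_i] are then the diagonal matrices read off
    from [wt], and their relations with [E_i] and [F_i] become the shift conditions [rE_wt] and
    [rF_wt]. *)
Record repn (K : fieldType) (v : K) (r : nat) := Repn {
  dim : nat;
  wt : 'I_dim -> lattice r;
  rE : idx r -> 'M[K]_dim;
  rF : idx r -> 'M[K]_dim;
  rE_wt : forall i a b, rE i a b != 0 -> wt a = wt b + alpha i;
  rF_wt : forall i a b, rF i a b != 0 -> wt a = wt b - alpha i;
  rEF : forall i j, rE i *m rF j - rF j *m rE i =
    (i == j)%:R *: diag_mx (\row_a qi v (pairing (alpha i) (wt a)));
  rserreE1 : forall i j : idx r, `|i - j|%N = 1%N ->
    rE i *m (rE i *m rE j) + rE j *m (rE i *m rE i) =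
    (v + v^-1) *: (rE i *m (rE j *m rE i));
  rserreE0 : forall i j : idx r, (1 < `|i - j|)%N -> rE i *m rE j = rE j *m rE i;
  rserreF1 : forall i j : idx r, `|i - j|%N = 1%N ->
    rF i *m (rF i *m rF j) + rF j *m (rF i *m rF i) =
    (v + v^-1) *: (rF i *m (rF j *m rF i));
  rserreF0 : forall i j : idx r, (1 < `|i - j|)%N -> rF i *m rF j = rF j *m rF i
}.

Section Diagonal.
Variables (K : fieldType) (v : K) (r : nat) (M : repn v r).
Implicit Types f g : lattice r -> K.

Definition dg f : 'M[K]_(dim M) := diag_mx (\row_a f (wt a)).

Lemma dgM f g : dg f *m dg g = dg (fun x => f x * g x).
Proof. by rewrite /dg mulmx_diag; congr diag_mx; apply/rowP => a; rewrite !mxE. Qed.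

Lemma dgC f g : dg f *m dg g = dg g *m dg f.
Proof. by rewrite !dgM; congr diag_mx; apply/rowP => a; rewrite !mxE mulrC. Qed.

Lemma eq_dg f g : f =1 g -> dg f = dg g.
Proof. by move=> fg; congr diag_mx; apply/rowP => a; rewrite !mxE fg. Qed.

Lemma dg1 : dg (fun=> 1) = 1%:M.
Proof. by rewrite -diag_const_mx; congr diag_mx; apply/rowP => a; rewrite !mxE. Qed.

Lemma dgE f i : dg f *m rE M i = rE M i *m dg (fun x => f (x + alpha i)).
Proof.
apply/matrixP => a b; rewrite mul_diag_mx mul_mx_diag !mxE mulrC.
have [->|/rE_wt ->] := eqVneq (rE M i a b) 0; first by rewrite !mul0r.
by [].
Qed.

Lemma dgF f i : dg f *m rF M i = rF M i *m dg (fun x => f (x - alpha i)).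
Proof.
apply/matrixP => a b; rewrite mul_diag_mx mul_mx_diag !mxE mulrC.
have [->|/rF_wt ->] := eqVneq (rF M i a b) 0; first by rewrite !mul0r.
by [].
Qed.

Definition rK i := dg (fun x => v ^ pairing (alpha i) x).
Definition rKV i := dg (fun x => v ^ (- pairing (alpha i) x)).

Lemma rEF_dg i j : rE M i *m rF M j - rF M j *m rE M i =
  (i == j)%:R *: dg (fun x => qi v (pairing (alpha i) x)).
Proof. by rewrite rEF. Qed.

End Diagonal.

(** * Tensor products of weight representations *)

Section TensorAlgebra.
Variable K : fieldType.

Lemma tensmxDl m n p s (A B : 'M[K]_(m, n)) (C : 'M[K]_(p, s)) :
  (A + B) *t C = A *t C + B *t C.
Proof. by apply/matrixP => i j; rewrite !mxE mulrDl. Qed.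

Lemma tensmxDr m n p s (A : 'M[K]_(m, n)) (B C : 'M[K]_(p, s)) :
  A *t (B + C) = A *t B + A *t C.
Proof. by apply/matrixP => i j; rewrite !mxE mulrDr. Qed.

Lemma tensmxZl m n p s c (A : 'M[K]_(m, n)) (C : 'M[K]_(p, s)) :
  (c *: A) *t C = c *: (A *t C).
Proof. by apply/matrixP => i j; rewrite !mxE mulrA. Qed.

Lemma tensmxZr m n p s c (A : 'M[K]_(m, n)) (C : 'M[K]_(p, s)) :
  A *t (c *: C) = c *: (A *t C).
Proof. by apply/matrixP => i j; rewrite !mxE mulrCA. Qed.

Variable v : K.
Hypothesis v0 : v != 0.

(* [x + X] and [y + Y] are the images of two generators under a comultiplication;
   the hypotheses are those produced by the commutation of [K_i] with [F_j]. *)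
Lemma serre_add n (x y X Y : 'M[K]_n) :
  x *m X = v ^+ 2 *: (X *m x) -> x *m Y = v^-1 *: (Y *m x) ->
  y *m X = v^-1 *: (X *m y) ->
  x *m (x *m y) + y *m (x *m x) = (v + v^-1) *: (x *m (y *m x)) ->
  X *m (X *m Y) + Y *m (X *m X) = (v + v^-1) *: (X *m (Y *m X)) ->
  (x + X) *m ((x + X) *m (y + Y)) + (y + Y) *m ((x + X) *m (x + X)) =
  (v + v^-1) *: ((x + X) *m ((y + Y) *m (x + X))).
Proof.
move=> xX xY yX sA sB.
have xX' z : x *m (X *m z) = v ^+ 2 *: (X *m (x *m z)).
  by rewrite mulmxA xX -scalemxAl -mulmxA.
have xY' z : x *m (Y *m z) = v^-1 *: (Y *m (x *m z)).
  by rewrite mulmxA xY -scalemxAl -mulmxA.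
have yX' z : y *m (X *m z) = v^-1 *: (X *m (y *m z)).
  by rewrite mulmxA yX -scalemxAl -mulmxA.
rewrite !mulmxDl !mulmxDr.
(* All cubic monomials are sorted with capitals on the left; the claim is then linear in independent
   unknowns, modulo the two Serre relations. *)
do 4 rewrite ?xX' ?xY' ?yX' ?xX ?xY ?yX -?scalemxAr.
move: sA sB.
move: (x *m (x *m y)) (y *m (x *m x)) (x *m (y *m x)) => a1 a2 a3.
move: (X *m (X *m Y)) (Y *m (X *m X)) (X *m (Y *m X)) => b1 b2 b3.
move: (X *m (x *m Y)) (X *m (x *m y)) (X *m (y *m x)) (X *m (X *m y)) => c1 c2 c3 c4.
move: (Y *m (x *m x)) (X *m (Y *m x)) (Y *m (X *m x)) => c5 c6 c7.
move=> /eqP; rewrite -subr_eq0 => /eqP sA /eqP; rewrite -subr_eq0 => /eqP sB.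
apply/eqP; rewrite -subr_eq0 -sA; apply/eqP.
apply/matrixP => i j; move/matrixP/(_ i j): sB; rewrite !mxE => sB.
by rewrite -[RHS]addr0 -sB; field.
Qed.

Lemma commute_add n (x y X Y : 'M[K]_n) :
  x *m Y = Y *m x -> y *m X = X *m y -> x *m y = y *m x -> X *m Y = Y *m X ->
  (x + X) *m (y + Y) = (y + Y) *m (x + X).
Proof.
move=> xY yX xy XY; rewrite !mulmxDl !mulmxDr xY xy XY yX.
by rewrite addrACA; congr (_ + _); rewrite addrC.
Qed.

End TensorAlgebra.

Section KCommutation.
Variables (K : fieldType) (v : K) (r : nat) (M : repn v r).
Hypothesis gv : generic v.

Lemma dgZ c (f : lattice r -> K) : dg M (fun x => c * f x) = c *: dg M f.
Proof. by rewrite /dg -linearZ; congr diag_mx; apply/rowP => a; rewrite !mxE. Qed.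

Lemma rKE i j : rK M i *m rE M j = v ^ pairing (alpha i) (alpha j) *: (rE M j *m rK M i).
Proof.
rewrite /rK dgE scalemxAr -dgZ; congr (_ *m _); apply: eq_dg => x.
by rewrite pairingDr genzD // mulrC.
Qed.

Lemma rKF i j : rK M i *m rF M j = v ^ (- pairing (alpha i) (alpha j)) *: (rF M j *m rK M i).
Proof.
rewrite /rK dgF scalemxAr -dgZ; congr (_ *m _); apply: eq_dg => x.
by rewrite pairingBr genzD // mulrC.
Qed.

Lemma rKVE i j :
  rKV M i *m rE M j = v ^ (- pairing (alpha i) (alpha j)) *: (rE M j *m rKV M i).
Proof.
rewrite /rKV dgE scalemxAr -dgZ; congr (_ *m _); apply: eq_dg => x.
by rewrite pairingDr opprD genzD // mulrC.
Qed.

Lemma rKVF i j : rKV M i *m rF M j = v ^ pairing (alpha i) (alpha j) *: (rF M j *m rKV M i).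
Proof.
rewrite /rKV dgF scalemxAr -dgZ; congr (_ *m _); apply: eq_dg => x.
by rewrite pairingBr opprB genzD.
Qed.

Lemma rKKV i : rK M i *m rKV M i = 1%:M.
Proof.
rewrite /rK /rKV dgM -dg1; apply: eq_dg => x.
by rewrite -genzD // subrr.
Qed.

Lemma rKVK i : rKV M i *m rK M i = 1%:M.
Proof. by rewrite dgC; exact: rKKV. Qed.

End KCommutation.

Opaque tensmx.

Section Tensor.
Variables (K : fieldType) (v : K) (r : nat) (M N : repn v r).
Hypothesis gv : generic v.
Let v0 := gen_neq0 gv.

Definition twt (k : 'I_(dim M * dim N)) : lattice r :=
  wt (mxtens_unindex k).1 + wt (mxtens_unindex k).2.
(** The coproducts E -> E ⊗ 1 + K ⊗ E and F -> F ⊗ K^-1 + 1 ⊗ F; in each of them the two summands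
    q-commute, as [serre_add] requires. *)
Definition tE i := rE M i *t 1%:M + rK M i *t rE N i.
Definition tF i := rF M i *t rKV N i + 1%:M *t rF N i.

Lemma dg_tens (g h : lattice r -> K) : dg M g *t dg N h =
  diag_mx (\row_k (g (wt (mxtens_unindex k).1) * h (wt (mxtens_unindex k).2))).
Proof.
apply/matrixP => k l; case: (mxtens_indexP k) => a b; case: (mxtens_indexP l) => c d.
rewrite tensmxE !mxE !mxtens_indexK /=.
rewrite -(mulr_natr (g _)) -(mulr_natr (h _)) -[RHS]mulr_natr mulrACA; congr (_ * _).
rewrite -natrM mulnb -xpair_eqE; congr (_%:R); congr (nat_of_bool _).
by rewrite (can_eq (@mxtens_indexK _ _)).
Qed.

Lemma tens_wt (A : 'M[K]_(dim M)) (B : 'M[K]_(dim N)) f g k l :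
  (forall i j, A i j != 0 -> wt i = wt j + f) ->
  (forall i j, B i j != 0 -> wt i = wt j + g) ->
  (A *t B) k l != 0 -> twt k = twt l + (f + g).
Proof.
case: (mxtens_indexP k) => a1 a2; case: (mxtens_indexP l) => b1 b2.
rewrite tensmxE /twt !mxtens_indexK mulf_eq0 negb_or => hA hB /andP [hA' hB'] /=.
by rewrite (hA _ _ hA') (hB _ _ hB') addrACA.
Qed.

Lemma diag_wt (L : repn v r) (d : 'rV[K]_(dim L)) i j :
  diag_mx d i j != 0 -> wt i = wt j + 0.
Proof. by rewrite mxE; have [->|_] := eqVneq i j; rewrite ?addr0 // mulr0n eqxx. Qed.

Lemma one_wt (L : repn v r) i j : (1%:M : 'M[K]_(dim L)) i j != 0 -> wt i = wt j + 0.
Proof. by rewrite mxE; have [->|_] := eqVneq i j; rewrite ?addr0 // mulr0n eqxx. Qed.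

Lemma add_neq0 (x y : K) : x + y != 0 -> x != 0 \/ y != 0.
Proof. by have [->|] := eqVneq x 0; [rewrite add0r; right | left]. Qed.

Lemma tE_wt i a b : tE i a b != 0 -> twt a = twt b + alpha i.
Proof.
rewrite mxE => /add_neq0 [] h.
  by rewrite -[alpha i]addr0; apply: tens_wt h => // j k; [exact: rE_wt | exact: one_wt].
by rewrite -[alpha i]add0r; apply: tens_wt h => // j k; [exact: diag_wt | exact: rE_wt].
Qed.

Lemma tF_wt i a b : tF i a b != 0 -> twt a = twt b - alpha i.
Proof.
rewrite mxE => /add_neq0 [] h.
  by rewrite -[- alpha i]addr0; apply: tens_wt h => // j k; [exact: rF_wt | exact: diag_wt].
by rewrite -[- alpha i]add0r; apply: tens_wt h => // j k; [exact: one_wt | exact: rF_wt].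
Qed.

Lemma tEF i j : tE i *m tF j - tF j *m tE i =
  (i == j)%:R *: diag_mx (\row_k qi v (pairing (alpha i) (twt k))).
Proof.
have -> : diag_mx (\row_k qi v (pairing (alpha i) (twt k))) =
    dg M (fun x => qi v (pairing (alpha i) x)) *t rKV N i +
    rK M i *t dg N (fun x => qi v (pairing (alpha i) x)).
  rewrite /rK /rKV !dg_tens -linearD; congr diag_mx; apply/rowP => k; rewrite !mxE /twt.
  by rewrite pairingDr (addrC (pairing _ _)) qiD // addrC; congr (_ + _); exact: mulrC.
have -> : tE i *m tF j - tF j *m tE i =
    (rE M i *m rF M j - rF M j *m rE M i) *t rKV N j +
    rK M i *t (rE N i *m rF N j - rF N j *m rE N i).
  rewrite /tE /tF !mulmxDl !mulmxDr !tensmx_mul !mul1mx !mulmx1.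
  rewrite rKF // rKVE // (pairingC (alpha j)) tensmxZl tensmxZr.
  rewrite tensmxDl tensmxDr -!scaleN1r tensmxZl tensmxZr.
  move: (_ *t rKV N j) (rE M i *t _) (_ *t (_ *m rKV N j)) (rK M i *t _) => a b c d.
  move: (_ *t rKV N j) (rK M i *t _) (v ^ _) => e f x.
  by apply/matrixP => k l; rewrite !mxE; ring.
rewrite !rEF_dg scalerDr tensmxZl tensmxZr.
by have [<-//|_] := eqVneq i j; rewrite !scale0r.
Qed.

Lemma dgM3 (L : repn v r) f g : [/\
  dg L f *m (dg L f *m dg L g) = dg L (fun x => f x * f x * g x),
  dg L g *m (dg L f *m dg L f) = dg L (fun x => f x * f x * g x) &
  dg L f *m (dg L g *m dg L f) = dg L (fun x => f x * f x * g x)].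
Proof. by split; rewrite !dgM; apply: eq_dg => x; ring. Qed.

Lemma tserreE1 (i j : idx r) : `|i - j|%N = 1%N ->
  tE i *m (tE i *m tE j) + tE j *m (tE i *m tE i) =
  (v + v^-1) *: (tE i *m (tE j *m tE i)).
Proof.
move=> ij; have ji : `|j - i|%N = 1%N by rewrite distnC.
rewrite /tE ![rE M _ *t 1%:M + _]addrC; apply: (serre_add v0).
- by rewrite !tensmx_mul !mul1mx !mulmx1 rKE // cartan_diag tensmxZl.
- by rewrite !tensmx_mul !mul1mx !mulmx1 rKE // cartan_adj // tensmxZl.
- by rewrite !tensmx_mul !mul1mx !mulmx1 rKE // cartan_adj // tensmxZl.
- rewrite !tensmx_mul /rK; have [-> -> ->] := dgM3 M (fun x => v ^ pairing (alpha i) x)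
    (fun x => v ^ pairing (alpha j) x).
  by rewrite -tensmxDr rserreE1 // tensmxZr.
- by rewrite !tensmx_mul !mul1mx -tensmxDl rserreE1 // tensmxZl.
Qed.

Lemma tserreE0 (i j : idx r) : (1 < `|i - j|)%N -> tE i *m tE j = tE j *m tE i.
Proof.
move=> ij; have ji : (1 < `|j - i|)%N by rewrite distnC.
apply: commute_add; rewrite !tensmx_mul ?mul1mx ?mulmx1.
- by rewrite rKE // cartan_far // scale1r.
- by rewrite rKE // cartan_far // scale1r.
- by rewrite rserreE0.
- by rewrite rserreE0 //; congr (_ *t _); exact: dgC.
Qed.

Lemma tserreF1 (i j : idx r) : `|i - j|%N = 1%N ->
  tF i *m (tF i *m tF j) + tF j *m (tF i *m tF i) =
  (v + v^-1) *: (tF i *m (tF j *m tF i)).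
Proof.
move=> ij; have ji : `|j - i|%N = 1%N by rewrite distnC.
apply: (serre_add v0).
- by rewrite !tensmx_mul !mul1mx !mulmx1 rKVF // cartan_diag tensmxZr.
- by rewrite !tensmx_mul !mul1mx !mulmx1 rKVF // cartan_adj // tensmxZr.
- by rewrite !tensmx_mul !mul1mx !mulmx1 rKVF // cartan_adj // tensmxZr.
- rewrite !tensmx_mul /rKV.
  have [-> -> ->] := dgM3 N (fun x => v ^ (- pairing (alpha i) x))
    (fun x => v ^ (- pairing (alpha j) x)).
  by rewrite -tensmxDl rserreF1 // tensmxZl.
- by rewrite !tensmx_mul !mul1mx -tensmxDr rserreF1 // tensmxZr.
Qed.

Lemma tserreF0 (i j : idx r) : (1 < `|i - j|)%N -> tF i *m tF j = tF j *m tF i.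
Proof.
move=> ij; have ji : (1 < `|j - i|)%N by rewrite distnC.
apply: commute_add; rewrite !tensmx_mul ?mul1mx ?mulmx1.
- by rewrite rKVF // cartan_far // scale1r.
- by rewrite rKVF // cartan_far // scale1r.
- by rewrite rserreF0 //; congr (_ *t _); exact: dgC.
- by rewrite rserreF0.
Qed.

Definition tensor : repn v r := Repn tE_wt tF_wt tEF tserreE1 tserreE0 tserreF1 tserreF0.

End Tensor.

(** * The exterior algebra of the natural representation *)

Section Trivial.
Variables (K : fieldType) (v : K) (r : nat).

Definition trivial : repn v r.
refine (@Repn K v r 1 (fun=> 0) (fun=> 0) (fun=> 0) _ _ _ _ _ _ _);
  try by move=> *; rewrite ?mulmx0 ?addr0 ?scaler0.
- by move=> i a b; rewrite mxE eqxx.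
- by move=> i a b; rewrite mxE eqxx.
- move=> i j; rewrite mul0mx subrr; apply/matrixP => a b.
  by rewrite !mxE pairing0r qi0 mul0rn mulr0.
Defined.

End Trivial.

(** Basis of the exterior algebra: the set of occupied indices. No signs occur, because the
    generators replace an index by an adjacent one. *)
Notation state r := {ffun 'I_(r.*2.+2) -> bool}.

Section PartialMaps.
Variables (K : fieldType) (T : finType).

Definition ket (t : T) : 'cV[K]_#|T| := delta_mx (enum_rank t) 0.
Definition oket (o : option T) : 'cV[K]_#|T| := if o is Some t then ket t else 0.
Definition pmx (f : T -> option T) : 'M[K]_#|T| :=
  \matrix_(a, b) (f (enum_val b) == Some (enum_val a))%:R.

Lemma pmx_ket f t : pmx f *m ket t = oket (f t).
Proof.
apply/matrixP => a b; rewrite !mxE (bigD1 (enum_rank t)) //= big1 => [|c ct]; last first.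
  by rewrite !mxE (negPf ct) mulr0.
rewrite addr0 !mxE enum_rankK (ord1 b) !eqxx mulr1.
case: (f t) => [u|] /=; rewrite ?mxE //.
rewrite andbT; congr (nat_of_bool _)%:R.
by rewrite (inj_eq Some_inj) -(inj_eq enum_rank_inj) enum_valK eq_sym.
Qed.

Lemma ket_matrixP (A B : 'M[K]_#|T|) : (forall t, A *m ket t = B *m ket t) -> A = B.
Proof.
move=> AB; apply/matrixP => a b.
have := congr1 (fun x : 'cV_#|T| => x a 0) (AB (enum_val b)).
by rewrite /ket enum_valK -!colE !mxE.
Qed.

End PartialMaps.

Section Exterior.
Variables (K : fieldType) (v : K) (r : nat).
Implicit Types (S : state r) (i j : idx r).
Local Notation ket := (@ket K (state r)).

Definition put S i (b c : bool) : state r :=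
  [ffun a => if a == lo i then b else if a == hi i then c else S a].
Definition stF i S := if S (lo i) && ~~ S (hi i) then Some (put S i false true) else None.
Definition stE i S := if ~~ S (lo i) && S (hi i) then Some (put S i true false) else None.
Definition stwt S : lattice r := \row_a (S a)%:R.

Lemma hi_lo i : (hi i == lo i) = false.
Proof. by rewrite -val_eqE /= /bump; lia. Qed.

Lemma put_lo S i b c : put S i b c (lo i) = b.
Proof. by rewrite ffunE eqxx. Qed.

Lemma put_hi S i b c : put S i b c (hi i) = c.
Proof. by rewrite ffunE hi_lo eqxx. Qed.

Lemma stF_wt i S S' : stF i S = Some S' -> stwt S' = stwt S - alpha i.
Proof.
rewrite /stF; case: ifP => // /andP [h1 h2] [<-].
apply/rowP => a; rewrite !mxE ffunE.
rewrite -/(lo i) -/(hi i) !eqxx /=.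
have [->|_] := eqVneq a (lo i); first by rewrite h1 eq_sym hi_lo.
by have [->|_] := eqVneq a (hi i); rewrite ?(negPf h2) /= ?subr0 ?addr0 ?oppr0 //; lia.
Qed.

Lemma stE_wt i S S' : stE i S = Some S' -> stwt S' = stwt S + alpha i.
Proof.
rewrite /stE; case: ifP => // /andP [h1 h2] [<-].
apply/rowP => a; rewrite !mxE ffunE.
rewrite -/(lo i) -/(hi i) !eqxx /=.
have [->|_] := eqVneq a (lo i); first by rewrite (negPf h1) eq_sym hi_lo.
by have [->|_] := eqVneq a (hi i); rewrite ?h2 /= ?subr0 ?addr0 //; lia.
Qed.

Definition extE i := pmx K (stE i).
Definition extF i := pmx K (stF i).
Definition extwt (a : 'I_#|{: state r}|) : lattice r := stwt (enum_val a).

Lemma extE_wt i a b : extE i a b != 0 -> extwt a = extwt b + alpha i.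
Proof. by rewrite mxE; case: (_ =P Some _) => [/stE_wt e _|_]; [exact: e | rewrite eqxx]. Qed.

Lemma extF_wt i a b : extF i a b != 0 -> extwt a = extwt b - alpha i.
Proof. by rewrite mxE; case: (_ =P Some _) => [/stF_wt e _|_]; [exact: e | rewrite eqxx]. Qed.

Lemma extE_ket i S : extE i *m ket S = oket K (stE i S). Proof. exact: pmx_ket. Qed.
Lemma extF_ket i S : extF i *m ket S = oket K (stF i S). Proof. exact: pmx_ket. Qed.
Lemma extE_oket i o : extE i *m oket K o = oket K (obind (stE i) o).
Proof. by case: o => [S|]; rewrite ?extE_ket //= mulmx0. Qed.
Lemma extF_oket i o : extF i *m oket K o = oket K (obind (stF i) o).
Proof. by case: o => [S|]; rewrite ?extF_ket //= mulmx0. Qed.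

Lemma put_far S i b c a : a != lo i -> a != hi i -> put S i b c a = S a.
Proof. by rewrite ffunE => /negPf -> /negPf ->. Qed.

Lemma putC S i j b c d e : (1 < `|i - j|)%N -> put (put S i b c) j d e = put (put S j d e) i b c.
Proof.
move=> ij; apply/ffunP => a; rewrite !ffunE -!val_eqE /= /bump /=.
by repeat case: ifP => //; lia.
Qed.

Lemma far_put S i j b c : (1 < `|i - j|)%N ->
  (put S i b c (lo j) = S (lo j)) * (put S i b c (hi j) = S (hi j)).
Proof. by move=> ij; split; apply: put_far; rewrite -val_eqE /= /bump; lia. Qed.

Lemma extEE i : extE i *m extE i = 0.
Proof.
apply: ket_matrixP => S; rewrite -mulmxA mul0mx extE_ket extE_oket /stE /=.
by case: ifP => //= _; rewrite put_lo.
Qed.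

Lemma extFF i : extF i *m extF i = 0.
Proof.
apply: ket_matrixP => S; rewrite -mulmxA mul0mx extF_ket extF_oket /stF /=.
by case: ifP => //= _; rewrite put_lo.
Qed.

Lemma adj_put S i j b c d e : `|i - j|%N = 1%N ->
  put (put S i b c) j d e (lo i) = (if (i < j)%N then b else e) /\
  put (put S i b c) j d e (hi i) = (if (i < j)%N then d else c).
Proof.
move=> ij; rewrite !ffunE !eqxx -!val_eqE /= /bump !add1n !eqSS.
by case: (ltngtP i j) ij => [h|h|->]; rewrite ?distnn // => ij;
  do ![case: eqP => //]; lia.
Qed.

(** [E_i] empties [hi i] and fills [lo i], and [E_j] with [j] adjacent to [i] changes only one of
    these two places, so that [E_i] cannot act again. With [extEE], every monomial of the Serre
    relation vanishes separately. *)
Lemma extEEE i j : `|i - j|%N = 1%N -> extE i *m (extE j *m extE i) = 0.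
Proof.
move=> ij; apply: ket_matrixP => S.
rewrite -!mulmxA mul0mx extE_ket !extE_oket /stE /=.
do 2 case: ifP => //= _; have [-> ->] := adj_put S true false true false ij.
by case: (i < j)%N.
Qed.

Lemma extFFF i j : `|i - j|%N = 1%N -> extF i *m (extF j *m extF i) = 0.
Proof.
move=> ij; apply: ket_matrixP => S.
rewrite -!mulmxA mul0mx extF_ket !extF_oket /stF /=.
do 2 case: ifP => //= _; have [-> ->] := adj_put S false true false true ij.
by case: (i < j)%N.
Qed.

Lemma extE_far i j : (1 < `|i - j|)%N -> extE i *m extE j = extE j *m extE i.
Proof.
move=> ij; have ji : (1 < `|j - i|)%N by rewrite distnC.
apply: ket_matrixP => S; rewrite -!mulmxA !extE_ket !extE_oket /stE.
case ci : (~~ S (lo i) && S (hi i)); case cj : (~~ S (lo j) && S (hi j));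
  rewrite /= ?far_put ?ci ?cj //.
by rewrite putC.
Qed.

Lemma extF_far i j : (1 < `|i - j|)%N -> extF i *m extF j = extF j *m extF i.
Proof.
move=> ij; have ji : (1 < `|j - i|)%N by rewrite distnC.
apply: ket_matrixP => S; rewrite -!mulmxA !extF_ket !extF_oket /stF.
case ci : (S (lo i) && ~~ S (hi i)); case cj : (S (lo j) && ~~ S (hi j));
  rewrite /= ?far_put ?ci ?cj //.
by rewrite putC.
Qed.

Lemma extEF_neq i j : i != j -> extE i *m extF j = extF j *m extE i.
Proof.
move=> nij; apply: ket_matrixP => S; rewrite -!mulmxA extE_ket extF_ket extE_oket extF_oket.
have [ij|ij] : (1 < `|i - j|)%N \/ `|i - j|%N = 1%N by move: nij; rewrite -val_eqE /=; lia.
  have ji : (1 < `|j - i|)%N by rewrite distnC.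
  rewrite /stE /stF; case ci : (~~ S (lo i) && S (hi i)); case cj : (S (lo j) && ~~ S (hi j));
  rewrite /= ?far_put ?ci ?cj //.
  by rewrite putC.
have [e|e] : hi i = lo j \/ lo i = hi j.
  have [h|h] : (j = i.+1 :> nat) \/ (i = j.+1 :> nat) by lia.
    by left; apply: val_inj; rewrite /= h.
  by right; apply: val_inj; rewrite /= h.
  have -> : obind (stE i) (stF j S) = None.
    by rewrite /stF; case: ifP => //= _; rewrite /stE e put_lo andbF.
  have -> // : obind (stF j) (stE i S) = None.
  by rewrite /stE; case: ifP => //= _; rewrite /stF -e put_hi.
have -> : obind (stE i) (stF j S) = None.
  by rewrite /stF; case: ifP => //= _; rewrite /stE e put_hi.
have -> // : obind (stF j) (stE i S) = None.
by rewrite /stE; case: ifP => //= _; rewrite /stF -e put_lo andbF.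
Qed.

Lemma put_id S i b c : S (lo i) = b -> S (hi i) = c -> put S i b c = S.
Proof.
move=> <- <-; apply/ffunP => a; rewrite ffunE.
by case: eqVneq => [->//|_]; case: eqVneq => [->|].
Qed.

Lemma put_put S i b c d e : put (put S i b c) i d e = put S i d e.
Proof. by apply/ffunP => a; rewrite !ffunE; case: (a == lo i); case: (a == hi i). Qed.

Hypothesis gv : generic v.

Lemma extEF_eq i : extE i *m extF i - extF i *m extE i =
  diag_mx (\row_a qi v (pairing (alpha i) (extwt a))).
Proof.
apply: ket_matrixP => S.
have -> : diag_mx (\row_a qi v (pairing (alpha i) (extwt a))) *m ket S =
    qi v ((S (lo i))%:R - (S (hi i))%:R) *: ket S.
  apply/matrixP => a b; rewrite mul_diag_mx !mxE; case: eqP => [->|_]; rewrite ?mulr0 //.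
  by rewrite pairing_alpha /extwt enum_rankK !mxE.
rewrite mulmxBl -!mulmxA extE_ket extF_ket extE_oket extF_oket /stE /stF.
case h1: (S (lo i)); case h2: (S (hi i)); rewrite /= ?subr0 ?sub0r ?subrr ?qi0 ?scale0r //.
- by rewrite put_lo put_hi /= put_put put_id // qi1 // scale1r.
- by rewrite put_lo put_hi /= put_put put_id // qiN qi1 // scaleN1r.
Qed.

Lemma extEF i j : extE i *m extF j - extF j *m extE i =
  (i == j)%:R *: diag_mx (\row_a qi v (pairing (alpha i) (extwt a))).
Proof.
have [<-|ij] := eqVneq i j; first by rewrite scale1r extEF_eq.
by rewrite extEF_neq // subrr scale0r.
Qed.

Lemma extserreE1 i j : `|i - j|%N = 1%N ->
  extE i *m (extE i *m extE j) + extE j *m (extE i *m extE i) =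
  (v + v^-1) *: (extE i *m (extE j *m extE i)).
Proof. by move=> ij; rewrite mulmxA extEE extEEE // mul0mx mulmx0 addr0 scaler0. Qed.

Lemma extserreF1 i j : `|i - j|%N = 1%N ->
  extF i *m (extF i *m extF j) + extF j *m (extF i *m extF i) =
  (v + v^-1) *: (extF i *m (extF j *m extF i)).
Proof. by move=> ij; rewrite mulmxA extFF extFFF // mul0mx mulmx0 addr0 scaler0. Qed.

Definition exterior : repn v r :=
  Repn extE_wt extF_wt extEF extserreE1 extE_far extserreF1 extF_far.

Lemma dg_ket (f : lattice r -> K) S : dg exterior f *m ket S = f (stwt S) *: ket S.
Proof.
apply/matrixP => a b; rewrite mul_diag_mx !mxE; case: eqP => [->|_]; rewrite ?mulr0 //.
by congr (f _ * _); rewrite /= /extwt enum_rankK.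
Qed.

End Exterior.

(** * Root vectors *)

Lemma down_ind n (P : nat -> Prop) :
  P n -> (forall k, (k < n)%N -> P k.+1 -> P k) -> forall k, (k <= n)%N -> P k.
Proof.
move=> Pn IH k kn; rewrite -(subKn kn).
elim: (n - k)%N (leq_subr k n) => [|d IHd] dn; first by rewrite subn0.
apply: IH; first by lia.
by rewrite -subSn // subSS; apply: IHd; exact: ltnW.
Qed.

Section RootVectors.
Variables (K : fieldType) (v : K) (A : algType K) (f : nat -> A) (m : nat).
Hypothesis gv : generic v.
Hypothesis serre1 : forall i j, (i < m)%N -> (j < m)%N -> `|i - j|%N = 1%N ->
  f i * f i * f j + f j * f i * f i = (v + v^-1) *: (f i * f j * f i).
Hypothesis serre0 : forall i j, (i < m)%N -> (j < m)%N -> (1 < `|i - j|)%N ->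
  f i * f j = f j * f i.

Let v0 : v != 0 := gen_neq0 gv.

Definition qcom (x y : A) : A := x * y - v^-1 *: (y * x).

Fixpoint rootv_rec n d : A :=
  if d is d'.+1 then qcom (f (n - d)) (rootv_rec n d') else f n.
(* the root vector of weight [alpha_k + ... + alpha_n] *)
Definition rootv n k := rootv_rec n (n - k).

Lemma rootv_diag n : rootv n n = f n.
Proof. by rewrite /rootv subnn. Qed.

Lemma rootvE n k : (k < n)%N -> rootv n k = qcom (f k) (rootv n k.+1).
Proof.
move=> kn; rewrite /rootv -(prednK (n := n - k)) ?subn_gt0 // subnS /=.
by rewrite prednK ?subn_gt0 // subKn // ltnW.
Qed.

Lemma qcom_scale c x y z : x * z = z * x -> y * z = c *: (z * y) ->
  qcom x y * z = c *: (z * qcom x y).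
Proof.
move=> xz yz; rewrite /qcom mulrBl mulrBr -scalerAl -scalerAr scalerBr.
have -> : x * y * z = c *: (z * (x * y)) by rewrite -mulrA yz -scalerAr [x * (z * y)]mulrA xz -mulrA.
have -> : y * x * z = c *: (z * (y * x)) by rewrite -mulrA xz [y * (z * x)]mulrA yz -scalerAl -mulrA.
by rewrite !scalerA mulrC.
Qed.

Lemma qcom_comm x y z : x * z = z * x -> y * z = z * y -> qcom x y * z = z * qcom x y.
Proof. by move=> xz yz; rewrite (@qcom_scale 1) // ?scale1r. Qed.

Lemma qcom_serre a b : b * b * a + a * b * b = (v + v^-1) *: (b * a * b) ->
  qcom a b * b = v *: (b * qcom a b).
Proof.
move=> S; rewrite /qcom mulrBl mulrBr -scalerAl -scalerAr scalerBr scalerA divff // scale1r !mulrA.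
by apply/eqP; rewrite subr_eq addrAC eq_sym subr_eq -scalerDl -S addrC.
Qed.

(* Expanding [z = [a, [b, y]]] also as [[[a, b], y]] yields two expressions for [b * z]. *)
Lemma qcom_middle a b y x z : x = qcom b y -> z = qcom a x ->
  y * a = a * y -> b * b * a + a * b * b = (v + v^-1) *: (b * a * b) ->
  b * x = v *: (x * b) -> b * z = z * b.
Proof.
move=> xE zE0 ya S bx; have [w wE] : exists w, w = qcom a b by eexists.
have wb : w * b = v *: (b * w) by rewrite wE; exact: qcom_serre.
have byE : b * y = x + v^-1 *: (y * b) by rewrite xE subrK.
have zE : z = w * y - v^-1 *: (y * w).
  rewrite zE0 xE wE /qcom !mulrBr !mulrBl -!scalerAl -!scalerAr !mulrA.
  rewrite -ya -[b * y * a]mulrA ya mulrA !scalerBr !opprB !addrA.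
  by rewrite addrAC [RHS]addrAC; congr (_ + _); rewrite addrAC.
have zb : z * b = w * y * b - y * b * w.
  by rewrite zE mulrBl -scalerAl -[y * w * b]mulrA wb -scalerAr scalerA mulVf // scale1r mulrA.
have E1 : b * z = v^-1 *: (w * x - x * w) + v^-2 *: (z * b).
  rewrite [in LHS]zE mulrBr -scalerAr !mulrA.
  have -> : b * w = v^-1 *: (w * b) by rewrite wb scalerA mulVf // scale1r.
  rewrite -scalerAl -[w * b * y]mulrA byE -scalerBr zb mulrDr mulrDl -scalerAr -scalerAl !mulrA.
  rewrite opprD addrACA -scalerBr scalerDr scalerA; congr (_ + _ *: _).
  by rewrite expr2 invfM.
have E2 : w * x - x * w = v *: (z * b) - v^-1 *: (b * z).
  have xb : x * b = v^-1 *: (b * x) by rewrite bx scalerA mulVf // scale1r.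
  have -> : z * b = v^-1 *: (a * b * x) - v^-1 *: (x * a * b).
    by rewrite zE0 /qcom mulrBl -scalerAl -[a * x * b]mulrA xb -scalerAr mulrA.
  have -> : b * z = b * a * x - x * b * a.
    by rewrite zE0 /qcom mulrBr -scalerAr !mulrA bx -scalerAl scalerA mulVf // scale1r.
  rewrite wE /qcom mulrBl mulrBr -scalerAl -scalerAr !mulrA !scalerBr !scalerA divff // !scale1r.
  by rewrite !opprB addrACA [RHS]addrACA; congr (_ + _); rewrite addrC.
have h : (1 + v^-2) *: (b * z) = (1 + v^-2) *: (z * b).
  have e : v^-1 * v^-1 = v^-2 by rewrite expr2 invfM.
  rewrite scalerDl scale1r {1}E1 E2 scalerBr !scalerA mulVf // e scale1r.
  by rewrite addrAC subrK scalerDl scale1r.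
(* [1 + v^-2] divides [[4] = (v + v^-1)(v^2 + v^-2)], which is nonzero because [v] is not a root of
   unity. *)
have n0 : 1 + v^-2 != 0.
  have := qi_neq0 gv (z := 4) isT; apply: contraNneq => h0.
  have -> : qi v 4 = (v + v^-1) * (v ^+ 2 + v^-2).
    rewrite /qi (_ : v ^ (-4) = v^-1 ^+ 4) ?exprVn // -exprnP.
    have := gen_sqrB1_neq0 gv => nz; field.
    by rewrite v0 nz.
  have -> : v + v^-1 = v * (1 + v^-2) by field.
  by rewrite h0 mulr0 mul0r.
by have := congr1 (fun t => (1 + v^-2)^-1 *: t) h; rewrite !scalerA mulVf // !scale1r.
Qed.

Section Level.
Variable n : nat.
Hypothesis nm : (n < m)%N.

Lemma rootv_far j k : (j.+1 < k)%N -> (k <= n)%N -> rootv n k * f j = f j * rootv n k.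
Proof.
move=> jk kn; move: k kn jk.
apply: down_ind => [jn|k kn IH jk].
  by rewrite rootv_diag serre0 //; lia.
rewrite rootvE //; apply: qcom_comm; last by apply: IH; exact: ltnW.
by rewrite serre0 //; lia.
Qed.

(** Towards [f j], the root vector starting at [j + 1] behaves like [f j.+1], since the rest of it
    commutes with [f j]. *)
Lemma rootv_serre j : (j < n)%N ->
  f j * f j * rootv n j.+1 + rootv n j.+1 * f j * f j =
  (v + v^-1) *: (f j * rootv n j.+1 * f j).
Proof.
rewrite leq_eqVlt => /orP [/eqP jn|jn].
  by rewrite jn rootv_diag -jn serre1 //; lia.
have := serre1 (i := j) (j := j.+1); have := @rootv_far j j.+2 (leqnn _) jn.
rewrite (rootvE jn); move: (rootv n j.+2) (f j) (f j.+1) => y a b ya S.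
have {}S : a * a * b + b * a * a = (v + v^-1) *: (a * b * a) by apply: S; lia.
have E1 : a * a * (b * y) + (b * y) * a * a = (v + v^-1) *: (a * (b * y) * a).
  have -> : b * y * a * a = b * a * a * y.
    by rewrite -[b * y * a]mulrA ya mulrA -[b * a * y * a]mulrA ya mulrA.
  have -> : a * (b * y) * a = a * b * a * y by rewrite mulrA -mulrA ya mulrA.
  by rewrite mulrA -mulrDl S -scalerAl.
have E2 : a * a * (y * b) + (y * b) * a * a = (v + v^-1) *: (a * (y * b) * a).
  have -> : a * a * (y * b) = y * (a * a * b).
    by rewrite mulrA -[a * a * y]mulrA -ya mulrA -ya !mulrA.
  have -> : a * (y * b) * a = y * (a * b * a) by rewrite mulrA -ya !mulrA.
  have -> : y * b * a * a = y * (b * a * a) by rewrite !mulrA.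
  by rewrite -mulrDr S -scalerAr.
rewrite /qcom !(mulrBl, mulrBr) -!scalerAl -!scalerAr -!scalerAl addrACA -opprD.
by rewrite -scalerDr E1 E2 scalerBr !scalerA (mulrC v^-1).
Qed.

Lemma rootv_diagC j : (j < n)%N -> f j * rootv n j = v *: (rootv n j * f j).
Proof.
move=> jn; rewrite (rootvE jn); have := rootv_serre jn.
move: (rootv n j.+1) (f j) => y a S.
rewrite /qcom mulrBl mulrBr -scalerAl -scalerAr scalerBr scalerA divff // scale1r !mulrA.
by apply/eqP; rewrite subr_eq addrAC eq_sym subr_eq -scalerDl eq_sym addrC -S addrC eqxx.
Qed.

Lemma rootv_middle j k : (k < j)%N -> (j < n)%N -> f j * rootv n k = rootv n k * f j.
Proof.
move=> kj jn; have jm := ltn_trans jn nm.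
have base i : i.+1 = j -> f j * rootv n i = rootv n i * f j.
  move=> ij; apply: (@qcom_middle (f i) (f j) (rootv n j.+1) (rootv n j)).
  - exact: rootvE.
  - by rewrite -ij rootvE // ij; exact: ltnW.
  - by apply: rootv_far; lia.
  - by apply: serre1; lia.
  - exact: rootv_diagC.
have j0 : (0 < j)%N by lia.
have {}kj : (k <= j.-1)%N by lia.
move: k kj; apply: down_ind => [|k kj IH].
  by apply: base; lia.
have kn : (k < n)%N by lia.
by symmetry; rewrite (rootvE kn); apply: qcom_comm => //; apply: serre0; lia.
Qed.

(** Root vectors with the same end [n] can thus be reordered up to powers of [v]. Downward induction
    on [j], peeling [f j] off [rootv n j]. *)
Lemma rootv_comm i j : (i < j)%N -> (j <= n)%N ->
  rootv n i * rootv n j = v *: (rootv n j * rootv n i).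
Proof.
move=> ij jn; move: j jn ij; apply: down_ind => [ni|j jn IH ij]; last first.
  have h : rootv n j * rootv n i = v^-1 *: (rootv n i * rootv n j).
    rewrite (rootvE jn); apply: qcom_scale; first exact: rootv_middle.
    by rewrite IH 1?ltnW // scalerA mulVf // scale1r.
  by rewrite h scalerA divff // scale1r.
rewrite rootv_diag rootvE //; have [e|ni'] := eqVneq i.+1 n.
  by rewrite e rootv_diag; apply: qcom_serre; apply: serre1; lia.
have {ni'}ni' : (i.+1 < n)%N by lia.
apply: qcom_scale; first by apply: serre0; lia.
have : (i.+1 <= n.-1)%N by lia.
move: (i.+1) => k; move: k; apply: down_ind => [|k kn IH].
  have n1 : n.-1.+1 = n by lia.
  rewrite rootvE ?n1 ?rootv_diag; last by lia.
  by apply: qcom_serre; apply: serre1; lia.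
rewrite rootvE; last by lia.
by apply: qcom_scale => //; apply: serre0; lia.
Qed.

Lemma rootv_low j : (j < n)%N ->
  f j * rootv n j.+1 = v^-1 *: (rootv n j.+1 * f j) + rootv n j.
Proof. by move=> jn; rewrite (rootvE jn) addrC subrK. Qed.

End Level.
End RootVectors.

(** * Ordered products of root vectors *)

Section Tower.
Variables (K : fieldType) (v : K) (r : nat) (A : algType K) (f : nat -> A).
Local Notation m := (r.*2.+1).
Hypothesis gv : generic v.
Hypothesis serre1 : forall i j, (i < m)%N -> (j < m)%N -> `|i - j|%N = 1%N ->
  f i * f i * f j + f j * f i * f i = (v + v^-1) *: (f i * f j * f i).
Hypothesis serre0 : forall i j, (i < m)%N -> (j < m)%N -> (1 < `|i - j|)%N ->
  f i * f j = f j * f i.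

Local Notation rootv := (rootv v f).
Definition al j : lattice r := alpha (inord j).
Definition be n k : lattice r := \sum_(k <= j < n.+1) al j.

(* The subalgebra generated by the [f j] with [j < n], as a predicate on pairs of a degree in the
   root lattice and a homogeneous element of that degree. *)
Inductive words (n : nat) : lattice r -> A -> Prop :=
  | words0 nu : words n nu 0
  | words1 c : words n 0 c%:A
  | wordsD nu x y : words n nu x -> words n nu y -> words n nu (x + y)
  | wordsM j nu x : (j < n)%N -> words n nu x -> words n (nu + al j) (f j * x).

Inductive adjoin (P : lattice r -> A -> Prop) (b : lattice r) (X : A) :
    lattice r -> A -> Prop :=
  | adjoin_base nu x : P nu x -> adjoin P b X nu x
  | adjoinD nu x y : adjoin P b X nu x -> adjoin P b X nu y -> adjoin P b X nu (x + y)
  | adjoinM nu x : adjoin P b X nu x -> adjoin P b X (nu + b) (X * x).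

(** Spanned by the products [X_(k-1)^a ... X_0^c w], where [X_i = rootv n i] and [w] is a word in
    the [f j] with [j < n]. At [k = n.+1] all words in [f 0, ..., f n] are covered ([words_tower]),
    which makes an induction on [n] possible. *)
Fixpoint tower n k : lattice r -> A -> Prop :=
  if k is k'.+1 then adjoin (tower n k') (be n k') (rootv n k') else words n.

Lemma wordsZ n c nu x : words n nu x -> words n nu (c *: x).
Proof.
elim=> {nu x} [nu|d|nu x y _ hx _ hy|j nu x jn _ hx].
- by rewrite scaler0; exact: words0.
- by rewrite scalerA; exact: words1.
- by rewrite scalerDr; exact: wordsD.
- by rewrite scalerAr; exact: wordsM.
Qed.

Lemma adjoinZ P b X c nu x : (forall nu x, P nu x -> P nu (c *: x)) ->
  adjoin P b X nu x -> adjoin P b X nu (c *: x).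
Proof.
move=> PZ; elim=> {nu x} [nu x Px|nu x y _ hx _ hy|nu x _ hx].
- by apply: adjoin_base; exact: PZ.
- by rewrite scalerDr; exact: adjoinD.
- by rewrite scalerAr; exact: adjoinM.
Qed.

Lemma towerZ n k c nu x : tower n k nu x -> tower n k nu (c *: x).
Proof.
elim: k c nu x => [|k IH] c nu x; first exact: wordsZ.
by apply: adjoinZ; exact: IH.
Qed.

Lemma towerD n k nu x y : tower n k nu x -> tower n k nu y -> tower n k nu (x + y).
Proof. by case: k => [|k]; [exact: wordsD | exact: adjoinD]. Qed.

Lemma tower0 n k nu : tower n k nu 0.
Proof. by elim: k => [|k IH]; [exact: words0 | exact: adjoin_base]. Qed.

Lemma be_diag n : be n n = al n.
Proof. by rewrite /be big_nat1. Qed.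

Lemma beE n k : (k < n)%N -> be n k = be n k.+1 + al k.
Proof. by move=> kn; rewrite /be big_ltn; [exact: addrC | exact: ltnW]. Qed.

Section Closed.
Variable n : nat.
Hypothesis nm : (n < m)%N.

(** The two closure properties are proved together: moving [f j] past [rootv n j.+1] creates
    [rootv n j], so stability under the [f j] relies on stability under the earlier root vectors. *)
Lemma tower_closed k : (k <= n.+1)%N ->
  (forall j nu x, (j < n)%N -> tower n k nu x -> tower n k (nu + al j) (f j * x)) /\
  (forall j nu x, (j < k)%N -> tower n k nu x -> tower n k (nu + be n j) (rootv n j * x)).
Proof.
elim: k => [_|k IH]; first by split=> // j nu x; exact: wordsM.
rewrite ltnS => kn; have [IHf IHr] := IH (leqW kn).
have R j nu x : (j < k.+1)%N -> tower n k.+1 nu x -> tower n k.+1 (nu + be n j) (rootv n j * x).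
  rewrite ltnS leq_eqVlt => /orP [/eqP ->|jk]; first exact: adjoinM.
  elim=> {nu x} [nu x hx|nu x y _ hx _ hy|nu x _ hx].
  - by apply: adjoin_base; exact: IHr.
  - by rewrite mulrDr; exact: adjoinD.
  - rewrite mulrA (rootv_comm gv serre1 serre0) // -scalerAl -mulrA addrAC.
    by apply: (@towerZ n k.+1); exact: adjoinM.
split=> // j nu x jn.
elim=> {nu x} [nu x hx|nu x y _ hx _ hy|nu x hx hfx].
- by apply: adjoin_base; exact: IHf.
- by rewrite mulrDr; exact: adjoinD.
- rewrite addrAC; have [jk|jk|e] := ltngtP j k.
  + have [e|jk'] := eqVneq j.+1 k; last first.
      by rewrite mulrA -(rootv_far gv serre0 nm) // -?mulrA; [exact: adjoinM|lia].
    (* The only case where the exchange leaves an extra term, a multiple of [rootv n j]; it is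
       absorbed by the second closure property. *)
    subst k; rewrite mulrA rootv_low // mulrDl -scalerAl -mulrA.
    apply: (@towerD n j.+2); first by apply: (@towerZ n j.+2); exact: adjoinM.
    by rewrite -addrA [al j + _]addrC -beE //; apply: (R j).
  + by rewrite mulrA (rootv_middle gv serre1 serre0) // -mulrA; exact: adjoinM.
  + rewrite e in jn hfx *; rewrite mulrA (rootv_diagC gv serre1 serre0) // -scalerAl -mulrA.
    by apply: (@towerZ n k.+1); exact: adjoinM.
Qed.

Lemma words_tower nu x : words n.+1 nu x -> tower n n.+1 nu x.
Proof.
elim=> {nu x} [nu|c|nu x y _ hx _ hy|j nu x].
- exact: tower0.
- elim: n.+1 => [|k IH]; first exact: words1.
  exact: adjoin_base.
- exact: towerD.
- have [Tf Tr] := tower_closed (leqnn n.+1).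
  rewrite ltnS leq_eqVlt => /orP [/eqP ->|jn] _; last exact: Tf.
  by rewrite -(rootv_diag v f n) -be_diag; apply: Tr.
Qed.

End Closed.
End Tower.

(** * Expansion in powers of one root vector *)

Section NormalForm.
Variables (K : fieldType) (v : K) (r : nat) (A : algType K).

Lemma hgt_words (f : nat -> A) n nu x : words (r := r) f n nu x -> hgt nu < 0 -> x = 0.
Proof.
elim=> {nu x} [//|c|nu x y _ hx _ hy h|j nu x _ _ hx].
- by rewrite hgt0.
- by rewrite hx // hy // addr0.
- by rewrite hgtD hgt_alpha => h; rewrite hx ?mulr0 //; lia.
Qed.

Variables (P : lattice r -> A -> Prop) (b : lattice r) (X : A).
Hypothesis P0 : forall nu, P nu 0.
Hypothesis PD : forall nu x y, P nu x -> P nu y -> P nu (x + y).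
Hypothesis Pneg : forall nu x, P nu x -> hgt nu < 0 -> x = 0.
Hypothesis bpos : 0 < hgt b.

Lemma hgt_adjoin nu x : adjoin P b X nu x -> hgt nu < 0 -> x = 0.
Proof.
elim=> {nu x} [//|nu x y _ hx _ hy h|nu x _ hx].
- by rewrite hx // hy // addr0.
- by rewrite hgtD => h; rewrite hx ?mulr0 //; lia.
Qed.

(** Elements of negative height vanish and [b] has positive height, so the degree in [X] is at most
    the height. The coefficients [u] are chosen before the bound [D], so that expansions of summands
    can be added termwise. *)
Lemma adjoin_normal nu x : adjoin P b X nu x ->
  exists2 u : nat -> A, (forall a, P (nu - b *+ a) (u a)) &
    forall D : nat, hgt nu <= D%:Z -> x = \sum_(a < D.+1) X ^+ a * u a.
Proof.
elim=> {nu x} [nu x Px|nu x y _ [u hu eu] _ [w hw ew]|nu x hx [u hu eu]].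
- exists (fun a => if a is 0 then x else 0) => [[|a]|D _] //.
    by rewrite mulr0n subr0.
  by rewrite big_ord_recl expr0 mul1r big1 ?addr0 // => a _; rewrite mulr0.
- exists (fun a => u a + w a) => [a|D h]; first exact: PD.
  rewrite (eu D h) (ew D h) -big_split; apply: eq_bigr => a _; by rewrite mulrDr.
- exists (fun a => if a is a'.+1 then u a' else 0) => [[|a]|[|D] h] //.
  + by rewrite mulrS opprD addrA addrK.
  + rewrite big_ord1 mulr0 (hgt_adjoin hx) ?mulr0 //.
    by move: h bpos; rewrite hgtD; lia.
  + rewrite big_ord_recl mulr0 add0r (eu D); last by move: h bpos; rewrite hgtD; lia.
    by rewrite mulr_sumr; apply: eq_bigr => a _; rewrite exprS mulrA.
Qed.

End NormalForm.

Section Coefficient.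
Variable r : nat.
Implicit Types (x y : lattice r) (n j : nat).

(* the coefficient of the simple root [al r n] *)
Definition coef_al n x : int := \sum_(a < r.*2.+2 | (a <= n)%N) x 0 a.

Lemma coef_alD n x y : coef_al n (x + y) = coef_al n x + coef_al n y.
Proof. by rewrite /coef_al -big_split; apply: eq_bigr => a _; rewrite mxE. Qed.

Lemma coef_al0 n : coef_al n 0 = 0.
Proof. by rewrite /coef_al big1 // => a _; rewrite mxE. Qed.

Lemma coef_al_sum n I (s : seq I) (p : pred I) (F : I -> lattice r) :
  coef_al n (\sum_(i <- s | p i) F i) = \sum_(i <- s | p i) coef_al n (F i).
Proof. by elim/big_rec2: _ => [|i x y _ <-]; rewrite ?coef_al0 ?coef_alD. Qed.

Lemma hgt_sum I (s : seq I) (p : pred I) (F : I -> lattice r) :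
  hgt (\sum_(i <- s | p i) F i) = \sum_(i <- s | p i) hgt (F i).
Proof. by elim/big_rec2: _ => [|i x y _ <-]; rewrite ?hgt0 ?hgtD. Qed.

Lemma coef_alal n j : (j < r.*2.+1)%N -> coef_al n (al r j) = (j == n)%:R.
Proof.
move=> jm; have e : forall b : 'I_(r.*2.+2), \sum_(a < r.*2.+2 | (a <= n)%N)
    (a == b)%:R = (b <= n)%:R :> int.
  move=> b; rewrite big_mkcond (bigD1 b) //= eqxx big1 ?addr0; first by case: (b <= n)%N.
  by move=> a /negPf ->; case: ifP.
rewrite /coef_al /al (eq_bigr (fun a => (a == lo (inord j))%:R - (a == hi (inord j))%:R)).
  by rewrite sumrB !e lo_val hi_val inordK //; lia.
by move=> a _; rewrite alphaE -!val_eqE.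
Qed.

Lemma coef_al_be n k : (k <= n)%N -> (n < r.*2.+1)%N -> coef_al n (be r n k) = 1.
Proof.
move=> kn nm; rewrite /be coef_al_sum big_nat_recr //= coef_alal // eqxx big_nat.
by rewrite big1 ?add0r // => j jn; rewrite coef_alal; lia.
Qed.

Lemma hgt_be n k : (k <= n)%N -> 0 < hgt (be r n k).
Proof.
move=> kn; rewrite /be hgt_sum big_nat_recr //= hgt_alpha ltr_wpDl //.
by apply: sumr_ge0 => j _; rewrite hgt_alpha.
Qed.

End Coefficient.

(** * States with one hole *)

Section States.
Variable r : nat.
Local Notation m := (r.*2.+1).

(** Indices up to [n + 1] are filled, except the hole [k]. The hole [n + 1] gives the highest weight
    vector of the exterior power of degree [n + 1]. For [j <= n], [F_j] only moves the hole from
    [j + 1] to [j], so passing from the hole [n + 1] to the hole [k] costs exactly the weight of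
    [rootv n k]. *)
Definition wst (n k : nat) : state r := [ffun a : 'I_(r.*2.+2) => (a <= n.+1)%N && (a != k :> nat)].

Lemma wst_inj n k l : (k <= n.+1)%N -> (n < m)%N -> wst n k = wst n l -> k = l.
Proof.
move=> kn nm /ffunP /(_ (inord k)); rewrite !ffunE inordK; last by lia.
by rewrite kn eqxx /=; case: eqP.
Qed.

Section Fixed.
Variables n j l : nat.
Hypotheses (nm : (n < m)%N) (jn : (j <= n)%N) (ln : (l <= n.+1)%N).

Let jm : (j < m)%N := leq_ltn_trans jn nm.

Lemma lo_inord : lo (inord j : idx r) = j :> nat.
Proof. by rewrite lo_val inordK. Qed.

Lemma hi_inord : hi (inord j : idx r) = j.+1 :> nat.
Proof. by rewrite hi_val inordK. Qed.

Lemma stF_wst : stF (inord j : idx r) (wst n l) = if l == j.+1 then Some (wst n j) else None.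
Proof.
rewrite /stF !ffunE lo_inord hi_inord; case: (l =P j.+1) => [->|lj]; last by case: ifP => //; lia.
case: ifP => [_|]; last by lia.
congr Some; apply/ffunP => a; rewrite !ffunE -!val_eqE /= inordK // /bump add1n.
by case: (a =P j :> nat) => ?; case: (a =P j.+1 :> nat) => ?; lia.
Qed.

Lemma pairing_wst : pairing (alpha (inord j : idx r)) (stwt (wst n l)) =
  (l == j.+1)%:R - (l == j)%:R.
Proof.
rewrite pairing_alpha !mxE !ffunE lo_inord hi_inord.
by case: (l =P j) => ?; case: (l =P j.+1) => ?; lia.
Qed.

End Fixed.
End States.

(** * Faithfulness of tensor modules in bounded height *)

Section Faithful.
Variables (K : fieldType) (v : K) (r : nat) (A : algType K) (f : nat -> A).
Local Notation m := (r.*2.+1).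
Hypothesis gv : generic v.
Hypothesis serre1 : forall i j, (i < m)%N -> (j < m)%N -> `|i - j|%N = 1%N ->
  f i * f i * f j + f j * f i * f i = (v + v^-1) *: (f i * f j * f i).
Hypothesis serre0 : forall i j, (i < m)%N -> (j < m)%N -> (1 < `|i - j|)%N ->
  f i * f j = f j * f i.
Variable act : forall M : repn v r, A -> 'M[K]_(dim M).
Hypothesis actD : forall M x y, act M (x + y) = act M x + act M y.
Hypothesis actZ : forall M c x, act M (c *: x) = c *: act M x.
Hypothesis actM : forall M x y, act M (x * y) = act M x *m act M y.
Hypothesis act1 : forall M, act M 1 = 1%:M.
Hypothesis actf : forall M j, (j < m)%N -> act M (f j) = rF M (inord j).

Let v0 : v != 0 := gen_neq0 gv.
Local Notation rootv := (rootv v f).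
Local Notation tower := (tower (r := r) v f).
Local Notation ext := (exterior r gv).

Lemma act0 M : act M 0 = 0.
Proof. by rewrite -(scale0r (0 : A)) actZ scale0r. Qed.

Lemma act_sum M I (s : seq I) (p : pred I) (F : I -> A) :
  act M (\sum_(i <- s | p i) F i) = \sum_(i <- s | p i) act M (F i).
Proof. by elim/big_rec2: _ => [|i x y _ <-]; rewrite ?act0 ?actD. Qed.

Section TensorVector.
Variable M : repn v r.
Local Notation MX := (tensor M ext gv).

Definition tz (z : 'cV[K]_(dim M)) (s : state r) : 'cV[K]_(dim MX) := z *t ket K s.

Lemma tzD x y s : tz (x + y) s = tz x s + tz y s.
Proof. exact: (tensmxDl x y (ket K s)). Qed.

Lemma tzZ c x s : tz (c *: x) s = c *: tz x s.
Proof. exact: (tensmxZl c x (ket K s)). Qed.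

Definition comp s (z : 'cV[K]_(dim MX)) : 'cV[K]_(dim M) :=
  \col_i z (mxtens_index (i, enum_rank s)) 0.

Lemma compD s x y : comp s (x + y) = comp s x + comp s y.
Proof. by apply/colP => i; rewrite !mxE. Qed.

Lemma compZ s c x : comp s (c *: x) = c *: comp s x.
Proof. by apply/colP => i; rewrite !mxE. Qed.

Lemma comp0 s : comp s 0 = 0.
Proof. by apply/colP => i; rewrite !mxE. Qed.

Lemma comp_sum s I (e : seq I) (p : pred I) (F : I -> 'cV[K]_(dim MX)) :
  comp s (\sum_(i <- e | p i) F i) = \sum_(i <- e | p i) comp s (F i).
Proof. by elim/big_rec2: _ => [|i x y _ <-]; rewrite ?comp0 ?compD. Qed.

Lemma comp_tz s t z : comp s (tz z t) = (s == t)%:R *: z.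
Proof.
apply/colP => i; rewrite !mxE.
rewrite mxtens_indexK /= [X in z i X]ord1 [X in _ && (X == _)]ord1 eqxx andbT mulrC.
by rewrite (inj_eq enum_rank_inj).
Qed.

Lemma rF_tz i z s : rF MX i *m tz z s =
  v ^ (- pairing (alpha i) (stwt s)) *: tz (rF M i *m z) s +
  (if stF i s is Some t then tz z t else 0).
Proof.
apply: etrans (mulmxDl (rF M i *t rKV ext i) (1%:M *t rF ext i) (z *t ket K s)) _.
rewrite !tensmx_mul mul1mx extF_ket dg_ket tensmxZr.
by case: (stF i s) => [t|] //=; rewrite tensmx0.
Qed.

Lemma act_qcom N x y : act N (qcom v x y) = act N x *m act N y - v^-1 *: (act N y *m act N x).
Proof. by rewrite /qcom actD -scaleN1r actZ actZ !actM scaleN1r. Qed.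

Section Level.
Variable n : nat.
Hypothesis nm : (n < m)%N.
Local Notation tw z l := (tz z (wst r n l)).
Local Notation a := (act M).
Local Notation aX := (act MX).

Lemma act_f_tz j l z : (j <= n)%N -> (l <= n.+1)%N ->
  aX (f j) *m tw z l = v ^ ((l == j)%:R - (l == j.+1)%:R) *: tw (a (f j) *m z) l +
    (if l == j.+1 then tw z j else 0).
Proof.
move=> jn ln; have jm := leq_ltn_trans jn nm.
rewrite !actf // rF_tz pairing_wst // stF_wst // opprB.
by case: (l == j.+1).
Qed.

(** Besides acting on the first factor, [rootv n k] brings the hole from [n + 1] to [k] with
    coefficient 1; the contributions of intermediate holes cancel in the q-commutator. *)
Lemma act_rootv_top k z : (k <= n)%N ->
  aX (rootv n k) *m tw z n.+1 = v^-1 *: tw (a (rootv n k) *m z) n.+1 + tw z k.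
Proof.
move=> kn; move: k kn z; apply: down_ind => [z|k kn IH z].
  by rewrite rootv_diag act_f_tz // eqxx gtn_eqF // sub0r.
rewrite rootvE // !act_qcom !mulmxBl -!scalemxAl -!mulmxA IH.
have e1 : (n.+1 == k) = false by lia.
have e2 : (n.+1 == k.+1) = false by lia.
have e3 : (k.+1 == k) = false by lia.
rewrite mulmxDr -scalemxAr !act_f_tz ?ltnS ?(ltnW kn) // e1 e2 e3 eqxx subr0 sub0r expr0z !scale1r !addr0.
rewrite IH; move: (a (f k)) (a (rootv n k.+1)) => x y.
have <- : tw (x *m (y *m z)) n.+1 - v^-1 *: tw (y *m (x *m z)) n.+1 =
    tw (x *m (y *m z) - v^-1 *: (y *m (x *m z))) n.+1.
  by rewrite tzD -[in RHS]scaleN1r !tzZ scaleN1r.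
move: (tw (x *m (y *m z)) n.+1) (tw (y *m (x *m z)) n.+1) (tw (x *m z) k.+1) (tw z k).
move=> b1 b2 b3 b4; rewrite -[v ^ (-1)]/(v^-1); move: (v^-1) => w.
by apply/matrixP => i j; rewrite !mxE; ring.
Qed.

Lemma act_rootv_low k l z : (l < k)%N -> (k <= n)%N ->
  aX (rootv n k) *m tw z l = tw (a (rootv n k) *m z) l.
Proof.
move=> lk kn; move: k kn lk z; apply: down_ind => [ln z|k kn IH lk z].
  have e1 : (l == n) = false by lia.
  have e2 : (l == n.+1) = false by lia.
  rewrite rootv_diag act_f_tz //; last by lia.
  by rewrite e1 e2 subr0 expr0z scale1r addr0.
have e1 : (l == k) = false by lia.
have e2 : (l == k.+1) = false by lia.
rewrite rootvE // !act_qcom !mulmxBl -!scalemxAl -!mulmxA IH 1?ltnW //.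
rewrite !act_f_tz ?(ltnW kn) //; [|lia|lia].
rewrite e1 e2 subr0 expr0z !scale1r !addr0 IH; last by rewrite ltnW.
by rewrite tzD -[in RHS]scaleN1r !tzZ scaleN1r.
Qed.

Lemma act_rootv_eq k z : (k <= n)%N ->
  aX (rootv n k) *m tw z k = v *: tw (a (rootv n k) *m z) k.
Proof.
rewrite leq_eqVlt => /orP [/eqP ->|kn].
  rewrite rootv_diag act_f_tz //.
  by rewrite eqxx ltn_eqF // subr0 addr0.
have e2 : (k == k.+1) = false by lia.
rewrite rootvE // !act_qcom !mulmxBl -!scalemxAl -!mulmxA act_rootv_low //.
rewrite !act_f_tz ?(ltnW kn) //; [|lia|lia].
rewrite e2 eqxx subr0 expr1z !addr0 -scalemxAr act_rootv_low //.
by rewrite tzD -[in RHS]scaleN1r !tzZ scaleN1r scalerBr !scalerA mulrC.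
Qed.

(** Error terms with hole below [k]: [rootv n k] does not move such holes, and the components at
    holes from [k] to [n + 1] do not see them ([low_comp]). *)
Definition low k (R : 'cV[K]_(dim MX)) : Prop :=
  exists zz : nat -> 'cV[K]_(dim M), R = \sum_(l < k) tw (zz l) l.

Lemma low0 k : low k 0.
Proof.
exists (fun=> 0); rewrite big1 // => l _.
by rewrite -[X in tz X](scale0r (0 : 'cV[K]_(dim M))) tzZ scale0r.
Qed.

Lemma lowD k R S : low k R -> low k S -> low k (R + S).
Proof.
move=> [z ->] [y ->]; exists (fun l => z l + y l).
by rewrite -big_split; apply: eq_bigr => l _; rewrite tzD.
Qed.

Lemma lowS k z R : low k R -> low k.+1 (tw z k + R).
Proof.
move=> [y ->]; exists (fun l => if (l < k)%N then y l else z).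
by rewrite big_ord_recr /= ltnn addrC; congr (_ + _); apply: eq_bigr => l _; rewrite ltn_ord.
Qed.

Lemma lowW k R : low k R -> low k.+1 R.
Proof.
move=> h; rewrite -[R]add0r.
by rewrite -[X in X + _](scale0r (tw 0 k)) -tzZ; exact: lowS.
Qed.

Lemma low_act k R : (k <= n)%N -> low k R -> low k (aX (rootv n k) *m R).
Proof.
move=> kn [z ->]; exists (fun l => a (rootv n k) *m z l).
by rewrite mulmx_sumr; apply: eq_bigr => l _; rewrite act_rootv_low.
Qed.

Lemma low_comp k l R : (k <= l)%N -> (l <= n.+1)%N -> low k R -> comp (wst r n l) R = 0.
Proof.
move=> kl ln [z ->]; rewrite comp_sum big1 // => i _; rewrite comp_tz.
case: eqP => [/(wst_inj ln nm) e|_]; last by rewrite scale0r.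
by have := ltn_ord i; rewrite -e; lia.
Qed.

(** Only the root vectors with index below [k] can move the hole away from [n + 1], and they bring
    it below [k]. Each of them contributes a factor [v^-1] to the top term, whence the exponent. *)
Lemma tower_act k nu x : (k <= n.+1)%N -> tower n k nu x -> forall z,
  exists2 R, low k R &
    aX x *m tw z n.+1 = v ^ (- coef_al n nu) *: tw (a x *m z) n.+1 + R.
Proof.
elim: k nu x => [|k IH] nu x kn.
  elim=> {nu x} [nu|c|nu x y _ hx _ hy|j nu x jn _ hx] z.
  - exists 0; first exact: low0.
    by rewrite !act0 !mul0mx -[X in tz X](scale0r z) tzZ !scale0r scaler0 addr0.
  - exists 0; first exact: low0.
    by rewrite !actZ !act1 -!scalemxAl !mul1mx tzZ coef_al0 oppr0 expr0z scale1r addr0.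
  - have [R hR eR] := hx z; have [S hS eS] := hy z; exists (R + S); first exact: lowD.
    by rewrite !actD !mulmxDl eR eS tzD scalerDr addrACA.
  - have [R [z0 ->] eR] := hx z; exists 0; first exact: low0.
    rewrite big_ord0 addr0 in eR; rewrite !actM -mulmxA eR -scalemxAr act_f_tz ?(ltnW jn) //.
    have e1 : (n.+1 == j) = false by lia.
    have e2 : (n.+1 == j.+1) = false by lia.
    have e3 : (j == n) = false by lia.
    rewrite e1 e2 subr0 expr0z scale1r addr0 coef_alD coef_alal ?e3 ?addr0 ?mulmxA //.
    exact: ltn_trans nm.
rewrite ltnS in kn.
elim=> {nu x} [nu x hx|nu x y _ hx _ hy|nu x _ hx] z.
- by have [R hR eR] := IH _ _ (leqW kn) hx z; exists R => //; exact: lowW.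
- have [R hR eR] := hx z; have [S hS eS] := hy z; exists (R + S); first exact: lowD.
  by rewrite !actD !mulmxDl eR eS tzD scalerDr addrACA.
- have [R [z0 ->] eR] := hx z; rewrite big_ord_recr /= in eR.
  pose R' := \sum_(l < k) tw (z0 l) l.
  exists (tw (v ^ (- coef_al n nu) *: (a x *m z) + v *: (a (rootv n k) *m z0 k)) k +
    aX (rootv n k) *m R').
    by apply: lowS; apply: low_act => //; exists z0.
  rewrite !actM -!mulmxA eR !mulmxDr -scalemxAr act_rootv_top // act_rootv_eq // tzD !tzZ.
  rewrite scalerDr scalerA coef_alD coef_al_be // opprD genzD //.
  by rewrite -!addrA; congr (_ + _); congr (_ + _); rewrite addrC.
Qed.

(** At the hole [k], the power [X^c] of a root vector contributes [[c] X^(c-1)]: taking this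
    component is a q-derivative in [X]. *)
Lemma power_act k c z R : (k <= n)%N -> low k R -> exists2 R', low k R' &
  aX (rootv n k ^+ c) *m (tw z n.+1 + R) =
  v ^ (- c%:Z) *: tw (a (rootv n k ^+ c) *m z) n.+1 +
  qi v c *: tw (a (rootv n k ^+ c.-1) *m z) k + R'.
Proof.
move=> kn hR; elim: c => [|c [R' hR' IH]].
  exists R => //; rewrite !expr0 !act1 !mul1mx qi0 oppr0 expr0z scale1r scale0r addr0 //.
exists (aX (rootv n k) *m R'); first exact: low_act.
rewrite exprS actM -mulmxA IH !mulmxDr -!scalemxAr act_rootv_top // act_rootv_eq //.
have -> : qi v c *: (v *: tw (a (rootv n k) *m (a (rootv n k ^+ c.-1) *m z)) k) =
    (v * qi v c) *: tw (a (rootv n k ^+ c) *m z) k.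
  case: c {IH} => [|c] /=; first by rewrite qi0 mulr0 !scale0r.
  by rewrite mulmxA -actM -exprS scalerA mulrC.
rewrite mulmxA -actM -exprS scalerDr scalerA; congr (_ + _).
rewrite -addrA -scalerDl; congr (_ *: _ + _ *: _).
  by rewrite -addn1 PoszD opprD genzD.
by rewrite -addn1 PoszD qiD // qi1 // mulr1 expr1z addrC.
Qed.

Lemma comp_wst k l z : (k <= n.+1)%N -> comp (wst r n k) (tw z l) = (k == l)%:R *: z.
Proof.
move=> kn; rewrite comp_tz; congr ((nat_of_bool _)%:R *: _).
by apply/eqP/eqP => [/(wst_inj kn nm)|->].
Qed.

Lemma comp_term k c nu x z : (k <= n)%N -> tower n k nu x ->
  comp (wst r n k) (aX (rootv n k ^+ c * x) *m tw z n.+1) =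
  (qi v c * v ^ (- coef_al n nu)) *: (a (rootv n k ^+ c.-1 * x) *m z).
Proof.
move=> kn hx; have [R hR eR] := tower_act (leqW kn) hx z.
rewrite actM -mulmxA eR -tzZ; have [R' hR' ->] := power_act c (v ^ (- coef_al n nu) *: (a x *m z)) kn hR.
rewrite !compD !compZ (low_comp (leqnn k) (leqW kn) hR') !comp_wst ?leqW // eqxx.
have -> : (k == n.+1) = false by lia.
by rewrite scale0r scaler0 add0r addr0 scale1r -scalemxAr scalerA actM mulmxA.
Qed.

Lemma comp_top k nu x z : (k <= n)%N -> tower n k nu x ->
  comp (wst r n n.+1) (aX x *m tw z n.+1) = v ^ (- coef_al n nu) *: (a x *m z).
Proof.
move=> kn hx; have [R hR ->] := tower_act (leqW kn) hx z.
by rewrite compD compZ (low_comp (leqW kn) (leqnn _) hR) comp_wst // eqxx scale1r addr0.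
Qed.

End Level.
End TensorVector.

Fixpoint tmod (s : seq nat) : repn v r :=
  if s is n :: s' then tensor (tmod s') ext gv else trivial v r.

Fixpoint hvec (s : seq nat) : 'cV[K]_(dim (tmod s)) :=
  if s is n :: s' return 'cV[K]_(dim (tmod s)) then tz (hvec s') (wst r n n.+1) else 1%:M.

Definition faithful (P : lattice r -> A -> Prop) (D : nat) (s : seq nat) : Prop :=
  forall nu x, hgt nu <= D%:Z -> P nu x -> act (tmod s) x *m hvec s = 0 -> x = 0.

Section Step.
Variables (n k D : nat).
Hypotheses (nm : (n < m)%N) (kn : (k <= n)%N).

(** Induction on the number [e] of copies of the exterior power. The component of the last factor at
    the hole [k] is a q-derivative in [rootv n k] and lowers the degree by one; the component at the
    top state then isolates the constant term. *)
Lemma faithful_terms s : faithful (tower n k) D s ->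
  forall e nu u, hgt nu <= D%:Z -> (forall a, tower n k (nu - be r n k *+ a) (u a)) ->
  act (tmod (nseq e n ++ s)) (\sum_(a < e.+1) rootv n k ^+ a * u a) *m
    hvec (nseq e n ++ s) = 0 ->
  forall a, (a <= e)%N -> u a = 0.
Proof.
move=> fs; elim=> [|e IH] nu u hnu hu.
  rewrite big_ord1 expr0 mul1r => h a; rewrite leqn0 => /eqP ->.
  by apply: fs (hu 0%N) h; rewrite mulr0n subr0.
set z := hvec (nseq e n ++ s) => h.
have hb : 0 < hgt (be r n k) by apply: hgt_be.
have S a : (a <= e)%N -> u a.+1 = 0.
  pose u' a := (qi v a.+1 * v ^ (- coef_al n (nu - be r n k *+ a.+1))) *: u a.+1.
  move=> ae; have : u' a = 0.
    apply: (IH (nu - be r n k) u') ae.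
    - by rewrite hgtD hgtN; lia.
    - by move=> c; apply: towerZ; move: (hu c.+1); rewrite mulrS opprD addrA.
    - have := congr1 (comp (wst r n k)) h; rewrite comp0.
      rewrite act_sum mulmx_suml comp_sum big_ord_recl (comp_term nm _ _ kn (hu 0%N)).
      (* The constant term carries the coefficient [[0]] and disappears from the derivative. *)
      rewrite qi0 mul0r scale0r add0r => <-.
      rewrite act_sum mulmx_suml; apply: eq_bigr => c _.
      by rewrite (comp_term nm _ _ kn (hu c.+1)) /u' -scalerAr actZ scalemxAl.
  move/eqP; rewrite scaler_eq0 mulf_eq0 (negPf (qiS_neq0 gv a)) (negPf (genz_neq0 gv _)) /=.
  by move/eqP.
case=> [_|a]; last by rewrite ltnS; exact: S.
(* The higher coefficients being 0, the induction hypothesis is used a second time, for the family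
   reduced to [u 0]. *)
apply: (IH nu (fun a => if a is 0 then u 0%N else 0) hnu _ _ 0%N (leq0n e)).
  by case=> [|a]; [exact: (hu 0%N) | exact: tower0].
rewrite big_ord_recl expr0 mul1r big1 ?addr0 => [|c _]; last by rewrite mulr0.
have := congr1 (comp (wst r n n.+1)) h; rewrite comp0.
rewrite big_ord_recl expr0 mul1r big1 ?addr0 => [|c _]; last by rewrite S ?mulr0 // -ltnS.
rewrite (comp_top nm _ kn (hu 0%N)) => /eqP.
by rewrite scaler_eq0 (negPf (genz_neq0 gv _)) => /eqP.
Qed.

Lemma hgt_tower l nu x : (l <= n.+1)%N -> tower n l nu x -> hgt nu < 0 -> x = 0.
Proof.
elim: l nu x => [|l IH] nu x ln; first exact: hgt_words.
apply: hgt_adjoin; last exact: hgt_be.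
by move=> nu' x'; apply: IH; exact: ltnW.
Qed.

(** [D] copies suffice, since [adjoin_normal] bounds the degree in [rootv n k] by the height. *)
Lemma faithful_step s : faithful (tower n k) D s ->
  faithful (tower n k.+1) D (nseq D n ++ s).
Proof.
move=> fs nu x hnu hx.
have [u hu eu] := adjoin_normal (fun nu => tower0 v f n k nu) (@towerD _ _ _ _ _ n k)
  (fun nu x => hgt_tower (leqW kn)) (hgt_be r kn) hx.
rewrite (eu D hnu) => /(faithful_terms fs hnu hu) u0.
by rewrite big1 // => a _; rewrite u0 ?mulr0 // -ltnS.
Qed.

End Step.

Lemma faithful_level n D s : (n < m)%N -> faithful (words f n) D s ->
  exists s', faithful (words f n.+1) D s'.
Proof.
move=> nm fs; have : forall k, (k <= n.+1)%N -> exists s', faithful (tower n k) D s'.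
  elim=> [_|k IH kn]; first by exists s.
  by have [s' fs'] := IH (ltnW kn); exists (nseq D n ++ s'); exact: faithful_step.
move=> /(_ _ (leqnn _)) [s' fs']; exists s' => nu x hnu /(words_tower gv serre1 serre0 nm).
exact: fs'.
Qed.

Lemma faithful_words n D : (n <= m)%N -> exists s, faithful (words f n) D s.
Proof.
elim: n => [_|n IH nm]; last by have [s fs] := IH (ltnW nm); exact: faithful_level fs.
exists [::] => nu x _ hx; have [c ->] : exists c, x = c%:A.
  elim: hx => {nu x} [nu|c|nu x y _ [c ->] _ [d ->]|//]; last 1 first.
  - by exists (c + d); rewrite scalerDl.
  - by exists 0; rewrite scale0r.
  - by exists c.
rewrite actZ act1 mulmx1 => /(congr1 (fun M : 'M_1 => M 0 0)); rewrite !mxE mulr1 => ->.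
by rewrite scale0r.
Qed.

End Faithful.

(** * Divided powers and the commutation formula of sl_2 *)

Section ScalarIdentities.
Variables (K : fieldType) (v : K).
Hypothesis gv : generic v.

Lemma qi_sl2 (b : nat) (m : int) :
  qi v b * qi v (m - b%:Z + 1) + qi v (m - b%:Z *+ 2) = qi v b.+1 * qi v (m - b%:Z).
Proof.
rewrite /qi (_ : m - b%:Z *+ 2 = m - b%:Z - b%:Z); last by lia.
rewrite -addn1 PoszD !(opprD, genzD gv) !opprK -!invr_expz !expr1z.
have := genz_neq0 gv b; have := genz_neq0 gv m; have := gen_sqrB1_neq0 gv; have := gen_neq0 gv.
move: (v ^ b) (v ^ m) => x y v0 h y0 x0.
by field; rewrite v0 h y0 x0.
Qed.

(** The recursion of the coefficients in [sl2_formula]. *)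
Lemma qbin_sl2 (z : int) (a t : nat) : (t <= a)%N ->
  qbin v z t.+1 * qi v (a - t)%N + qbin v z t * qi v (z + a%:Z + 1 - t%:Z) =
  qi v a.+1 * qbin v (z + 1) t.+1.
Proof.
move=> ta; rewrite qbinSS // qbinS -subzn // -[a.+1]addn1 -[t.+1]addn1 !PoszD.
have -> : qi v (a%:Z - t%:Z) = qi v ((a%:Z + 1) - (t%:Z + 1)) by congr (qi v _); lia.
have -> : qi v (z + a%:Z + 1 - t%:Z) = qi v ((z + 1) + (a%:Z + 1) - (t%:Z + 1)).
  by congr (qi v _); lia.
have -> : qi v (z - t%:Z) = qi v ((z + 1) - (t%:Z + 1)) by congr (qi v _); lia.
have := qi_neq0 gv (z := t.+1) isT; rewrite -addn1 PoszD.
move: (z + 1) (a%:Z + 1) (t%:Z + 1) (qbin v z t) => x y w c h.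
have {}h : v ^ w - v ^ (- w) != 0 by apply: contraNneq h => h; rewrite /qi h mul0r.
rewrite /qi !(opprD, genzD gv) !opprK -!invr_expz in h *.
have := genz_neq0 gv x; have := genz_neq0 gv y; have := genz_neq0 gv w.
have := gen_sqrB1_neq0 gv; have := gen_neq0 gv.
move: (v ^ x) (v ^ y) (v ^ w) h => X Y W h v0 h2 W0 Y0 X0.
have W2 : W * W - 1 != 0.
  apply: contraNneq h => h; apply/eqP; apply: (mulIf W0).
  by rewrite mulrBl mulVf // h mul0r.
by field; rewrite v0 h2 W0 Y0 X0 W2.
Qed.

End ScalarIdentities.

Section DividedPowers.
Variables (K : fieldType) (v : K) (n : nat).
Hypothesis gv : generic v.

Fixpoint dp (X : 'M[K]_n) (a : nat) : 'M[K]_n :=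
  if a is a'.+1 then (qi v a)^-1 *: (X *m dp X a') else 1%:M.

(* junk value [0] when [b < t], so that it represents [dp X (b - t)] for integers *)
Definition dpB X (b t : nat) := if (t <= b)%N then dp X (b - t) else 0.

Lemma dpS X a : X *m dp X a = qi v a.+1 *: dp X a.+1.
Proof. by rewrite /= scalerA divff ?scale1r ?qiS_neq0. Qed.

Lemma dp_comm X Y a : X *m Y = Y *m X -> dp X a *m Y = Y *m dp X a.
Proof.
move=> XY; elim: a => [|a IH] /=; first by rewrite mul1mx mulmx1.
by rewrite -scalemxAl -scalemxAr -mulmxA IH !mulmxA XY.
Qed.

Lemma dp_dp_comm X Y a b : X *m Y = Y *m X -> dp X a *m dp Y b = dp Y b *m dp X a.
Proof. by move=> XY; apply: dp_comm; symmetry; apply: dp_comm. Qed.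

Lemma dpSr X a : dp X a *m X = qi v a.+1 *: dp X a.+1.
Proof. by rewrite dp_comm // dpS. Qed.

Section Sl2.
Variables (X Y : 'M[K]_n) (w : int -> 'cV[K]_n -> Prop).
Hypothesis wX : forall m y, w m y -> w (m + 2) (X *m y).
Hypothesis wY : forall m y, w m y -> w (m - 2) (Y *m y).
Hypothesis wZ : forall m c y, w m y -> w m (c *: y).
Hypothesis XY : forall m y, w m y -> X *m (Y *m y) = Y *m (X *m y) + qi v m *: y.

Lemma w_dpX m a y : w m y -> w (m + a%:Z *+ 2) (dp X a *m y).
Proof.
move=> wy; elim: a => [|a IH] /=; first by rewrite mul1mx mul0rn addr0.
rewrite -scalemxAl -mulmxA (_ : _ + _ = m + a%:Z *+ 2 + 2); last by lia.
by apply: wZ; exact: wX.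
Qed.

Lemma w_dpY m a y : w m y -> w (m - a%:Z *+ 2) (dp Y a *m y).
Proof.
move=> wy; elim: a => [|a IH] /=; first by rewrite mul1mx mul0rn subr0.
rewrite -scalemxAl -mulmxA (_ : m - _ = m - a%:Z *+ 2 - 2); last by lia.
by apply: wZ; exact: wY.
Qed.

Lemma sl2_step m b y : w m y -> X *m (dp Y b *m y) =
  dp Y b *m (X *m y) + qi v (m - b%:Z + 1) *: (dpB Y b 1 *m y).
Proof.
move=> wy; elim: b => [|b IH].
  by rewrite /= !mul1mx /dpB mul0mx scaler0 addr0.
have := w_dpY b wy => /XY; rewrite IH => e.
rewrite /= -!scalemxAl -scalemxAr -!mulmxA e mulmxDr -scalemxAr.
have -> : (qi v b.+1)^-1 *: (Y *m (dp Y b *m (X *m y)) +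
   qi v (m - b%:Z + 1) *: (Y *m (dpB Y b 1 *m y)) + qi v (m - b%:Z *+ 2) *: (dp Y b *m y)) =
   (qi v b.+1)^-1 *: (Y *m (dp Y b *m (X *m y))) +
   (qi v b.+1)^-1 *: ((qi v b.+1 * qi v (m - b%:Z)) *: (dp Y b *m y)).
  rewrite -scalerDr -addrA; congr (_ *: (_ + _)).
  have -> : Y *m (dpB Y b 1 *m y) = qi v b *: (dp Y b *m y).
    rewrite /dpB; case: b {IH e} => [|b]; first by rewrite mul0mx mulmx0 qi0 scale0r.
    by rewrite subn1 mulmxA dpS scalemxAl.
  by rewrite scalerA -scalerDl -qi_sl2 // mulrC.
rewrite scalerA mulrA mulVf ?qiS_neq0 // mul1r; congr (_ + _ *: _).
  by congr (qi v _); lia.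
by rewrite /dpB subn1.
Qed.

(** Kostant's formula for [E^(a) F^(b)], evaluated at a weight vector, where the factors in [K]
    become Gaussian binomials. The abstract weight predicate [w] allows [E] and [F] to exchange
    roles. *)
Lemma sl2_formula m a b y : w m y -> dp X a *m (dp Y b *m y) =
  \sum_(t < a.+1) qbin v (m + a%:Z - b%:Z) t *: (dpB Y b t *m (dp X (a - t) *m y)).
Proof.
move=> wy; elim: a => [|a IH].
  by rewrite big_ord1 qbin0 scale1r /dpB subn0 /= !mul1mx.
set z := m + a%:Z - b%:Z in IH.
have step t : (t <= a)%N -> X *m (dpB Y b t *m (dp X (a - t) *m y)) =
    qi v (a - t).+1 *: (dpB Y b t *m (dp X (a - t).+1 *m y)) +
    qi v (z + a%:Z + 1 - t%:Z) *: (dpB Y b t.+1 *m (dp X (a - t) *m y)).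
  move=> ta; rewrite {1 2}/dpB; case: leqP => tb; last first.
    by rewrite !mul0mx /dpB ltnNge (ltnW tb) /= mul0mx mulmx0 !scaler0 addr0.
  rewrite (sl2_step _ (w_dpX (a - t) wy)); congr (_ + _).
    by rewrite (mulmxA X) dpS -scalemxAl -scalemxAr.
  congr (qi v _ *: _); first by rewrite /z; lia.
  by rewrite /dpB subn_gt0 -subnDA addn1.
have -> : dp X a.+1 *m (dp Y b *m y) = (qi v a.+1)^-1 *: (X *m (dp X a *m (dp Y b *m y))).
  by rewrite /= -scalemxAl -mulmxA.
apply: (scalerI (qiS_neq0 gv a)); rewrite scalerA divff ?qiS_neq0 // scale1r IH.
rewrite mulmx_sumr.
have -> : m + a.+1%:Z - b%:Z = z + 1 by rewrite /z; lia.
pose D t := dpB Y b t *m (dp X (a.+1 - t) *m y).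
transitivity (\sum_(t < a.+1) (qbin v z t * qi v (a.+1 - t)%N) *: D t +
   \sum_(t < a.+1) (qbin v z t * qi v (z + a%:Z + 1 - t%:Z)) *: D t.+1).
  rewrite -big_split; apply: eq_bigr => t _; have ta : (t <= a)%N by rewrite -ltnS.
  by rewrite -scalemxAr step // scalerDr !scalerA /D subSn // subSS.
rewrite [in RHS]big_ord_recl [X in X + _]big_ord_recl scalerDr -addrA; congr (_ + _).
  by rewrite /D subn0 !qbin0 mul1r scale1r.
rewrite scaler_sumr.
transitivity (\sum_(t < a.+1) (qbin v z t.+1 * qi v (a - t)%N) *: D t.+1 +
   \sum_(t < a.+1) (qbin v z t * qi v (z + a%:Z + 1 - t%:Z)) *: D t.+1).
  by rewrite [X in _ = X + _]big_ord_recr /= subnn qi0 mulr0 scale0r addr0.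
rewrite -big_split; apply: eq_bigr => t _; have ta : (t <= a)%N by rewrite -ltnS.
by rewrite /= -scalerDl qbin_sl2 // scalerA.
Qed.

End Sl2.
End DividedPowers.

(** * Integral forms *)

Section Projections.
Variables (K : fieldType) (v : K) (r : nat) (M : repn v r).
Implicit Types (nu : lattice r) (y : 'cV[K]_(dim M)).

Definition pr nu : 'M[K]_(dim M) := dg M (fun x => (x == nu)%:R).
Definition wts : seq (lattice r) := undup [seq wt a | a <- enum 'I_(dim M)].

Lemma sum_pr y : y = \sum_(nu <- wts) pr nu *m y.
Proof.
apply/colP => a; rewrite summxE (bigD1_seq (wt a)) ?undup_uniq //=; last first.
  by rewrite mem_undup map_f // mem_enum.
rewrite big1 => [|nu h]; rewrite mul_diag_mx !mxE; first by rewrite eqxx mul1r addr0.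
by rewrite eq_sym (negPf h) mul0r.
Qed.

Lemma dg_pr f nu : dg M f *m pr nu = f nu *: pr nu.
Proof.
rewrite /pr dgM -dgZ; apply: eq_dg => x.
by case: eqP => [->//|_]; rewrite !mulr0.
Qed.

Lemma dg_wt f nu y : pr nu *m y = y -> dg M f *m y = f nu *: y.
Proof. by move=> <-; rewrite mulmxA dg_pr -scalemxAl. Qed.

Lemma pr_pr mu nu : pr mu *m pr nu = (nu == mu)%:R *: pr nu.
Proof. exact: dg_pr. Qed.

Lemma pr_id nu y : pr nu *m (pr nu *m y) = pr nu *m y.
Proof. by rewrite mulmxA pr_pr eqxx scale1r. Qed.

Lemma pr_neq mu nu y : mu != nu -> pr nu *m y = y -> pr mu *m y = 0.
Proof. by move=> h <-; rewrite mulmxA pr_pr eq_sym (negPf h) scale0r mul0mx. Qed.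

Lemma prE nu i : pr (nu + alpha i) *m rE M i = rE M i *m pr nu.
Proof.
rewrite /pr dgE; congr (_ *m _); apply: eq_dg => x.
by rewrite (inj_eq (addIr _)).
Qed.

Lemma prF nu i : pr (nu - alpha i) *m rF M i = rF M i *m pr nu.
Proof.
rewrite /pr dgF; congr (_ *m _); apply: eq_dg => x.
by rewrite (inj_eq (addIr _)).
Qed.

End Projections.

Section Lattice.
Variables (K : fieldType) (v : K) (r : nat) (M : repn v r).
Variables (X Y : idx r -> 'M[K]_(dim M)) (sh : idx r -> lattice r).
Hypothesis gv : generic v.
Hypothesis prX : forall nu i, pr M (nu + sh i) *m X i = X i *m pr M nu.
Hypothesis prY : forall nu i, pr M (nu - sh i) *m Y i = Y i *m pr M nu.
Hypothesis XYneq : forall i j, i != j -> X i *m Y j = Y j *m X i.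
Hypothesis XYeq : forall i nu (y : 'cV[K]_(dim M)), pr M nu *m y = y ->
  Y i *m (X i *m y) = X i *m (Y i *m y) + qi v (- pairing (sh i) nu) *: y.
Hypothesis sh2 : forall i, pairing (sh i) (sh i) = 2.
Local Notation V := 'cV[K]_(dim M).

(** [X], [Y], [sh] stand for [E], [F], [alpha] or for [F], [E], [-alpha]; [latEF] compares the two
    lattices. *)
Inductive lat (x0 : V) : V -> Prop :=
  | lat_gen : lat x0 x0
  | lat_zero : lat x0 0
  | latD x y : lat x0 x -> lat x0 y -> lat x0 (x + y)
  | latZ c x : laurent v c -> lat x0 x -> lat x0 (c *: x)
  | latX i a x : lat x0 x -> lat x0 (dp v (X i) a *m x).

Lemma pr_dpX nu i a : pr M (nu + sh i *+ a) *m dp v (X i) a = dp v (X i) a *m pr M nu.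
Proof.
elim: a => [|a IH] /=; first by rewrite mulr0n addr0 mul1mx mulmx1.
by rewrite -scalemxAr mulmxA mulrSr addrA prX -mulmxA IH mulmxA scalemxAl.
Qed.

Lemma lat_sum x0 I (s : seq I) (p : pred I) (F : I -> V) :
  (forall i, p i -> lat x0 (F i)) -> lat x0 (\sum_(i <- s | p i) F i).
Proof. by move=> h; elim/big_ind: _ => //; [exact: lat_zero | exact: latD]. Qed.

Section WeightVector.
Variables (nu0 : lattice r) (x0 : V).
Hypothesis wx0 : pr M nu0 *m x0 = x0.

Lemma lat_pr x nu : lat x0 x -> lat x0 (pr M nu *m x).
Proof.
move=> hx; elim: hx nu => {x} [nu|nu|x y _ hx _ hy nu|c x hc _ hx nu|i a x _ hx nu].
- have [->|h] := eqVneq nu nu0; first by rewrite wx0; exact: lat_gen.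
  by rewrite (pr_neq h wx0); exact: lat_zero.
- by rewrite mulmx0; exact: lat_zero.
- by rewrite mulmxDr; exact: latD.
- by rewrite -scalemxAr; exact: latZ.
- by rewrite -[nu](subrK (sh i *+ a)) mulmxA pr_dpX -mulmxA; exact: latX.
Qed.

Hypothesis Yx0 : forall i, Y i *m x0 = 0.

Lemma dp_killed i a (y : V) : Y i *m y = 0 -> dp v (Y i) a.+1 *m y = 0.
Proof.
move=> h; apply: (scalerI (qiS_neq0 gv a)).
by rewrite scaler0 scalemxAl -dpSr // -mulmxA h mulmx0.
Qed.

Let w i m (y : V) := exists2 nu, pr M nu *m y = y & m = - pairing (sh i) nu.

Lemma sl2_lattice i a b nu (y : V) : pr M nu *m y = y ->
  dp v (Y i) a *m (dp v (X i) b *m y) =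
  \sum_(t < a.+1) qbin v (- pairing (sh i) nu + a%:Z - b%:Z) t *:
    (dpB v (X i) b t *m (dp v (Y i) (a - t) *m y)).
Proof.
move=> hy; apply: (sl2_formula gv (w := w i)) => [m z|m z|m c z|m z|].
- move=> [mu hz ->]; exists (mu - sh i); first by rewrite mulmxA prY -mulmxA hz.
  by rewrite pairingBr sh2 opprB addrC.
- move=> [mu hz ->]; exists (mu + sh i); first by rewrite mulmxA prX -mulmxA hz.
  by rewrite pairingDr sh2 [RHS]opprD.
- by move=> [mu hz ->]; exists mu; rewrite // -scalemxAr hz.
- by move=> [mu hz ->]; exact: XYeq.
- by exists nu.
Qed.

(** A divided power of [Y i] commutes with those of [X j] for [j != i]; for [j = i], Kostant's
    formula moves it to the right with Laurent coefficients, until it reaches [x0], which is killed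
    by [Y i]. The projection to a weight is needed for the formula to apply. *)
Lemma lat_stable i a x : lat x0 x -> lat x0 (dp v (Y i) a *m x).
Proof.
move=> hx; rewrite (sum_pr x) mulmx_sumr; apply: lat_sum => nu _.
elim: hx nu i a => {x} [nu i a|nu i a|x y _ hx _ hy nu i a|c x hc _ hx nu i a|j b x lx hx nu i a].
- have [->|h] := eqVneq nu nu0; last by rewrite (pr_neq h wx0) mulmx0; exact: lat_zero.
  rewrite wx0; case: a => [|a]; first by rewrite mul1mx; exact: lat_gen.
  by rewrite dp_killed //; exact: lat_zero.
- by rewrite !mulmx0; exact: lat_zero.
- by rewrite !mulmxDr; exact: latD.
- by rewrite -!scalemxAr; exact: latZ.
- rewrite -[nu](subrK (sh j *+ b)) [pr M _ *m _]mulmxA pr_dpX -mulmxA.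
  set mu := nu - _; have [->|ij] := eqVneq i j; last first.
    by rewrite mulmxA -dp_dp_comm ?XYneq 1?eq_sym // -mulmxA; apply: latX.
  rewrite (@sl2_lattice j a b mu) ?pr_id //; apply: lat_sum => t _.
  apply: latZ; first exact: laurent_qbin.
  by rewrite /dpB; case: leqP => _; [apply: latX | rewrite mul0mx; exact: lat_zero].
Qed.

End WeightVector.
End Lattice.

Section IntegralForm.
Variables (K : fieldType) (v : K) (r : nat) (M : repn v r).
Hypothesis gv : generic v.
Variables (nh nl : lattice r) (vh vl : 'cV[K]_(dim M)).
Hypothesis wh : pr M nh *m vh = vh.
Hypothesis wl : pr M nl *m vl = vl.
Hypothesis Evh : forall i, rE M i *m vh = 0.
Hypothesis Fvl : forall i, rF M i *m vl = 0.

Lemma rEF_neq i j : i != j -> rE M i *m rF M j = rF M j *m rE M i.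
Proof. by move=> ij; apply/eqP; rewrite -subr_eq0 rEF (negPf ij) scale0r. Qed.

Lemma rEF_eq i : rE M i *m rF M i =
  rF M i *m rE M i + dg M (fun x => qi v (pairing (alpha i) x)).
Proof. by apply/eqP; rewrite addrC -subr_eq rEF_dg eqxx scale1r. Qed.

Lemma latE_F i a x : lat (rE M) vl x -> lat (rE M) vl (dp v (rF M i) a *m x).
Proof.
apply: (lat_stable (sh := @alpha r) gv _ _ _ _ _ wl Fvl) => {i a x}.
- by move=> nu i; exact: prE.
- by move=> nu i; exact: prF.
- exact: rEF_neq.
- move=> i nu y wy; rewrite [in RHS]mulmxA rEF_eq mulmxDl (dg_wt _ wy) qiN scaleNr addrK.
  by rewrite mulmxA.
- by move=> i; rewrite cartan_diag.
Qed.

Lemma latF_E i a x : lat (rF M) vh x -> lat (rF M) vh (dp v (rE M i) a *m x).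
Proof.
apply: (lat_stable (sh := fun i => - @alpha r i) gv _ _ _ _ _ wh Evh) => {i a x}.
- by move=> nu i; exact: prF.
- by move=> nu i; rewrite opprK; exact: prE.
- by move=> i j ij; rewrite rEF_neq // eq_sym.
- move=> i nu y wy; rewrite mulmxA rEF_eq mulmxDl (dg_wt _ wy) mulmxA.
  by rewrite (pairingC (- _)) pairingNr opprK pairingC.
- by move=> i; rewrite pairingNr pairingC pairingNr opprK cartan_diag.
Qed.

Hypothesis vhE : lat (rE M) vl vh.
Hypothesis vlF : lat (rF M) vh vl.

(** Each lattice is stable under the divided powers of both kinds and contains the generator of the
    other. *)
Lemma latEF x : lat (rE M) vl x <-> lat (rF M) vh x.
Proof.
split; elim=> {x} [|||c x hc _|i a x _].
- exact: vlF.
- exact: lat_zero.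
- by move=> x y _ hx _ hy; exact: latD.
- exact: latZ.
- exact: latF_E.
- exact: vhE.
- exact: lat_zero.
- by move=> x y _ hx _ hy; exact: latD.
- exact: latZ.
- exact: latE_F.
Qed.

End IntegralForm.

Lemma zmuln (x : int) n : x *+ n = x * n%:Z.
Proof. by rewrite -mulr_natr natz. Qed.

(** * The generators of the coideal subalgebra acting on integral forms *)

Section Coideal.
Variables (K : fieldType) (v s : K) (r : nat) (M : repn v r).
Hypothesis gv : generic v.
Hypothesis hs : s = v \/ s = v^-1.
Local Notation V := 'cV[K]_(dim M).
Local Notation rE := (rE M).
Local Notation rF := (rF M).
Local Notation pr := (pr M).
Local Notation dp := (dp v).
Local Notation i0 := (idx0 r).

Lemma inv_neq0 : s != 0.
Proof. by case: hs => ->; rewrite ?invr_neq0 ?gen_neq0. Qed.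

Lemma invD (m n : int) : s ^ (m + n) = s ^ m * s ^ n.
Proof. by rewrite expfzDr ?inv_neq0. Qed.

Lemma inv_qiD (m n : int) : qi v (m + n) = s ^ n * qi v m + s ^ (- m) * qi v n.
Proof.
case: hs => ->; first exact: qiD.
by rewrite !exprz_inv opprK addrC qiD // addrC.
Qed.

Lemma laurent_inv z : laurent v (s ^ z).
Proof. by case: hs => ->; rewrite ?exprz_inv; exact: laurent_genz. Qed.

(** For [s = v] this is the action of [K_j^-1], and [bmx], [tmx] are the actions of [bgen] and [ti];
    for [s = v^-1] it is that of [K_j], and they are the actions of the images under [psi]
    ([act_psi_bgen], [act_psi_tpoly]). *)
Definition kk (j : idx r) : 'M[K]_(dim M) := dg M (fun x => s ^ (- pairing (alpha j) x)).
Definition bmx (j : idx r) := rE j + rF (rev_ord j) *m kk j.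
Definition tmx := rE i0 + s *: (rF i0 *m kk i0) + kk i0.

Lemma wE nu j (z : V) : pr nu *m z = z -> pr (nu + alpha j) *m (rE j *m z) = rE j *m z.
Proof. by move=> h; rewrite mulmxA prE -mulmxA h. Qed.

Lemma wF nu j (z : V) : pr nu *m z = z -> pr (nu - alpha j) *m (rF j *m z) = rF j *m z.
Proof. by move=> h; rewrite mulmxA prF -mulmxA h. Qed.

Lemma w_dpE nu j a (z : V) : pr nu *m z = z ->
  pr (nu + alpha j *+ a) *m (dp (rE j) a *m z) = dp (rE j) a *m z.
Proof.
move=> h; elim: a => [|a IH] /=; first by rewrite addr0 mul1mx.
by rewrite -scalemxAl -mulmxA -scalemxAr mulrSr addrA wE.
Qed.

Lemma w_dpF nu j a (z : V) : pr nu *m z = z ->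
  pr (nu - alpha j *+ a) *m (dp (rF j) a *m z) = dp (rF j) a *m z.
Proof.
move=> h; elim: a => [|a IH] /=; first by rewrite subr0 mul1mx.
by rewrite -scalemxAl -mulmxA -scalemxAr mulrSr opprD addrA wF.
Qed.

Section OffDiagonal.
Variable j : idx r.
Hypothesis j0 : j != i0.

Lemma rev_far : (1 < `|j - rev_ord j|)%N.
Proof. by move: j0 (ltn_ord j); rewrite -val_eqE /= inordK; lia. Qed.

Lemma rev_neq : j != rev_ord j.
Proof. by apply/eqP => e; have := rev_far; rewrite -e; lia. Qed.

Lemma bmx_coef (m : int) (a k : nat) : (k <= a)%N ->
  s ^ (- (m * k.+1%:Z) - a%:Z * k.+1%:Z + k.+1%:Z * k.+1%:Z) * qi v (a - k)%N +
  s ^ (- (m * k%:Z) - a%:Z * k%:Z + k%:Z * k%:Z) *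
    (s ^ (- (m + (a - k)%N%:Z *+ 2)) * qi v k.+1) =
  qi v a.+1 * s ^ (- (m * k.+1%:Z) - a.+1%:Z * k.+1%:Z + k.+1%:Z * k.+1%:Z).
Proof.
move=> ka; rewrite (_ : a.+1%:Z = (a - k)%N%:Z + k.+1%:Z); last by lia.
rewrite inv_qiD mulrDl mulrAC -invD mulrA -invD [X in _ = _ + X]mulrAC -invD.
by congr (s ^ _ * _ + s ^ _ * _); rewrite -subzn // -[k.+1]addn1 PoszD; ring.
Qed.

(** The q-binomial formula: as [j] and its opposite are distinct and not adjacent, the two summands
    of [bmx j] q-commute. The term [k = 0] is the leading one. *)
Lemma bmx_formula nu a (z : V) : pr nu *m z = z ->
  dp (bmx j) a *m z = \sum_(k < a.+1)
    s ^ (- (pairing (alpha j) nu * k%:Z) - a%:Z * k%:Z + k%:Z * k%:Z) *: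
      (dp (rF (rev_ord j)) k *m (dp (rE j) (a - k) *m z)).
Proof.
move=> hz; set m := pairing _ _.
elim: a => [|a IH].
  by rewrite big_ord1 /= !mul1mx mulr0 mul0r oppr0 !addr0 expr0z scale1r.
apply: (scalerI (qiS_neq0 gv a)); rewrite [in LHS]scalemxAl -dpS // -mulmxA IH mulmx_sumr.
pose D k := dp (rF (rev_ord j)) k *m (dp (rE j) (a.+1 - k) *m z).
pose e a k : K := s ^ (- (m * k%:Z) - a%:Z * k%:Z + k%:Z * k%:Z).
transitivity (\sum_(k < a.+1) (e a k * qi v (a.+1 - k)%N) *: D k +
  \sum_(k < a.+1) (e a k * (s ^ (- (m + (a - k)%N%:Z *+ 2)) * qi v k.+1)) *: D k.+1).
  rewrite -big_split; apply: eq_bigr => k _; have ka : (k <= a)%N by rewrite -ltnS.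
  rewrite -scalemxAr /bmx mulmxDl /= -scalerA -[X in _ = _ + X]scalerA -scalerDr.
  congr (_ *: (_ + _)).
    have eF : rE j *m dp (rF (rev_ord j)) k = dp (rF (rev_ord j)) k *m rE j.
      by symmetry; apply: dp_comm; rewrite rEF_neq // rev_neq.
    rewrite (mulmxA (rE j)) eF.
    by rewrite -mulmxA (mulmxA (rE j)) dpS // -scalemxAl -scalemxAr /D subSn.
  have hw := w_dpF (rev_ord j) k (w_dpE j (a - k) hz).
  rewrite -mulmxA (dg_wt _ hw) -scalemxAr (mulmxA (rF _)) dpS // -scalemxAl scalerA /D subSS.
  congr (s ^ (- _) * _ *: _); rewrite pairingBr pairingDr !pairingMnr cartan_diag.
  by rewrite cartan_far ?rev_far // mul0rn subr0 [2 *+ _]zmuln /m; lia.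
rewrite [in RHS]big_ord_recl [X in X + _]big_ord_recl scalerDr -addrA; congr (_ + _).
  by rewrite /e /D subn0 !mulr0 oppr0 !addr0 expr0z mul1r scale1r.
rewrite scaler_sumr.
transitivity (\sum_(k < a.+1) (e a k.+1 * qi v (a - k)%N) *: D k.+1 +
  \sum_(k < a.+1) (e a k * (s ^ (- (m + (a - k)%N%:Z *+ 2)) * qi v k.+1)) *: D k.+1).
  by rewrite [X in _ = X + _]big_ord_recr /= subnn qi0 mulr0 scale0r addr0.
rewrite -big_split; apply: eq_bigr => k _; have ka : (k <= a)%N by rewrite -ltnS.
by rewrite /= -scalerDl bmx_coef // scalerA.
Qed.

End OffDiagonal.

(** * The generator at the middle index and its shifted powers *)

Section Diagonal.
Local Notation E0 := (rE i0).
Local Notation F0 := (rF i0).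

(* [g = \sum_k s^(k(k+1)/2) F^(k)] conjugates [E + s F K^-1 + K^-1] into
   [E + [h + 1]], where [h] is the weight. *)
Definition gco (k : nat) : K := s ^+ 'C(k.+1, 2).

Lemma gcoS k : gco k.+1 = s ^+ k.+1 * gco k.
Proof. by rewrite /gco binS bin1 exprD mulrC. Qed.

(** Equality of the coefficients of [F^(k)] on both sides of [tmx_gmx], [m] being the weight of the
    vector. *)
Lemma gco_identity (m : int) k :
  gco k.+1 * qi v (m - k%:Z) +
    (if k is k'.+1 then gco k' * (s * s ^ (- (m - k'%:Z *+ 2)) * qi v k) else 0) +
    gco k * s ^ (- (m - k%:Z *+ 2)) = qi v (m + 1) * gco k.
Proof.
have -> : (if k is k'.+1 then gco k' * (s * s ^ (- (m - k'%:Z *+ 2)) * qi v k) else 0) =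
    gco k * (s ^ (- m + k%:Z - 1) * qi v k).
  case: k => [|k]; first by rewrite qi0 !mulr0.
  have e : s * s ^ (- (m - k%:Z *+ 2)) = s ^+ k.+1 * s ^ (- m + k.+1%:Z - 1).
    by rewrite -[X in X * _]expr1z exprnP -!invD; congr (s ^ _); lia.
  by rewrite e gcoS; move: (s ^+ _) (s ^ _) (qi v _) (gco k) => a b c d; ring.
rewrite gcoS (_ : m + 1 = (m - k%:Z) + (1 + k%:Z)); last by lia.
rewrite [qi v (m - _ + _)]inv_qiD [qi v (1 + _)]inv_qiD qi1 // mulr1.
rewrite (_ : s ^ (- m + k%:Z - 1) = s ^ (- (m - k%:Z)) * s ^ (- 1)); last first.
  by rewrite -invD; congr (s ^ _); lia.
rewrite (_ : s ^ (- (m - k%:Z *+ 2)) = s ^ (- (m - k%:Z)) * s ^ k%:Z); last first.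
  by rewrite -invD; congr (s ^ _); lia.
rewrite -[s ^ (1 + k%:Z)]/(s ^+ k.+1) -exprnP.
move: (s ^+ k.+1) (s ^+ k) (gco k) (qi v _) (qi v k) (s ^ _) (s ^ _) => a b c d e f h.
by ring.
Qed.

Lemma sum_shift_up (W : lmodType K) N (c : nat -> K) (y : nat -> W) : y N = 0 ->
  \sum_(k < N) c k *: y k.+1 = \sum_(k < N) (if k : nat is k'.+1 then c k' else 0 : K) *: y k.
Proof.
move=> yN; transitivity (\sum_(k < N.+1) (if k : nat is k'.+1 then c k' else 0 : K) *: y k).
  by rewrite big_ord_recl scale0r add0r.
by rewrite big_ord_recr /= yN scaler0 addr0.
Qed.

Lemma sum_shift_down (W : lmodType K) N (c : nat -> K) (y : nat -> W) : y N = 0 ->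
  \sum_(k < N.+1) c k *: (if k : nat is k'.+1 then y k' else 0) = \sum_(k < N.+1) c k.+1 *: y k.
Proof.
by move=> yN; rewrite big_ord_recl scaler0 add0r [in RHS]big_ord_recr /= yN scaler0 addr0.
Qed.

Variable D : nat.
Hypothesis nilF : forall k, (D <= k)%N -> dp F0 k = 0.

Definition gmx : 'M[K]_(dim M) := \sum_(k < D.+1) gco k *: dp F0 k.

Lemma w_sl2 m b nu (y : V) : pr nu *m y = y -> m = pairing (alpha i0) nu ->
  E0 *m (dp F0 b *m y) = dp F0 b *m (E0 *m y) + qi v (m - b%:Z + 1) *: (dpB v F0 b 1 *m y).
Proof.
move=> hy hm; pose w c (x : V) := exists2 mu, pr mu *m x = x & c = pairing (alpha i0) mu.
have wy : w m y by exists nu.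
apply: (sl2_step gv _ _ _ b wy) => [c x|c d x|c x].
- move=> [mu hx ->]; exists (mu - alpha i0); first exact: wF.
  by rewrite pairingBr cartan_diag.
- by move=> [mu hx ->]; exists mu; rewrite // -scalemxAr hx.
- by move=> [mu hx ->]; rewrite !mulmxA rEF_eq mulmxDl (dg_wt _ hx).
Qed.

Lemma tmx_gmx nu (y : V) : pr nu *m y = y ->
  tmx *m (gmx *m y) = gmx *m (E0 *m y) + qi v (pairing (alpha i0) nu + 1) *: (gmx *m y).
Proof.
move=> hy; set m := pairing _ _; pose z k := dp F0 k *m y.
have zD k : (D <= k)%N -> z k = 0 by move=> h; rewrite /z nilF // mul0mx.
have step k : tmx *m z k = dp F0 k *m (E0 *m y) +
    qi v (m - k%:Z + 1) *: (if k : nat is k'.+1 then z k' else 0) +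
    (s * s ^ (- (m - k%:Z *+ 2)) * qi v k.+1) *: z k.+1 +
    s ^ (- (m - k%:Z *+ 2)) *: z k.
  have hk : kk i0 *m z k = s ^ (- (m - k%:Z *+ 2)) *: z k.
    rewrite /kk (dg_wt _ (w_dpF i0 k hy)); congr (s ^ (- _) *: _).
    by rewrite pairingBr pairingMnr cartan_diag [2 *+ _]zmuln /m; lia.
  have hF : F0 *m z k = qi v k.+1 *: z k.+1 by rewrite /z mulmxA dpS // -scalemxAl.
  rewrite /tmx !mulmxDl -!scalemxAl -mulmxA hk -scalemxAr scalerA hF scalerA.
  rewrite (w_sl2 k hy (erefl _)); congr (_ + _ *: _ + _ + _).
  by case: k {hk hF} => [|k]; rewrite /dpB ?mul0mx // subn1.
rewrite {1}/gmx mulmx_suml mulmx_sumr.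
transitivity (\sum_(k < D.+1) (gco k *: (dp F0 k *m (E0 *m y)) +
  ((gco k * qi v (m - k%:Z + 1)) *: (if k : nat is k'.+1 then z k' else 0) +
   (gco k * (s * s ^ (- (m - k%:Z *+ 2)) * qi v k.+1)) *: z k.+1 +
   (gco k * s ^ (- (m - k%:Z *+ 2))) *: z k))).
  apply: eq_bigr => k _; rewrite -scalemxAl -scalemxAr step !scalerDr !scalerA.
  by rewrite !addrA.
rewrite big_split /=; congr (_ + _).
  by rewrite /gmx mulmx_suml; apply: eq_bigr => k _; rewrite scalemxAl.
rewrite !big_split /= (sum_shift_down (fun k => gco k * qi v (m - k%:Z + 1)) (zD D (leqnn D))).
rewrite (sum_shift_up (fun k => gco k * (s * s ^ (- (m - k%:Z *+ 2)) * qi v k.+1)) (zD D.+1 (leqnSn D))).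
rewrite -!big_split scaler_sumr; apply: eq_bigr => k _ /=.
rewrite -scalemxAl scalerA -gco_identity -!scalerDl; congr ((_ + _ + _) *: _).
  by congr (_ * qi v _); lia.
by case: (nat_of_ord k).
Qed.

Fixpoint tpow (c : int) (a : nat) : 'M[K]_(dim M) :=
  if a is a'.+1 then (qi v a)^-1 *: ((tmx - (qi v (c + a'%:Z *+ 2))%:M) *m tpow c a')
  else 1%:M.

(** Through the conjugation by [g], subtracting [[h + 1]] turns the factor into [E]; as [E] raises
    [h] by 2, the successive shifts are [c + 2i] with [c = h + 1]. *)
Lemma tpow_gmx a nu (y : V) : pr nu *m y = y ->
  tpow (pairing (alpha i0) nu + 1) a *m (gmx *m y) = gmx *m (dp E0 a *m y).
Proof.
move=> hy; elim: a => [|a IH] /=; first by rewrite !mul1mx.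
rewrite -!scalemxAl -scalemxAr -!mulmxA IH mulmxBl (tmx_gmx (w_dpE i0 a hy)); congr (_ *: _).
rewrite mul_scalar_mx (_ : pairing _ (_ + _) + 1 = pairing (alpha i0) nu + 1 + a%:Z *+ 2) ?addrK //.
by rewrite pairingDr pairingMnr cartan_diag [2 *+ _]zmuln; lia.
Qed.

Lemma factor_comm c d : (tmx - c%:M) *m (tmx - d%:M) = (tmx - d%:M) *m (tmx - c%:M).
Proof.
by rewrite [LHS]mulmxBl [RHS]mulmxBr scalar_mxC mulmxBl [in LHS]mulmxBr scalar_mxC.
Qed.

Lemma tpow_first c a :
  tpow c a.+1 = (qi v a.+1)^-1 *: ((tmx - (qi v c)%:M) *m tpow (c + 2) a).
Proof.
elim: a => [|a IH]; first by rewrite /= addr0.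
rewrite -[tpow c a.+2]/(_ *: (_ *m tpow c a.+1)) IH -scalemxAr mulmxA factor_comm -mulmxA.
rewrite -[tpow (c + 2) a.+1]/(_ *: (_ *m tpow (c + 2) a)) -scalemxAr.
rewrite (_ : c + a.+1%:Z *+ 2 = c + 2 + a%:Z *+ 2) //; lia.
Qed.

(** Changing [c] by 2 only adds an integral multiple of a product with fewer factors. Hence one
    element of the coideal subalgebra serves all weights of a given parity. *)
Lemma tpow_shift c a : tpow c a.+1 - tpow (c + 2) a.+1 =
  (v ^ (c + a.+1%:Z) + v ^ (- (c + a.+1%:Z))) *: tpow (c + 2) a.
Proof.
rewrite tpow_first -[tpow (c + 2) a.+1]/(_ *: (_ *m tpow (c + 2) a)).
rewrite -scalerBr -mulmxBl opprB addrC addrA subrK -raddfB /=.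
rewrite mul_scalar_mx scalerA; congr (_ *: _).
apply: (mulfI (qiS_neq0 gv a)); rewrite mulrA divff ?qiS_neq0 // mul1r.
rewrite (_ : c + 2 + a%:Z *+ 2 = c + a.+1%:Z + a.+1%:Z); last by lia.
rewrite [X in _ - qi v X](_ : c = c + a.+1%:Z - a.+1%:Z); last by lia.
rewrite /qi !(opprD, genzD gv) !opprK -!invr_expz.
have := genz_neq0 gv c; have := genz_neq0 gv a.+1; have := gen_sqrB1_neq0 gv; have := gen_neq0 gv.
move: (v ^ c) (v ^ a.+1) => x y v0 h y0 x0.
by field; rewrite v0 h y0 x0.
Qed.

End Diagonal.

(** * Leading terms for height and parity *)

Section Leading.
Variable L : V -> Prop.
Hypothesis L0 : L 0.
Hypothesis LD : forall x y, L x -> L y -> L (x + y).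
Hypothesis LZ : forall c x, laurent v c -> L x -> L (c *: x).
Hypothesis LE : forall i a x, L x -> L (dp (rE i) a *m x).
Hypothesis LF : forall i a x, L x -> L (dp (rF i) a *m x).

Local Notation p0 := (pairing (alpha i0)).

Definition same (x y : int) : Prop := exists k : int, x = y + k *+ 2.

(** The remainders allowed in leading term estimates: integral, of smaller height, and of fixed
    parity against [alpha_0], so that shifted powers of [t] can be applied to them in turn. *)
Definition below (p h : int) (z : V) : Prop :=
  L z /\ forall nu, pr nu *m z != 0 -> same (p0 nu) p /\ hgt nu < h.

Lemma same_refl x : same x x.
Proof. by exists 0; rewrite mul0rn addr0. Qed.

Lemma same_trans x y z : same x y -> same y z -> same x z.
Proof. by move=> [k ->] [l ->]; exists (k + l); lia. Qed.

Lemma same_sym x y : same x y -> same y x.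
Proof. by move=> [k ->]; exists (- k); lia. Qed.

Lemma below0 p h : below p h 0.
Proof. by split=> // nu; rewrite mulmx0 eqxx. Qed.

Lemma belowD p h x y : below p h x -> below p h y -> below p h (x + y).
Proof.
move=> [Lx hx] [Ly hy]; split; first exact: LD.
move=> nu; rewrite mulmxDr; have [e|/hx //] := eqVneq (pr nu *m x) 0.
by rewrite e add0r; exact: hy.
Qed.

Lemma belowZ p h c x : laurent v c -> below p h x -> below p h (c *: x).
Proof.
move=> lc [Lx hx]; split; first exact: LZ.
move=> nu; rewrite -scalemxAr; have [e|/hx //] := eqVneq (pr nu *m x) 0.
by rewrite e scaler0 eqxx.
Qed.

Lemma belowN p h x : below p h x -> below p h (- x).
Proof. by rewrite -scaleN1r; apply: belowZ; exact: (laurent_intr _ (-1)). Qed.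

Lemma belowB p h x y : below p h x -> below p h y -> below p h (x - y).
Proof. by move=> hx /belowN; exact: belowD. Qed.

Lemma below_sum p h I (e : seq I) (P : pred I) (F : I -> V) :
  (forall i, P i -> below p h (F i)) -> below p h (\sum_(i <- e | P i) F i).
Proof. by move=> hF; elim/big_ind: _ => //; [exact: below0 | exact: belowD]. Qed.

Lemma below_wt p h nu z : L z -> pr nu *m z = z -> same (p0 nu) p -> hgt nu < h -> below p h z.
Proof.
move=> Lz wz hp hh; split=> // mu; have [->//|h1] := eqVneq mu nu.
by rewrite (pr_neq h1 wz) eqxx.
Qed.

Lemma below_le p h h' z : h <= h' -> below p h z -> below p h' z.
Proof. by move=> hh [Lz hz]; split=> // nu /hz [? ?]; split=> //; lia. Qed.

Lemma p0_rev j : p0 (alpha (rev_ord j)) = p0 (alpha j).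
Proof.
rewrite !cartan -!val_eqE /= inordK; last by lia.
have := ltn_ord j; move: (j : nat) => k hk.
rewrite (_ : (r == r.*2.+1 - k.+1)%N = (r == k)%N); last by lia.
rewrite (_ : (r == (r.*2.+1 - k.+1).+1)%N = (k == r.+1)%N); last by lia.
rewrite (_ : (r.*2.+1 - k.+1 == r.+1)%N = (r == k.+1)%N); last by lia.
by rewrite addrAC.
Qed.

Lemma bmx_leading j a nu z : j != i0 -> L z -> pr nu *m z = z ->
  below (p0 (nu + alpha j *+ a)) (hgt nu + a%:Z) (dp (bmx j) a *m z - dp (rE j) a *m z).
Proof.
move=> j0 Lz wz; rewrite (bmx_formula j0 a wz) big_ord_recl.
rewrite !mulr0 oppr0 !addr0 expr0z scale1r subn0 mul1mx addrAC subrr add0r.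
apply: below_sum => k _; apply: belowZ; first exact: laurent_inv.
have hw := w_dpF (rev_ord j) (lift ord0 k) (w_dpE j (a - lift ord0 k) wz).
have ka : (lift ord0 k <= a)%N by rewrite /= /bump; have := ltn_ord k; lia.
apply: below_wt hw _ _; first by apply: LF; apply: LE.
  exists (- (p0 (alpha j) *+ lift ord0 k)).
  rewrite pairingBr 2!pairingDr !pairingMnr p0_rev !zmuln -subzn //.
  move: (p0 nu) (p0 (alpha j)) (nat_of_ord (lift ord0 k)) => x y l.
  by ring.
rewrite !hgtD hgtN !hgtMn !hgt_alpha !zmuln -subzn //.
by rewrite /= /bump; move: (hgt nu) => x; lia.
Qed.

Variables (B D : nat).
Hypothesis hB : forall nu (z : V), pr nu *m z = z -> hgt nu < - B%:Z -> z = 0.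
Hypothesis nilF : forall k, (D <= k)%N -> dp (rF i0) k = 0.

Lemma gmxE (z : V) : gmx D *m z = z + \sum_(k < D) gco k.+1 *: (dp (rF i0) k.+1 *m z).
Proof.
rewrite /gmx big_ord_recl mulmxDl /gco bin_small // expr0 scale1r mul1mx mulmx_suml.
by congr (_ + _); apply: eq_bigr => k _; rewrite -scalemxAl.
Qed.

Lemma laurent_gco k : laurent v (gco k).
Proof. by rewrite /gco exprnP; exact: laurent_inv. Qed.

(** Outer induction on [a], for changing [c] by [tpow_shift]; inner induction on the height of [z],
    because [g z] differs from [z] by vectors [F^(k) z] to which the claim must be applied with the
    same [c]. *)
Lemma tpow_leading a nu z c : L z -> pr nu *m z = z -> same c (p0 nu + 1) ->
  below (p0 nu) (hgt nu + a%:Z) (tpow c a *m z - dp (rE i0) a *m z).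
Proof.
elim: a nu z c => [|a IHa] nu z c Lz wz hc; first by rewrite subrr; exact: below0.
have [n] : exists n : nat, hgt nu < - B%:Z + n%:Z.
  by exists (`|hgt nu| + B + 1)%N; lia.
elim: n nu z c Lz wz hc => [|n IHn] nu z c Lz wz hc hn.
  by rewrite (hB wz) ?mulmx0 ?subrr; [exact: below0 | lia].
have base : below (p0 nu) (hgt nu + a.+1%:Z)
    (tpow (p0 nu + 1) a.+1 *m z - dp (rE i0) a.+1 *m z).
  (* [tpow (g z) = g (E^(a) z)], with [g] expanded on both sides: besides the two leading terms,
     only images of the vectors [F^(k) z], [k > 0], are left. *)
  have := tpow_gmx nilF a.+1 wz; rewrite !gmxE mulmxDr => /(canRL (addrK _)) ->.
  rewrite addrAC [X in X - _]addrAC subrr add0r mulmx_sumr.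
  rewrite -sumrB; apply: below_sum => k _.
  rewrite -scalemxAr -scalerBr; apply: belowZ; first exact: laurent_gco.
  set y := dp (rF i0) k.+1 *m z.
  have wy : pr (nu - alpha i0 *+ k.+1) *m y = y by exact: w_dpF.
  have Ly : L y by exact: LF.
  have hy : hgt (nu - alpha i0 *+ k.+1) = hgt nu - k.+1%:Z.
    by rewrite hgtD hgtN hgtMn hgt_alpha zmuln; lia.
  have py : same (p0 (nu - alpha i0 *+ k.+1)) (p0 nu).
    exists (- k.+1%:Z); rewrite pairingBr pairingMnr cartan_diag [2 *+ _]zmuln; lia.
  have wF' := w_dpF i0 k.+1 (w_dpE i0 a.+1 wz).
  have wE' := w_dpE i0 a.+1 wy.
  have hyE : hgt (nu - alpha i0 *+ k.+1 + alpha i0 *+ a.+1) = hgt nu - k.+1%:Z + a.+1%:Z.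
    by rewrite hgtD hy hgtMn hgt_alpha zmuln; lia.
  have pyE : same (p0 (nu - alpha i0 *+ k.+1 + alpha i0 *+ a.+1)) (p0 nu).
    apply: same_trans py; exists a.+1%:Z.
    rewrite pairingDr [X in _ + X]pairingMnr cartan_diag [2 *+ _]zmuln; lia.
  apply: belowB.
    by apply: below_wt wF' _ _; [apply: LF; exact: LE | rewrite addrAC | rewrite addrAC hyE; lia].
  rewrite -[tpow _ _ *m y](subrK (dp (rE i0) a.+1 *m y)); apply: belowD.
    have hc1 : same (p0 nu + 1) (p0 (nu - alpha i0 *+ k.+1) + 1).
      by apply: same_sym; case: py => l ->; exists l; lia.
    have [|Lt ht] := IHn (nu - alpha i0 *+ k.+1) y (p0 nu + 1) Ly wy hc1; first by rewrite hy; lia.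
    split=> // mu /ht [h1 h2]; split; first exact: same_trans h1 py.
    by move: h2; rewrite hy; lia.
  by apply: below_wt wE' pyE _; [exact: LE | rewrite hyE; lia].
have step d : same d (p0 nu + 1) -> below (p0 nu) (hgt nu + a.+1%:Z)
    (tpow d a.+1 *m z - tpow (d + 2) a.+1 *m z).
  move=> hd; rewrite -mulmxBl tpow_shift -scalemxAl; apply: belowZ.
    by apply: laurentD; exact: laurent_genz.
  rewrite -[tpow _ _ *m z](subrK (dp (rE i0) a *m z)); apply: belowD.
    apply: below_le (IHa nu z _ Lz wz _); first by lia.
    by case: hd => l ->; exists (l + 1); lia.
  apply: below_wt (w_dpE i0 a wz) _ _; first exact: LE.
    exists a%:Z; rewrite pairingDr pairingMnr cartan_diag [2 *+ _]zmuln; lia.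
  by rewrite hgtD hgtMn hgt_alpha zmuln; lia.
(* An admissible [c] is joined to [p0 nu + 1] by steps of 2, in either direction. *)
case: hc => k ->; case: (intP k) => [|l|l]; first by rewrite mul0rn addr0.
- elim: l.+1 => [|l' IH]; first by rewrite mul0rn addr0.
  rewrite -[X in X - _](subrK (tpow (p0 nu + 1 + l'%:Z *+ 2) a.+1 *m z)) -addrA.
  apply: belowD => //; rewrite -opprB; apply: belowN.
  rewrite (_ : p0 nu + 1 + l'.+1%:Z *+ 2 = p0 nu + 1 + l'%:Z *+ 2 + 2); last by lia.
  by apply: step; exists l'%:Z.
- elim: l.+1 => [|l' IH]; first by rewrite mul0rn addr0.
  rewrite -[X in X - _](subrK (tpow (p0 nu + 1 + (- l'%:Z) *+ 2) a.+1 *m z)) -addrA.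
  apply: belowD => //.
  rewrite [X in tpow X _ *m z - tpow (_ + _ *+ 2) _ *m z](_ : _ = p0 nu + 1 + - l'.+1%:Z *+ 2) //.
  rewrite (_ : p0 nu + 1 + (- l'%:Z) *+ 2 = p0 nu + 1 + (- l'.+1%:Z) *+ 2 + 2); last by lia.
  by apply: step; exists (- l'.+1%:Z).
Qed.

End Leading.
End Coideal.

(** * Extremal vectors *)

Section Sorting.
Variable r : nat.
Implicit Types (S T : state r) (i : idx r).

Definition tot S : int := \sum_a (S a)%:R.
Definition raise S i := odflt S (stE i S).
Definition lower S i := odflt S (stF i S).

Lemma raise_wt S i : raise S i = S \/ stwt (raise S i) = stwt S + alpha i.
Proof. by rewrite /raise; case e : (stE i S) => [T|]; [right; exact: stE_wt | left]. Qed.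

Lemma lower_wt S i : lower S i = S \/ stwt (lower S i) = stwt S - alpha i.
Proof. by rewrite /lower; case e : (stF i S) => [T|]; [right; exact: stF_wt | left]. Qed.

Lemma tot_stwt S : tot S = \sum_a (stwt S) 0 a.
Proof. by apply: eq_bigr => a _; rewrite mxE. Qed.

Lemma sum_alpha i : \sum_a alpha i 0 a = 0.
Proof.
have e (b : 'I_(r.*2.+2)) : \sum_a (a == b)%:R = 1 :> int.
  by rewrite (bigD1 b) //= eqxx big1 ?addr0 // => a /negPf ->.
rewrite (eq_bigr (fun a => (a == lo i)%:R - (a == hi i)%:R)) => [|a _].
  by rewrite sumrB !e subrr.
by rewrite alphaE -!val_eqE.
Qed.

Lemma tot_raise S i : tot (raise S i) = tot S.
Proof.
have [->//|e] := raise_wt S i; rewrite !tot_stwt e.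
rewrite (eq_bigr (fun a => stwt S 0 a + alpha i 0 a)) => [|a _]; last by rewrite mxE.
by rewrite big_split /= sum_alpha addr0.
Qed.

Lemma tot_lower S i : tot (lower S i) = tot S.
Proof.
have [->//|e] := lower_wt S i; rewrite !tot_stwt e.
rewrite (eq_bigr (fun a => stwt S 0 a - alpha i 0 a)) => [|a _]; last by rewrite mxE [X in _ + X]mxE.
by rewrite sumrB sum_alpha subr0.
Qed.

Lemma tot_foldl_raise p S : tot (foldl raise S p) = tot S.
Proof. by elim: p S => //= i p IH S; rewrite IH tot_raise. Qed.

Lemma tot_foldl_lower p S : tot (foldl lower S p) = tot S.
Proof. by elim: p S => //= i p IH S; rewrite IH tot_lower. Qed.

Definition topped S := forall i, S (hi i) -> S (lo i).
Definition bottomed S := forall i, S (lo i) -> S (hi i).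

Lemma toppedP S : topped S <-> forall i, stE i S = None.
Proof.
split=> h i; rewrite /stE; last by apply/implyP; have := h i; rewrite /stE; do 2 case: (S _).
by case h1 : (S (hi i)); rewrite ?andbF // h.
Qed.

Lemma bottomedP S : bottomed S <-> forall i, stF i S = None.
Proof.
split=> h i; rewrite /stF; last by apply/implyP; have := h i; rewrite /stF; do 2 case: (S _).
by case h1 : (S (lo i)); rewrite // h.
Qed.

Lemma topped_le S : topped S -> forall a b : 'I_(r.*2.+2), (a <= b)%N -> S b -> S a.
Proof.
move=> h a b; have [d] := ubnP (b - a)%N; elim: d b => // d IH b.
move=> hd; rewrite leq_eqVlt => /orP [/eqP/val_inj -> //|ab] Sb.
have bm : (b.-1 < r.*2.+1)%N by have := ltn_ord b; lia.
have e : hi (Ordinal bm) = b by apply: val_inj; rewrite /= /bump; lia.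
apply: (IH (lo (Ordinal bm))); rewrite /=; [by lia | by lia|].
by apply: h; rewrite e.
Qed.

(** The occupied indices of such a state form an initial segment, determined by its size. *)
Lemma topped_eq S T : topped S -> topped T -> tot S = tot T -> S = T.
Proof.
move=> hS hT.
have P (S1 T1 : state r) a : topped S1 -> topped T1 -> S1 a -> ~~ T1 a -> tot T1 < tot S1.
  move=> h1 h2 Sa Ta; rewrite /tot (bigD1 a) //= [in X in _ < X](bigD1 a) //= Sa (negPf Ta).
  rewrite ltr_leD //; apply: ler_sum => b _; rewrite ler_nat.
  case Tb : (T1 b) => //; case: (leqP a b) => ab; first by rewrite (topped_le h2 ab Tb) in Ta.
  by rewrite (topped_le h1 (ltnW ab) Sa).
move=> e; apply/ffunP => a; case Sa : (S a); case Ta : (T a) => //.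
  by have := P S T a hS hT Sa (negbT Ta); rewrite e ltxx.
by have := P T S a hT hS Ta (negbT Sa); rewrite e ltxx.
Qed.

Definition flip S : state r := [ffun a => S (rev_ord a)].

Lemma flipK : involutive flip.
Proof. by move=> S; apply/ffunP => a; rewrite !ffunE rev_ordK. Qed.

Lemma tot_flip S : tot (flip S) = tot S.
Proof.
by rewrite /tot [RHS](reindex_inj rev_ord_inj); apply: eq_bigr => a _; rewrite ffunE.
Qed.

Lemma rev_lo i : rev_ord (lo i) = hi (rev_ord i).
Proof. by apply: val_inj; rewrite /= /bump; have := ltn_ord i; lia. Qed.

Lemma rev_hi i : rev_ord (hi i) = lo (rev_ord i).
Proof. by apply: val_inj; rewrite /= /bump; have := ltn_ord i; lia. Qed.

Lemma bottomed_flip S : bottomed S <-> topped (flip S).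
Proof.
split=> h i; first by rewrite !ffunE rev_lo rev_hi; exact: h.
by have := h (rev_ord i); rewrite !ffunE rev_lo rev_hi rev_ordK.
Qed.

Lemma bottomed_eq S T : bottomed S -> bottomed T -> tot S = tot T -> S = T.
Proof.
rewrite !bottomed_flip => hS hT e; apply: (can_inj flipK).
by apply: topped_eq; rewrite // !tot_flip.
Qed.

Lemma hgt_stwt S : hgt (stwt S) = - \sum_a (S a)%:R * (a : nat)%:Z.
Proof. by congr (- _); apply: eq_bigr => a _; rewrite mxE. Qed.

Lemma hgt_stwt_le0 S : hgt (stwt S) <= 0.
Proof. by rewrite hgt_stwt oppr_le0; apply: sumr_ge0 => a _; rewrite mulr_ge0. Qed.

Lemma hgt_stwt_ge S : - (\sum_(a < r.*2.+2) (a : nat)%:Z) <= hgt (stwt S).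
Proof.
rewrite hgt_stwt lerN2; apply: ler_sum => a _.
by case: (S a); rewrite ?mul1r ?mul0r.
Qed.

Lemma raise_topped S : exists p, topped (foldl raise S p).
Proof.
have [n] : exists n : nat, - n%:Z < hgt (stwt S) by exists (`|(hgt (stwt S) - 1)%R|%N); lia.
elim: n S => [|n IH] S hn.
  by have := hgt_stwt_le0 S; move: hn; rewrite oppr0; lia.
have [/existsP [i hi]|/existsPn h] := boolP [exists i, stE i S != None]; last first.
  by exists [::]; apply/toppedP => i; apply/eqP; rewrite -[_ == _]negbK h.
case e : (stE i S) hi => [T|] // _.
have [|p hp] := IH T; first by rewrite (stE_wt e) hgtD hgt_alpha; lia.
by exists (i :: p); rewrite /= {2}/raise e.
Qed.

Lemma lower_bottomed S : exists p, bottomed (foldl lower S p).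
Proof.
pose C : int := \sum_(a < r.*2.+2) (a : nat)%:Z.
have [n] : exists n : nat, hgt (stwt S) < n%:Z - C by exists (`|(hgt (stwt S) + C + 1)%R|%N); lia.
elim: n S => [|n IH] S hn.
  by have := hgt_stwt_ge S; rewrite -/C; lia.
have [/existsP [i hi]|/existsPn h] := boolP [exists i, stF i S != None]; last first.
  by exists [::]; apply/bottomedP => i; apply/eqP; rewrite -[_ == _]negbK h.
case e : (stF i S) hi => [T|] // _.
have [|p hp] := IH T; first by rewrite (stF_wt e) hgtD hgtN hgt_alpha; lia.
by exists (i :: p); rewrite /= {2}/lower e.
Qed.

Definition lst n : state r := flip (wst r n n.+1).

Lemma topped_wst n : topped (wst r n n.+1).
Proof. by move=> i; rewrite !ffunE /= /bump; lia. Qed.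

Lemma bottomed_lst n : bottomed (lst n).
Proof. by apply/bottomed_flip; rewrite /lst flipK; exact: topped_wst. Qed.

Lemma tot_lst n : tot (lst n) = tot (wst r n n.+1).
Proof. exact: tot_flip. Qed.

End Sorting.

(** * Maximal divided powers on tensor products *)

Section DividedSum.
Variables (K : fieldType) (v u : K) (n : nat) (A B : 'M[K]_n).
Hypothesis gv : generic v.
Hypothesis hu : u = v \/ u = v^-1.
Hypothesis BA : B *m A = u ^+ 2 *: (A *m B).
Hypothesis BB : B *m B = 0.

Lemma dp_moveL a : B *m dp v A a = (u ^+ a * u ^+ a) *: (dp v A a *m B).
Proof.
elim: a => [|a IH] /=; first by rewrite mulmx1 mul1mx expr0 mul1r scale1r.
rewrite -scalemxAr mulmxA BA -scalemxAl -mulmxA IH -scalemxAr -!scalemxAl !scalerA mulmxA.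
by congr (_ *: _); rewrite !(exprS u a) expr2; move: (qi v _)^-1 (u ^+ a) => x y; ring.
Qed.

(** The q-binomial formula, cut off after two terms by [B^2 = 0]. *)
Lemma dp_add a : dp v (A + B) a.+1 = dp v A a.+1 + u ^+ a *: (dp v A a *m B).
Proof.
have u0 : u != 0 by case: hu => ->; rewrite ?invr_neq0 ?gen_neq0.
elim: a => [|a IH].
  by rewrite /= qi1 // invr1 !scale1r !mulmx1 mul1mx ?expr0 ?scale1r.
apply: (scalerI (qiS_neq0 gv a.+1)); rewrite -dpS // IH scalerDr.
have := dp_moveL a.+1; have := dp_moveL a; have := dpS gv A a.+1; have := dpS gv A a.
move: (dp v A a) (dp v A a.+1) (dp v A a.+2) => d0 d1 d2 E1 E2 M1 M2.
rewrite mulmxDl !mulmxDr -!scalemxAr !mulmxA E1 E2 M1 M2 -!scalemxAl -(mulmxA d0) BB.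
rewrite mulmx0 !scaler0 addr0 -addrA !scalerA -scalerDl; congr (_ + _ *: _).
have -> : qi v a.+2 = u^-1 * qi v a.+1 + u ^+ a.+1.
  rewrite (_ : a.+2%:Z = 1 + a.+1%:Z) //; case: hu => ->.
    by rewrite qiD // qi1 // mulr1 exprN1 addrC.
  by rewrite addrC qiD // qi1 // mulr1 expr1z invrK exprVn exprnN.
rewrite !exprS; move: (qi v _) (u ^+ a) => x y; field.
exact: u0.
Qed.
End DividedSum.

Section Climb.
Variables (K : fieldType) (v : K) (r : nat).
Hypothesis gv : generic v.
Local Notation ext := (exterior r gv).
Local Notation tz := (tz gv).

Definition wv (M : repn v r) (x : 'cV[K]_(dim M)) : Prop := exists nu, pr M nu *m x = x.

Lemma prP (M : repn v r) nu (x : 'cV[K]_(dim M)) :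
  pr M nu *m x = x <-> forall a, x a 0 != 0 -> wt a = nu.
Proof.
split=> [<- a|h].
  by rewrite mul_diag_mx !mxE; case: (wt a =P nu) => // _; rewrite mul0r eqxx.
apply/colP => a; rewrite mul_diag_mx !mxE.
have [->|/h ->] := eqVneq (x a 0) 0; first by rewrite mulr0.
by rewrite eqxx mul1r.
Qed.

Lemma tz_wt (M : repn v r) nu (x : 'cV[K]_(dim M)) S :
  pr M nu *m x = x -> pr (tensor M ext gv) (nu + stwt S) *m tz x S = tz x S.
Proof.
rewrite !prP => h a; case: (mxtens_indexP a) => b c.
rewrite /tz mxE mxtens_indexK /= mulf_eq0 negb_or !ord1 => /andP [/h hb].
rewrite mxE; case: (c =P enum_rank S) => [-> _|_]; last by rewrite /= eqxx.
by rewrite /twt mxtens_indexK /= hb /extwt enum_rankK.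
Qed.

(** A path of divided powers, each taken with the largest exponent not killing the vector or with a
    larger one that does; the end is fixed up to a power of [v]. The indices are prescribed and the
    exponents are not, so that one path can be followed in both factors of a tensor product. *)
Fixpoint climb (M : repn v r) (X : idx r -> 'M[K]_(dim M)) (p : seq (idx r))
    (x y : 'cV[K]_(dim M)) : Prop :=
  if p is i :: p' then wv x /\ exists a, dp v (X i) a.+1 *m x = 0 /\
    climb X p' (dp v (X i) a *m x) y
  else exists z : int, y = v ^ z *: x.

Section Basic.
Variables (M : repn v r) (X : idx r -> 'M[K]_(dim M)).

Lemma wvZ c (x : 'cV[K]_(dim M)) : wv x -> wv (c *: x).
Proof. by move=> [nu h]; exists nu; rewrite -scalemxAr h. Qed.

Lemma climbZ p z x y : climb X p x y -> climb X p (v ^ z *: x) y.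
Proof.
elim: p x => [|i p IH] x /=.
  by move=> [w ->]; exists (w - z); rewrite scalerA -genzD // subrK.
move=> [wx [a [h0 h1]]]; split; first exact: wvZ.
by exists a; rewrite -!scalemxAr h0 scaler0; split=> //; exact: IH.
Qed.

Lemma climb_lat x0 p x y : lat X x0 x -> climb X p x y -> lat X x0 y.
Proof.
elim: p x => [|i p IH] x hx /=.
  by move=> [z ->]; apply: latZ => //; exact: laurent_genz.
by move=> [_ [a [_]]]; apply: IH; exact: latX.
Qed.

Lemma climb_cat p p' x y y' : climb X p x y -> climb X p' y y' -> climb X (p ++ p') x y'.
Proof.
elim: p x => [|i p IH] x /=.
  move=> [z ->] /(climbZ (- z)); rewrite scalerA -genzD // addNr expr0z scale1r //.
by move=> [wx [a [h0 h1]]] h2; split=> //; exists a; split=> //; exact: IH h1 h2.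
Qed.

Lemma climb_const p x : wv x -> (forall i, X i *m x = 0) -> climb X p x x.
Proof.
move=> wx h; elim: p => [|i p IH] /=; first by exists 0; rewrite expr0z scale1r.
split=> //; exists 0%N; rewrite /= mul1mx; split=> //.
by rewrite -scalemxAl -mulmxA mul1mx h scaler0.
Qed.

End Basic.

Section TensorClimb.
Variables (M : repn v r).
Local Notation MX := (tensor M ext gv).
Variables (X : idx r -> 'M[K]_(dim M)) (X' : idx r -> 'M[K]_(dim MX)).
Variables (o : idx r -> state r -> option (state r)) (u : K).
Variables (A B : idx r -> 'M[K]_(dim MX)).
Hypothesis hu : u = v \/ u = v^-1.
Hypothesis X'E : forall i, X' i = A i + B i.
Hypothesis BA : forall i, B i *m A i = u ^+ 2 *: (A i *m B i).
Hypothesis BB : forall i, B i *m B i = 0.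
Hypothesis A_tz : forall i x S, exists z : int, A i *m tz x S = v ^ z *: tz (X i *m x) S.
Hypothesis B_tz : forall i x S, wv x -> exists z : int, B i *m tz x S =
  v ^ z *: (if o i S is Some T then tz x T else 0).

Lemma tz0 S : tz (0 : 'cV[K]_(dim M)) S = 0.
Proof. by rewrite -(scale0r (0 : 'cV[K]_(dim M))) tzZ scale0r. Qed.

Lemma dpA_tz i a x S : exists z : int,
  dp v (A i) a *m tz x S = v ^ z *: tz (dp v (X i) a *m x) S.
Proof.
elim: a => [|a [z IH]] /=; first by exists 0; rewrite !mul1mx expr0z scale1r.
have [w hw] := A_tz i (dp v (X i) a *m x) S; exists (z + w).
rewrite -scalemxAl -mulmxA IH -scalemxAr hw -scalemxAl -mulmxA tzZ !scalerA genzD //.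
by congr (_ *: _); rewrite -mulrA mulrC.
Qed.

(** If [S] moves, the exponent is [a + 1] and the term with [A] alone vanishes; otherwise it is [a]
    and the term with [B] vanishes. A single term survives, with a power of [v] as coefficient. *)
Lemma climb_step i a x S : wv x -> dp v (X i) a.+1 *m x = 0 ->
  exists a' z, dp v (X' i) a'.+1 *m tz x S = 0 /\
    dp v (X' i) a' *m tz x S = v ^ z *: tz (dp v (X i) a *m x) (odflt S (o i S)).
Proof.
move=> wx h0; rewrite X'E.
have dpE b y : dp v (A i + B i) b.+1 *m y =
    dp v (A i) b.+1 *m y + u ^+ b *: (dp v (A i) b *m (B i *m y)).
  rewrite (dp_add gv hu (BA i) (BB i)); move: (dp v (A i) b.+1) (dp v (A i) b) => d1 d0.
  by rewrite mulmxDl -scalemxAl -mulmxA.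
have [z0 hB] := B_tz i S wx; case: (o i S) hB => [T|] hB; rewrite [odflt _ _]/=.
- exists a.+1; have [z1 e1] := dpA_tz i a x T; have [z2 e2] := dpA_tz i a.+1 x S.
  have [z3 e3] := dpA_tz i a.+2 x S; have [z4 e4] := dpA_tz i a.+1 x T.
  have [w hw] : exists w : int, u ^+ a = v ^ w.
    by case: hu => ->; [exists a%:Z | exists (- a%:Z); rewrite exprVn exprnN].
  exists (w + z0 + z1); rewrite !dpE hB -!scalemxAr e1 e2 e3 e4.
  have h1 : dp v (X i) a.+2 *m x = 0.
    by rewrite -[dp v _ _]/(_ *: (_ *m dp v (X i) a.+1)) -scalemxAl -mulmxA h0 mulmx0 scaler0.
  rewrite h0 h1 !tz0 !scaler0 addr0 add0r; split=> //.
  by rewrite !scalerA hw !genzD // mulrA.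
- rewrite scaler0 in hB; exists a; have [z1 e1] := dpA_tz i a.+1 x S.
  have {}dpE b : dp v (A i + B i) b *m tz x S = dp v (A i) b *m tz x S.
    case: b => [|b]; first by rewrite !mul1mx.
    by rewrite dpE hB mulmx0 scaler0 addr0.
  have [z2 e2] := dpA_tz i a x S; exists z2; rewrite !dpE e1 e2 h0 tz0 scaler0.
  by split.
Qed.

Lemma climb_tz p x y S : climb X p x y ->
  climb X' p (tz x S) (tz y (foldl (fun S i => odflt S (o i S)) S p)).
Proof.
elim: p x S => [|i p IH] x S /=; first by move=> [z ->]; exists z; rewrite tzZ.
move=> [wx [a [h0 h1]]]; have [a' [z [e0 e1]]] := climb_step S wx h0.
split; first by case: wx => nu hx; exists (nu + stwt S); exact: tz_wt.
by exists a'; split=> //; rewrite e1; apply: climbZ; exact: IH.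
Qed.

End TensorClimb.

Section TensorEF.
Variables (M : repn v r).
Local Notation MX := (tensor M ext gv).

Lemma rE_tz i (z : 'cV[K]_(dim M)) s : rE MX i *m tz z s =
  tz (rE M i *m z) s + (if stE i s is Some t then tz (rK M i *m z) t else 0).
Proof.
apply: etrans (mulmxDl (rE M i *t 1%:M) (rK M i *t rE ext i) (z *t ket K s)) _.
rewrite !tensmx_mul mul1mx extE_ket.
by case: (stE i s) => [t|] //=; rewrite tensmx0.
Qed.

Lemma climbE p x y S : climb (rE M) p x y ->
  climb (rE MX) p (tz x S) (tz y (foldl (@raise r) S p)).
Proof.
pose A i : 'M[K]_(dim MX) := rE M i *t (1%:M : 'M[K]_(dim ext)).
pose B i : 'M[K]_(dim MX) := rK M i *t rE ext i.
apply: (@climb_tz _ _ _ _ v A B) => [|//|i|i|i z s|i z s [nu hz]]; first by left.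
- rewrite /A /B; apply: etrans (tensmx_mul (rK M i) (rE ext i) (rE M i) 1%:M) _; rewrite mulmx1.
  apply: etrans (congr1 _ (esym (tensmx_mul (rE M i) 1%:M (rK M i) (rE ext i)))).
  by rewrite mul1mx rKE // cartan_diag tensmxZl.
- by apply: etrans (tensmx_mul (rK M i) (rE ext i) (rK M i) (rE ext i)) _; rewrite extEE tensmx0.
- exists 0; rewrite expr0z scale1r.
  by apply: etrans (tensmx_mul (rE M i) 1%:M z (ket K s)) _; rewrite mul1mx.
- exists (pairing (alpha i) nu); apply: etrans (tensmx_mul (rK M i) (rE ext i) z (ket K s)) _.
  rewrite extE_ket /rK (dg_wt _ hz) tensmxZl.
  by case: (stE i s) => [t|] //=; rewrite tensmx0.
Qed.

Lemma climbF p x y S : climb (rF M) p x y ->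
  climb (rF MX) p (tz x S) (tz y (foldl (@lower r) S p)).
Proof.
pose A i : 'M[K]_(dim MX) := rF M i *t rKV ext i.
pose B i : 'M[K]_(dim MX) := (1%:M : 'M[K]_(dim M)) *t rF ext i.
apply: (@climb_tz _ _ _ _ v^-1 A B) => [|//|i|i|i z s|i z s [nu hz]]; first by right.
- rewrite /A /B; apply: etrans (tensmx_mul 1%:M (rF ext i) (rF M i) (rKV ext i)) _; rewrite mul1mx.
  apply: etrans (congr1 _ (esym (tensmx_mul (rF M i) (rKV ext i) 1%:M (rF ext i)))).
  rewrite mulmx1 rKVF // cartan_diag tensmxZr scalerA.
  by rewrite exprVn mulVf ?scale1r // expf_neq0 ?gen_neq0.
- by apply: etrans (tensmx_mul 1%:M (rF ext i) 1%:M (rF ext i)) _; rewrite extFF tensmx0.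
- exists (- pairing (alpha i) (stwt s)).
  by apply: etrans (tensmx_mul (rF M i) (rKV ext i) z (ket K s)) _; rewrite dg_ket tensmxZr.
- exists 0; rewrite expr0z scale1r; apply: etrans (tensmx_mul 1%:M (rF ext i) z (ket K s)) _.
  rewrite extF_ket mul1mx.
  by case: (stF i s) => [t|] //=; rewrite tensmx0.
Qed.

End TensorEF.

Local Notation tmod := (tmod r gv).
Local Notation hvec := (hvec r gv).

Fixpoint lvec (s : seq nat) : 'cV[K]_(dim (tmod s)) :=
  if s is n :: s' return 'cV[K]_(dim (tmod s)) then tz (lvec s') (lst r n) else 1%:M.

Lemma wv_hvec s : wv (hvec s).
Proof.
elim: s => [|n s [nu IH]]; last by eexists; exact: tz_wt IH.
by exists 0; apply/prP => a _.
Qed.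

Lemma wv_lvec s : wv (lvec s).
Proof.
elim: s => [|n s [nu IH]]; last by eexists; exact: tz_wt IH.
by exists 0; apply/prP => a _.
Qed.

Lemma rE_hvec s i : rE (tmod s) i *m hvec s = 0.
Proof.
elim: s => [|n s IH]; first by rewrite mul0mx.
have /toppedP h := @topped_wst r n.
by apply: etrans (rE_tz _ _ _) _; rewrite h IH tz0 addr0.
Qed.

Lemma rF_lvec s i : rF (tmod s) i *m lvec s = 0.
Proof.
elim: s => [|n s IH]; first by rewrite mul0mx.
have /bottomedP h := @bottomed_lst r n.
by apply: etrans (rF_tz _ _ _ _) _; rewrite h IH tz0 scaler0 addr0.
Qed.

(** The path of the first factors is prolonged until the last factor is on top. The first factors
    stay put meanwhile, and the number of occupied places identifies the state reached. *)
Lemma climb_hvec s : exists p, climb (rE (tmod s)) p (lvec s) (hvec s).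
Proof.
elim: s => [|n s [p IH]]; first by exists [::], 0; rewrite expr0z scale1r.
have [p' hp'] := raise_topped (foldl (@raise r) (lst r n) p).
have h := climb_cat IH (climb_const p' (wv_hvec s) (rE_hvec s)).
exists (p ++ p'); have := climbE (lst r n) h.
rewrite foldl_cat (topped_eq hp' (@topped_wst r n)) //.
by rewrite !tot_foldl_raise tot_lst.
Qed.

Lemma climb_lvec s : exists p, climb (rF (tmod s)) p (hvec s) (lvec s).
Proof.
elim: s => [|n s [p IH]]; first by exists [::], 0; rewrite expr0z scale1r.
have [p' hp'] := lower_bottomed (foldl (@lower r) (wst r n n.+1) p).
have h := climb_cat IH (climb_const p' (wv_lvec s) (rF_lvec s)).
exists (p ++ p'); have := climbF (wst r n n.+1) h.
rewrite foldl_cat (bottomed_eq hp' (@bottomed_lst r n)) //.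
by rewrite !tot_foldl_lower tot_lst.
Qed.

Lemma hvec_lat s : lat (rE (tmod s)) (lvec s) (hvec s).
Proof. by have [p hp] := climb_hvec s; apply: climb_lat hp; exact: lat_gen. Qed.

Lemma lvec_lat s : lat (rF (tmod s)) (hvec s) (lvec s).
Proof. by have [p hp] := climb_lvec s; apply: climb_lat hp; exact: lat_gen. Qed.

End Climb.

Section AbstractScalars.
Variables (K : fieldType) (v : K).
Hypothesis gv : generic v.

Lemma qi2 : qi v 2 = v + v^-1.
Proof.
have := gen_sqrB1_neq0 gv; have := gen_neq0 gv; rewrite /qi -invr_expz -[v ^ 2]/(v ^+ 2) => v0 h.
by field; rewrite v0 h.
Qed.

Lemma dg_qi r (M : repn v r) i : dg M (fun x => qi v (pairing (alpha i) x)) =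
  (v - v^-1)^-1 *: (rK M i - rKV M i).
Proof.
rewrite /rK /rKV /dg -linearB -linearZ; congr diag_mx; apply/rowP => a.
by rewrite !mxE mulrC.
Qed.

End AbstractScalars.

(** * The action of U *)

Lemma generic_q : generic q.
Proof.
split=> [|n n0]; first exact: q_neq0.
rewrite /q -rmorphXn -[1]/(FracField.tofrac 1) tofrac_eq.
apply/eqP => /(congr1 (fun p : {poly rat} => size p)).
by rewrite size_polyXn size_poly1 => -[n1]; rewrite n1 in n0.
Qed.

Opaque q.

Lemma is_laurentP c : laurent q c -> is_laurent c.
Proof.
elim=> {c} [z|||c d _ [p [m ->]] _ [t [n ->]]|c d _ [p [m ->]] _ [t [n ->]]].
- by exists z%:P, 0%N; rewrite expr0 divr1 map_polyC /= !rmorph_int.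
- by exists 'X, 0%N; rewrite map_polyX expr0 divr1.
- by exists 1, 1%N; rewrite !rmorph1 expr1 mul1r.
- have qn k : q ^+ k != 0 by rewrite expf_neq0 // q_neq0.
  exists (p * 'X^n + t * 'X^m), (m + n)%N.
  rewrite addf_div // rmorphD !rmorphM /= !map_polyXn rmorphD !rmorphM.
  by rewrite !rmorphXn -exprD /=.
- by exists (p * t), (m + n)%N; rewrite mulf_div !rmorphM exprD.
Qed.

Lemma qintE (a : nat) : qint a = qi q a.
Proof. by rewrite /qint /qi -exprnP exprnN. Qed.

Lemma qfactE a : qfact a = qf q a.
Proof.
rewrite /qfact /qf big_add1 big_mkord; apply: eq_bigr => i _; exact: qintE.
Qed.

HB.instance Definition _ := GRing.isZmodMorphism.Build Qq Qq qbar (proj1 qbar_rmorphism).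
HB.instance Definition _ := GRing.isMonoidMorphism.Build Qq Qq qbar (proj2 qbar_rmorphism).

Lemma qbarD c d : qbar (c + d) = qbar c + qbar d. Proof. exact: rmorphD. Qed.
Lemma qbarM c d : qbar (c * d) = qbar c * qbar d. Proof. exact: rmorphM. Qed.

Lemma qbar_qz (z : int) : qbar (q ^ z) = q ^ (- z).
Proof. by rewrite fmorphXz /= qbar_q exprz_inv. Qed.

Lemma qbar_qi z : qbar (qi q z) = qi q z.
Proof.
rewrite /qi fmorph_div !rmorphB /= fmorphV /= !qbar_qz qbar_q opprK invrK.
by rewrite -opprB -[X in _ / X]opprB invrN mulrNN.
Qed.

Lemma laurent_qbar c : laurent q c -> laurent q (qbar c) /\ qbar (qbar c) = c.
Proof.
elim=> {c} [z|||c d _ [h1 h2] _ [h3 h4]|c d _ [h1 h2] _ [h3 h4]].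
- by rewrite !rmorph_int; split=> //; exact: laurent_intr.
- by rewrite qbar_q fmorphV /= qbar_q invrK; split=> //; exact: laurent_genV.
- by rewrite fmorphV /= qbar_q invrK qbar_q; split=> //; exact: laurent_gen.
- rewrite !(qbarD c d, qbarD (qbar c)) h2 h4; by split=> //; exact: laurentD.
- rewrite !(qbarM c d, qbarM (qbar c)) h2 h4; by split=> //; exact: laurentM.
Qed.

Section Evaluation.
Variable r : nat.
Implicit Types (M : repn q r) (x y : expr r).

Fixpoint ev M x : 'M[Qq]_(dim M) :=
  match x with
  | EGen (GE i) => rE M i
  | EGen (GF i) => rF M i
  | EGen (GK i) => rK M i
  | EGen (GKV i) => rKV M i
  | EConst c => c%:M
  | EAdd x y => ev M x + ev M y
  | EMul x y => ev M x *m ev M y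
  end.

Lemma ev_Ueq M x y : Ueq x y -> ev M x = ev M y.
Proof.
elim=> {x y} //=.
- by move=> x y z _ -> _ ->.
- by move=> x x' y y' _ -> _ ->.
- by move=> x x' y y' _ -> _ ->.
- by move=> x y z; exact: addrA.
- by move=> x y; exact: addrC.
- by move=> x; rewrite raddf0 add0r.
- by move=> x y z; exact: mulmxA.
- by move=> x; exact: mul1mx.
- by move=> x; rewrite raddf0 mul0mx.
- by move=> x y z; exact: mulmxDl.
- by move=> x y z; exact: mulmxDr.
- by move=> c d; rewrite raddfD.
- by move=> c d; rewrite scalar_mxM.
- by move=> c x; rewrite scalar_mxC.
- by move=> i; rewrite rKKV //; exact: generic_q.
- by move=> i; rewrite rKVK //; exact: generic_q.
- by move=> i j; exact: dgC.
- move=> i j; rewrite rKE; last exact: generic_q.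
  by rewrite -scalemxAl -mulmxA rKKV ?mulmx1 ?mul_scalar_mx //; exact: generic_q.
- move=> i j; rewrite rKF; last exact: generic_q.
  by rewrite -scalemxAl -mulmxA rKKV ?mulmx1 ?mul_scalar_mx //; exact: generic_q.
- move=> i j; rewrite !mul_scalar_mx !scaleN1r rEF_dg dg_qi scalerA.
  by [].
- move=> i j ij; rewrite mul_scalar_mx qintE (qi2 generic_q) -!mulmxA.
  exact: rserreE1.
- by move=> i j ij; exact: rserreE0.
- move=> i j ij; rewrite mul_scalar_mx qintE (qi2 generic_q) -!mulmxA.
  exact: rserreF1.
- by move=> i j ij; exact: rserreF0.
Qed.

Definition act M (u : U r) : 'M[Qq]_(dim M) := ev M (repr u).

Lemma act_pi M x : act M (\pi_(U r) x)%qT = ev M x.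
Proof. by apply: ev_Ueq; exact: U_reprP. Qed.

Lemma actD M (x y : U r) : act M (x + y) = act M x + act M y.
Proof. exact: (act_pi M (EAdd (repr x) (repr y))). Qed.

Lemma actM M (x y : U r) : act M (x * y) = act M x *m act M y.
Proof. exact: (act_pi M (EMul (repr x) (repr y))). Qed.

Lemma actc M c : act M (Uconst r c) = c%:M.
Proof. exact: act_pi. Qed.

Lemma act1 M : act M 1 = 1%:M.
Proof. exact: actc. Qed.

Lemma actZ M c (x : U r) : act M (c *: x) = c *: act M x.
Proof.
have -> : c *: x = Uconst r c * x by [].
by rewrite actM actc mul_scalar_mx.
Qed.

Lemma actE M i : act M (E i) = rE M i. Proof. exact: act_pi. Qed.
Lemma actF M i : act M (F i) = rF M i. Proof. exact: act_pi. Qed.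
Lemma actK M i : act M (Defs.K i) = rK M i. Proof. exact: act_pi. Qed.
Lemma actKV M i : act M (KV i) = rKV M i. Proof. exact: act_pi. Qed.

Lemma act_0 M : act M 0 = 0.
Proof. by rewrite -(scale0r (0 : U r)) actZ scale0r. Qed.

Lemma act_opp M (x : U r) : act M (- x) = - act M x.
Proof. by rewrite -scaleN1r actZ scaleN1r. Qed.

Lemma act_sumU M I (s : seq I) (p : pred I) (G : I -> U r) :
  act M (\sum_(i <- s | p i) G i) = \sum_(i <- s | p i) act M (G i).
Proof. by elim/big_rec2: _ => [|i x y _ <-]; rewrite ?act_0 ?actD. Qed.

End Evaluation.

(** * Homogeneous elements of the negative part *)

Section NegativePart.
Variable r : nat.
Local Notation m := (r.*2.+1).
Local Notation gq := generic_q.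
Implicit Types (x y u : U r) (nu : lattice r).

Definition Fn (j : nat) : U r := F (inord j).
Local Notation uw := (words (r := r) Fn m).

Lemma Fn_serre1 i j : (i < m)%N -> (j < m)%N -> `|i - j|%N = 1%N ->
  Fn i * Fn i * Fn j + Fn j * Fn i * Fn i = (q + q^-1) *: (Fn i * Fn j * Fn i).
Proof.
move=> im jm ij; rewrite -(qi2 gq) -qintE.
have h : `|(inord i : idx r) - (inord j : idx r)|%N = 1%N by rewrite !inordK.
have := U_eqP (Ueq_serreF1 h).
by rewrite -!UaddE -!UmulE.
Qed.

Lemma Fn_serre0 i j : (i < m)%N -> (j < m)%N -> (1 < `|i - j|)%N -> Fn i * Fn j = Fn j * Fn i.
Proof.
move=> im jm ij.
have h : (1 < `|(inord i : idx r) - (inord j : idx r)|)%N by rewrite !inordK.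
have := U_eqP (Ueq_serreF0 h).
by rewrite -!UmulE.
Qed.

Lemma FnE (i : idx r) : F i = Fn i.
Proof. by rewrite /Fn inord_val. Qed.

Lemma alE (i : idx r) : alpha i = al r i.
Proof. by rewrite /al inord_val. Qed.

Lemma uwF i nu x : uw nu x -> uw (nu + alpha i) (F i * x).
Proof. by move=> h; rewrite FnE alE; apply: wordsM. Qed.

Lemma uwZ c nu x : uw nu x -> uw nu (c *: x).
Proof. exact: wordsZ. Qed.

Lemma uwB nu x y : uw nu x -> uw nu y -> uw nu (x - y).
Proof. by move=> hx hy; apply: wordsD => //; rewrite -scaleN1r; exact: uwZ. Qed.

Lemma uwM nu mu x y : uw nu x -> uw mu y -> uw (nu + mu) (x * y).
Proof.
move=> hx hy; elim: hx => {nu x} [nu|c|nu x z _ hx _ hz|j nu x jm _ hx].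
- by rewrite mul0r; exact: words0.
- by rewrite add0r mulr_algl; exact: uwZ.
- by rewrite mulrDl; exact: wordsD.
- by rewrite -mulrA addrAC; exact: wordsM.
Qed.

Lemma KFKV (i j : idx r) : Defs.K i * F j * KV i = q ^ (- pairing (alpha i) (alpha j)) *: F j.
Proof.
have := U_eqP (Ueq_KF i j).
by rewrite -!UmulE.
Qed.

Lemma KVK (i : idx r) : KV i * Defs.K i = 1.
Proof. by have := U_eqP (Ueq_KVK i); rewrite -!UmulE. Qed.

Lemma KKV (i : idx r) : Defs.K i * KV i = 1.
Proof. by have := U_eqP (Ueq_KKV i); rewrite -!UmulE. Qed.

Lemma uw_K i nu x : uw nu x ->
  Defs.K i * x * KV i = q ^ (- pairing (alpha i) nu) *: x.
Proof.
elim=> {nu x} [nu|c|nu x z _ hx _ hz|j nu x jm _ hx].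
- by rewrite mulr0 mul0r scaler0.
- by rewrite pairing0r oppr0 expr0z scale1r -scalerAr mulr1 -scalerAl KKV.
- by rewrite mulrDr mulrDl hx hz scalerDr.
- have -> : Defs.K i * (Fn j * x) * KV i = (Defs.K i * Fn j * KV i) * (Defs.K i * x * KV i).
    by rewrite !mulrA -[_ * KV i * Defs.K i]mulrA KVK mulr1.
  rewrite hx KFKV -scalerAl -scalerAr scalerA pairingDr opprD.
  by rewrite addrC (genzD gq).
Qed.

(** The pairings with simple roots determine a weight only up to multiples of (1, ..., 1); this
    linear form, zero on roots, removes the ambiguity in [pairing_inj]. *)
Definition totl nu : int := \sum_a nu 0 a.

Lemma totlD nu mu : totl (nu + mu) = totl nu + totl mu.
Proof. by rewrite /totl -big_split; apply: eq_bigr => a _; rewrite mxE. Qed.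

Lemma totl0 : totl 0 = 0.
Proof. by apply: big1 => a _; rewrite mxE. Qed.

Lemma totl_alpha i : totl (alpha i : lattice r) = 0.
Proof. exact: sum_alpha. Qed.

Lemma Uminus_words x : Uminus x -> exists s : seq (lattice r * U r),
  (forall p, p \in s -> totl p.1 = 0 /\ uw p.1 p.2) /\ x = \sum_(p <- s) p.2.
Proof.
elim=> {x} [x [i ->]|c _|x y _ [s [hs ->]] _ [t [ht ->]]|x y _ [s [hs ->]] _ [t [ht ->]]].
- exists [:: (alpha i, F i)]; rewrite big_seq1; split=> // p; rewrite inE => /eqP ->.
  rewrite totl_alpha; split=> //=; have := uwF i (@words1 _ r _ Fn m 1).
  by rewrite add0r scale1r mulr1.
- exists [:: (0, c%:A)]; rewrite big_seq1; split=> // p; rewrite inE => /eqP ->.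
  by rewrite totl0; split=> //; exact: words1.
- exists (s ++ t); rewrite big_cat; split=> // p; rewrite mem_cat => /orP []; [exact: hs | exact: ht].
- exists [seq (p.1 + p'.1, p.2 * p'.2) | p <- s, p' <- t]; split.
    move=> p /allpairsP [[a b] [/= ha hb ->]] /=.
    have [h1 h2] := hs _ ha; have [h3 h4] := ht _ hb.
    by rewrite totlD h1 h3; split=> //; exact: uwM.
  rewrite big_allpairs_dep /= mulr_suml; apply: eq_bigr => p _.
  by rewrite mulr_sumr.
Qed.

Lemma pairing_inj nu mu : totl nu = totl mu ->
  (forall i, pairing (alpha i) nu = pairing (alpha i) mu) -> nu = mu.
Proof.
move=> ht h; apply/eqP; rewrite -subr_eq0; apply/eqP; set x := nu - mu.
have hx i : x 0 (lo i) = x 0 (hi i).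
  by apply/eqP; rewrite -subr_eq0 -pairing_alpha pairingBr h subrr.
have e (a : 'I_(r.*2.+2)) : x 0 a = x 0 0.
  have [n] := ubnP (a : nat); elim: n a => // n IH a; rewrite ltnS => an.
  have [->//|a0] := eqVneq a 0.
  have a1 : (a.-1 < r.*2.+1)%N by have := ltn_ord a; move: a0; rewrite -val_eqE /=; lia.
  have a2 : hi (Ordinal a1) = a.
    by apply: val_inj; rewrite /= /bump; move: a0; rewrite -val_eqE /=; lia.
  rewrite -[in LHS]a2 -hx IH //=; move: a0; rewrite -val_eqE /=; lia.
have : totl x = 0 by rewrite /x totlD ht -totlD subrr totl0.
rewrite /totl (eq_bigr (fun=> x 0 0)) => [|a _]; last exact: e.
rewrite sumr_const card_ord => /eqP; rewrite mulrn_eq0 /= => /eqP x0.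
by apply/rowP => a; rewrite e x0 mxE.
Qed.

Lemma totl_sum I (s : seq I) (p : pred I) (G : I -> lattice r) :
  totl (\sum_(i <- s | p i) G i) = \sum_(i <- s | p i) totl (G i).
Proof. by elim/big_rec2: _ => [|i x y _ <-]; rewrite ?totl0 ?totlD. Qed.

Lemma totlMn nu n : totl (nu *+ n) = totl nu *+ n.
Proof. by elim: n => [|n IH]; rewrite ?totl0 // !mulrS totlD IH. Qed.

Lemma totl_weight (mu : NPi r) : totl (weight mu) = 0.
Proof.
by rewrite /weight totl_sum big1 // => i _; rewrite totlMn totl_alpha mul0rn.
Qed.

Lemma hgt_weight (mu : NPi r) : hgt (weight mu) = ht mu.
Proof.
rewrite /weight hgt_sum /ht -[RHS]natz natr_sum; apply: eq_bigr => i _.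
by rewrite hgtMn hgt_alpha.
Qed.

Lemma weight_inj : injective (@weight r).
Proof.
have C (mu : NPi r) (i : idx r) : coef_al i (weight mu) = mu i.
  rewrite /weight coef_al_sum (bigD1 i) //= big1 => [|j ji].
    by rewrite addr0 alE; elim: (mu i) => [|n IH];
      rewrite ?coef_al0 // mulrS coef_alD IH coef_alal // eqxx; lia.
  rewrite alE; elim: (mu j) => [|n IH]; rewrite ?coef_al0 // mulrS coef_alD IH coef_alal //.
  by rewrite addr0; move: ji; rewrite -val_eqE => /negPf /= ->.
move=> mu mu' e; apply/ffunP => i.
by have := C mu i; rewrite e C => -[].
Qed.

(** Induction on the number of homogeneous terms. If one has the wrong degree, some [K_i] separates
    it from the weight of [x]; comparing the two eigenvalues of conjugation by [K_i] eliminates that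
    term and rescales the others. *)
Lemma Uminus_wt_words (mu : NPi r) x : Uminus_wt mu x -> uw (weight mu) x.
Proof.
move=> [/Uminus_words [s [hs ->]]].
have [n] := ubnP (size s); elim: n s hs => // n IH s hs; rewrite ltnS => sn hK.
have [/allP h|] := boolP (all (fun p : lattice r * U r => p.1 == weight mu) s).
  elim: s hs h {sn hK} => [|p s IHs] hs h; first by rewrite big_nil; exact: words0.
  rewrite big_cons; apply: wordsD.
    by rewrite -(eqP (h p (mem_head _ _))); case: (hs p (mem_head _ _)).
  by apply: IHs => c cs; [apply: hs | apply: h]; rewrite inE cs orbT.
move=> /allPn [p ps np].
have [i hi] : exists i, pairing (alpha i) p.1 != pairing (alpha i) (weight mu).
  apply/existsP; apply: contraR np => /existsPn h; apply/eqP; apply: pairing_inj.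
    by rewrite totl_weight; case: (hs p ps).
  by move=> i; apply/eqP; rewrite -[_ == _]negbK h.
pose c nu : Qq := q ^ (- pairing (alpha i) nu).
have cn : c (weight mu) - c p.1 != 0.
  rewrite subr_eq0; apply: contra hi => /eqP /(genz_inj gq) /oppr_inj e.
  by rewrite e.
pose w := \sum_(p' <- s) p'.2; have hKi := hK i.
have e : (c (weight mu) - c p.1) *: w = \sum_(p' <- rem p s) (c p'.1 - c p.1) *: p'.2.
  rewrite scalerBl -hKi /w mulr_sumr mulr_suml scaler_sumr -sumrB.
  rewrite (big_rem p ps) /= (uw_K i (proj2 (hs p ps))) subrr add0r.
  rewrite big_seq [RHS]big_seq; apply: eq_bigr => p' p's.
  by rewrite (uw_K i (proj2 (hs p' (mem_rem p's)))) scalerBl.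
have {}e : w = \sum_(p' <- [seq (p'.1, ((c (weight mu) - c p.1)^-1 * (c p'.1 - c p.1)) *: p'.2)
    | p' <- rem p s]) p'.2.
  rewrite big_map /=; apply: (scalerI cn); rewrite e scaler_sumr; apply: eq_bigr => p' _.
  by rewrite scalerA mulrA divff // mul1r.
rewrite -/w e; apply: IH.
- move=> p'' /mapP [p' /mem_rem p's ->] /=; have [h1 h2] := hs p' p's.
  by split=> //; exact: uwZ.
- by rewrite size_map size_rem //; move: sn ps; case: (s).
- by rewrite -e.
Qed.

Section Module.
Variable M : repn q r.
Local Notation V := 'cV[Qq]_(dim M).

Lemma uw_pr nu x mu : uw nu x -> pr M (mu - nu) *m act M x = act M x *m pr M mu.
Proof.
move=> hx; elim: hx mu => {nu x} [nu|c|nu x z _ hx _ hz|j nu x jm _ hx] mu.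
- by rewrite act_0 mulmx0 mul0mx.
- by rewrite subr0 actZ act1 scalemx1 scalar_mxC.
- by rewrite actD mulmxDr mulmxDl hx hz.
- by rewrite actM actF opprD addrA mulmxA prF -mulmxA hx mulmxA.
Qed.

Lemma uw_wt nu x mu (z : V) : uw nu x -> pr M mu *m z = z ->
  pr M (mu - nu) *m (act M x *m z) = act M x *m z.
Proof. by move=> hx hz; rewrite mulmxA (uw_pr _ hx) -mulmxA hz. Qed.

Definition hbound : nat := (\sum_(a < dim M) `|hgt (wt a)|)%N.

Lemma hgt_bound nu (z : V) : pr M nu *m z = z -> z != 0 ->
  - hbound%:Z <= hgt nu <= hbound%:Z.
Proof.
move=> /prP h nz; have [a ha] : exists a, z a 0 != 0.
  apply/existsP; apply: contraR nz => /existsPn h0; apply/eqP/colP => a.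
  by rewrite [RHS]mxE; apply/eqP; rewrite -[_ == _]negbK h0.
have {}h := h a ha.
have : (`|hgt nu| <= hbound)%N by rewrite -h /hbound (bigD1 a) //= leq_addr.
by lia.
Qed.

Lemma hgt_below nu (z : V) : pr M nu *m z = z -> hgt nu < - hbound%:Z -> z = 0.
Proof.
move=> hz hn; apply/eqP; apply: contraTT hn => /(hgt_bound hz) /andP [h _].
by rewrite -leNgt.
Qed.

Lemma uw_nilpotent nu x (z : V) : uw nu x -> (hbound + hbound)%N%:Z < hgt nu -> act M x *m z = 0.
Proof.
move=> hx hn; rewrite (sum_pr z) mulmx_sumr big1 // => mu _.
have [->|nz] := eqVneq (pr M mu *m z) 0; first by rewrite mulmx0.
apply: (hgt_below (uw_wt hx (pr_id mu z))).
have := hgt_bound (pr_id mu z) nz; rewrite hgtD hgtN; move: (hgt nu) (hgt mu) hn => a b; lia.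
Qed.

(** All weights have height within [hbound] of 0, so lowering by more than twice this bound gives 0.
    This turns equality in the completion into equality on [M]. *)
Lemma Ufilt_kills N x (z : V) : (hbound + hbound < N)%N -> Ufilt N x -> act M x *m z = 0.
Proof.
move=> hN; elim=> {x} [|u w x mu y _ _ hx hm _ hy].
  by rewrite act_0 mul0mx.
rewrite actD mulmxDl hy addr0 !actM -mulmxA (uw_nilpotent _ (Uminus_wt_words hx)) ?mulmx0 //.
by rewrite hgt_weight; lia.
Qed.

End Module.

End NegativePart.

Opaque act.

(** * Integral vectors and the bar involutions *)

Section Integral.
Variable r : nat.
Local Notation m := (r.*2.+1).
Local Notation gq := generic_q.
Local Notation uw := (words (r := r) (@Fn r) m).
Implicit Types (x y u : U r) (nu : lattice r).

Lemma act_divided M u a : act M ((qf q a)^-1 *: u ^+ a) = dp q (act M u) a.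
Proof.
elim: a => [|a IH]; first by rewrite qf0 invr1 scale1r expr0 act1.
rewrite qfS invfM exprS -scalerA actZ scalerAr actM IH.
by [].
Qed.

Lemma act_divpow M (i : idx r) a : act M (divpow i a) = dp q (rF M i) a.
Proof. by rewrite /divpow qfactE act_divided actF. Qed.

Lemma uw_divpow (i : idx r) a nu x : uw nu x -> uw (nu + alpha i *+ a) (divpow i a * x).
Proof.
move=> hx; rewrite /divpow -scalerAl; apply: uwZ.
elim: a => [|a IH]; first by rewrite expr0 mul1r addr0.
by rewrite mulrSr addrA exprS -mulrA; exact: uwF.
Qed.

Lemma lat_UminusA (M : repn q r) nh (vh z : 'cV[Qq]_(dim M)) : pr M nh *m vh = vh ->
  lat (rF M) vh z -> forall nu, exists y,
    [/\ UminusA y, uw nu y & pr M (nh - nu) *m z = act M y *m vh].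
Proof.
move=> wh; have Z nu : [/\ UminusA (0 : U r), uw nu 0 & (0 : 'cV[Qq]_(dim M)) = act M 0 *m vh].
  split; [|exact: words0 | by rewrite act_0 mul0mx].
  by rewrite -(scale0r 1); apply: subalg_const; apply: is_laurentP; exact: laurent0.
elim=> {z} [nu|nu|z z' _ hz _ hz' nu|c z lc _ hz nu|i a z _ hz nu].
- have [->|n0] := eqVneq nu 0.
    exists 1; split; last by rewrite subr0 wh act1 mul1mx.
      by rewrite -[1]scale1r; apply: subalg_const; apply: is_laurentP; exact: laurent1.
    by rewrite -[1]scale1r; exact: words1.
  exists 0; rewrite (pr_neq _ wh) //.
  by apply: contra n0 => /eqP e; rewrite -[nu]opprK -[- nu](addKr nh) e addrC subrr oppr0.
- by exists 0; rewrite mulmx0.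
- have [y [h1 h2 h3]] := hz nu; have [y' [h1' h2' h3']] := hz' nu.
  exists (y + y'); split; [exact: subalg_add | exact: wordsD |].
  by rewrite mulmxDr actD mulmxDl h3 h3'.
- have [y [h1 h2 h3]] := hz nu; exists (c *: y); split; last first.
  + by rewrite -scalemxAr actZ -scalemxAl h3.
  + exact: uwZ.
  + rewrite -mulr_algl; apply: subalg_mul => //; apply: subalg_const; exact: is_laurentP.
- have [y [h1 h2 h3]] := hz (nu - alpha i *+ a); exists (divpow i a * y); split.
  + by apply: subalg_mul => //; apply: subalg_gen; exists i, a.
  + by rewrite -[nu](subrK (alpha i *+ a)); exact: uw_divpow.
  + rewrite actM act_divpow -mulmxA -h3 opprB addrA.
    have := @pr_dpX _ q r M (rF M) (fun i => - alpha i) (prF M) (nh - nu + alpha i *+ a) i a.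
    by rewrite mulNrn addrK addrAC mulmxA => ->; rewrite mulmxA addrAC.
Qed.

Section BarInvolutions.
Variables psi psii : U r -> U r.
Hypothesis hpsi : is_bar psi.
Hypothesis hpsii : is_bari psii.

Lemma Ui_const c : Ui (c%:A : U r). Proof. exact: subalg_const. Qed.

Lemma Ui1 : Ui (1 : U r).
Proof. by rewrite -[1]scale1r; exact: Ui_const. Qed.

Lemma Ui0 : Ui (0 : U r).
Proof. by rewrite -[0](scale0r (1 : U r)); exact: Ui_const. Qed.

Lemma UiZ c u : Ui u -> Ui (c *: u).
Proof. by move=> h; rewrite -mulr_algl; apply: subalg_mul => //; exact: Ui_const. Qed.

Lemma UiD u x : Ui u -> Ui x -> Ui (u + x). Proof. exact: subalg_add. Qed.
Lemma UiM u x : Ui u -> Ui x -> Ui (u * x). Proof. exact: subalg_mul. Qed.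

Lemma UiX u a : Ui u -> Ui (u ^+ a).
Proof. by move=> h; elim: a => [|a IH]; rewrite ?expr0 ?exprS; [exact: Ui1 | exact: UiM]. Qed.

Let pD x y : psi (x + y) = psi x + psi y. Proof. by case: hpsi => h _; apply: (barD h). Qed.
Let pM x y : psi (x * y) = psi x * psi y. Proof. by case: hpsi => h _; apply: (barM h). Qed.
Let pZ c x : psi (c *: x) = qbar c *: psi x. Proof. by case: hpsi => h _; apply: (barZ h). Qed.
Let p1 : psi 1 = 1. Proof. by case: hpsi => h _; exact: (bar1 h). Qed.
Let p0 : psi 0 = 0. Proof. by rewrite -[in LHS](scale0r (1 : U r)) pZ rmorph0 scale0r. Qed.
Let pX x a : psi (x ^+ a) = psi x ^+ a.
Proof. by elim: a => [|a IH]; rewrite ?expr0 // !exprS pM IH. Qed.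
Let pE i : psi (E i) = E i. Proof. by case: hpsi => _ /(_ i) []. Qed.
Let pF i : psi (F i) = F i. Proof. by case: hpsi => _ /(_ i) []. Qed.
Let pK i : psi (Defs.K i) = KV i. Proof. by case: hpsi => _ /(_ i) []. Qed.
Let pKV i : psi (KV i) = Defs.K i.
Proof. by rewrite -pK; case: hpsi => h _; apply: (barK h). Qed.

Let iD x y : Ui x -> Ui y -> psii (x + y) = psii x + psii y.
Proof. by case: hpsii => h _ _; apply: (barD h). Qed.
Let iM x y : Ui x -> Ui y -> psii (x * y) = psii x * psii y.
Proof. by case: hpsii => h _ _; apply: (barM h). Qed.
Let iZ c x : Ui x -> psii (c *: x) = qbar c *: psii x.
Proof. by case: hpsii => h _ _; apply: (barZ h). Qed.
Let i1 : psii 1 = 1. Proof. by case: hpsii => h _ _; exact: (bar1 h). Qed.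
Let iX x a : Ui x -> psii x = x -> psii (x ^+ a) = x ^+ a.
Proof.
move=> hx e; elim: a => [|a IH]; first by rewrite !expr0.
by rewrite !exprS iM ?IH ?e //; exact: UiX.
Qed.

(* [bgen j] is [ei j] for [j] in {1, ..., r} and [fi (rev_ord j)] for [rev_ord j] in {1, ..., r}. *)
Definition bgen (j : idx r) : U r := E j + F (rev_ord j) * KV j.

Lemma bgen_inv j : j != idx0 r -> Ui (bgen j) /\ psii (bgen j) = bgen j.
Proof.
move=> j0; case: hpsii => _ _ h.
have [rj|jr] := ltnP r j.
  have -> : bgen j = ei j.
    rewrite /bgen /ei; congr (_ + _).
    (* [j] and its opposite are not adjacent, so [K_j] commutes with [F] at the opposite index. *)
    have e := KFKV j (rev_ord j); rewrite cartan_far ?rev_far // oppr0 expr0z scale1r in e.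
    have -> : KV j * F (rev_ord j) = KV j * (Defs.K j * F (rev_ord j) * KV j) by rewrite e.
    by rewrite !mulrA KVK mul1r.
  split; last by case: (h j rj).
  by apply: subalg_gen; right; exists j => //; apply: Or43.
have rj : idx_pos (rev_ord j).
  have : (j : nat) != r by move: j0; rewrite -val_eqE /= inordK //; lia.
  by rewrite /idx_pos /=; have := ltn_ord j; lia.
have -> : bgen j = fi (rev_ord j) by rewrite /bgen /fi rev_ordK addrC.
split; last by case: (h _ rj).
by apply: subalg_gen; right; exists (rev_ord j) => //; apply: Or44.
Qed.

Lemma act_bgen M j : act M (bgen j) = bmx q M j.
Proof. by rewrite /bgen actD actM actE actF actKV. Qed.

Lemma act_psi_bgen M j : act M (psi (bgen j)) = bmx q^-1 M j.
Proof.
rewrite /bgen pD pM pE pF pKV actD actM actE actF actK /bmx; congr (_ + _ *m _).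
by apply: eq_dg => x; rewrite exprz_inv opprK.
Qed.

(* A bar invariant element with the same leading term as the divided power [E_0^(a)] on weight
   vectors whose weight has the parity of [c] + 1 against [alpha_0]; the factors are the
   [t - [c + 2 i]]. *)
Fixpoint tpoly (c : int) (a : nat) : U r :=
  if a is a'.+1 then (qi q a)^-1 *: ((ti r - (qi q (c + a'%:Z *+ 2))%:A) * tpoly c a') else 1.

Lemma Ui_ti : Ui (ti r). Proof. by apply: subalg_gen; left. Qed.

Lemma tpoly_inv c a : Ui (tpoly c a) /\ psii (tpoly c a) = tpoly c a.
Proof.
case: hpsii => _ ht _; elim: a => [|a [h1 h2]] /=; first by split; [exact: Ui1 | exact: i1].
have hf : Ui (ti r - (qi q (c + a%:Z *+ 2))%:A).
  by apply: UiD; [exact: Ui_ti | rewrite -scaleNr; exact: Ui_const].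
split; first by apply: UiZ; exact: UiM.
rewrite iZ; last exact: UiM.
rewrite iM // h2 -scaleNr iD; [|exact: Ui_ti|exact: Ui_const].
rewrite ht iZ ?i1; last exact: Ui1.
by rewrite fmorphV rmorphN /= !qbar_qi.
Qed.

Lemma act_tpoly M c a : act M (tpoly c a) = tpow q M c a.
Proof.
elim: a => [|a IH] /=; first exact: act1.
rewrite actZ actM IH actD act_opp actZ act1 scalemx1; congr (_ *: ((_ - _) *m _)).
by rewrite /ti !actD actZ actM actE actF actKV.
Qed.

Lemma act_psi_tpoly M c a : act M (psi (tpoly c a)) = tpow q^-1 M c a.
Proof.
elim: a => [|a IH] /=; first by rewrite p1; exact: act1.
rewrite pZ fmorphV /= qbar_qi pM -scaleNr pD pZ p1 rmorphN /= qbar_qi scaleNr.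
rewrite actZ actM IH actD act_opp actZ act1 scalemx1; congr (_ *: ((_ - _) *m _)).
rewrite /ti !pD pZ qbar_q pM pE pF pKV !actD actZ actM actE actF actK /tmx.
have -> : rK M (idx0 r) = kk q^-1 M (idx0 r); last by [].
by apply: eq_dg => x; rewrite exprz_inv opprK.
Qed.

(** * Reaching the integral form from the lowest weight vector *)

Section LowestWeight.
Variables (M : repn q r) (nl : lattice r) (vl : 'cV[Qq]_(dim M)).
Hypothesis wl : pr M nl *m vl = vl.
Hypothesis Fvl : forall i, rF M i *m vl = 0.
Local Notation V := 'cV[Qq]_(dim M).
Local Notation L := (lat (rE M) vl).
Local Notation pa := (pairing (alpha (idx0 r))).

Let L0 : L 0. Proof. exact: lat_zero. Qed.
Let LD (x y : V) : L x -> L y -> L (x + y). Proof. exact: latD. Qed.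
Let LZ c (x : V) : laurent q c -> L x -> L (c *: x). Proof. exact: latZ. Qed.
Let LE i a (x : V) : L x -> L (dp q (rE M i) a *m x). Proof. exact: latX. Qed.
Let LF i a (x : V) : L x -> L (dp q (rF M i) a *m x).
Proof. exact: (latE_F gq wl Fvl). Qed.

Let Lpr nu (z : V) : L z -> L (pr M nu *m z).
Proof. by apply: (lat_pr (sh := @alpha r) _ wl) => mu i; exact: prE. Qed.

Lemma dpF_nil i k : ((hbound M + hbound M).+1 <= k)%N -> dp q (rF M i) k = 0.
Proof.
move=> hk; suff e (z : V) : dp q (rF M i) k *m z = 0.
  by apply/matrixP => x y; have /colP/(_ x) := e (delta_mx y 0); rewrite -colE !mxE.
rewrite -(act_divpow M i k).
have h := uw_divpow i k (@words1 _ r _ (@Fn r) m 1); rewrite scale1r mulr1 in h.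
apply: (uw_nilpotent _ h); rewrite add0r hgtMn hgt_alpha zmuln; lia.
Qed.

(** The boolean [s] selects the action of [b] or of [psi b]: both have the leading term [E_j^(a)].
    The quantum factorials are bar invariant, so dividing by them keeps [b] invariant. *)
Lemma leading_op j a (p : int) : exists b : U r, [/\ Ui b, psii b = b &
  forall (s : bool) nu (z : V), L z -> pr M nu *m z = z -> same (pa nu) p ->
    below L (pa (nu + alpha j *+ a)) (hgt nu + a%:Z)
      (act M (if s then b else psi b) *m z - dp q (rE M j) a *m z)].
Proof.
have hq (s : bool) : (if s then q else q^-1) = q \/ (if s then q else q^-1) = q^-1.
  by case: s; [left | right].
have [->|j0] := eqVneq j (idx0 r).
  exists (tpoly (p + 1) a); have [h1 h2] := tpoly_inv (p + 1) a; split=> // s nu z Lz wz hp.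
  have -> : act M (if s then tpoly (p + 1) a else psi (tpoly (p + 1) a)) =
      tpow (if s then q else q^-1) M (p + 1) a.
    by case: s; [exact: act_tpoly | exact: act_psi_tpoly].
  have hc : same (p + 1) (pa nu + 1).
    by case: (same_sym hp) => k ->; exists k; lia.
  have [Lb hb] := tpow_leading gq (hq s) L0 LD LZ LE LF (@hgt_below r M)
    (dpF_nil (idx0 r)) a Lz wz hc.
  split=> // mu /hb [e1 e2]; split=> //; apply: same_trans e1 _.
  by apply: same_sym; rewrite pairingDr pairingMnr cartan_diag; exists a%:Z; rewrite zmuln; lia.
have [h1 h2] := bgen_inv j0.
have hZ : Ui ((qf q a)^-1 *: bgen j ^+ a) by apply: UiZ; exact: UiX.
have qfb : qbar (qf q a)^-1 = (qf q a)^-1.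
  rewrite fmorphV; congr (_^-1); elim: a {hZ} => [|a IH]; first by rewrite qf0 rmorph1.
  by rewrite qfS rmorphM /= qbar_qi; congr (_ * _).
exists ((qf q a)^-1 *: bgen j ^+ a); split=> //.
  by rewrite iZ ?iX ?qfb //; exact: UiX.
move=> s nu z Lz wz hp.
have -> : act M (if s then (qf q a)^-1 *: bgen j ^+ a else psi ((qf q a)^-1 *: bgen j ^+ a)) =
    dp q (bmx (if s then q else q^-1) M j) a.
  case: s; first by rewrite act_divided act_bgen.
  by rewrite pZ qfb pX act_divided act_psi_bgen.
exact: (bmx_leading gq (hq s) L0 LD LZ LE LF a j0 Lz wz).
Qed.

(* The intertwiner fixes [vl] and carries [psi u vl] to [psii u vl], hence reached vectors into
   [L]. *)
Definition reached (p : int) (x : V) : Prop := exists u h,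
  [/\ Ui u, act M (psi u) *m vl = x & below L p h (act M (psii u) *m vl)].

Lemma reached0 p : reached p 0.
Proof.
exists 0, 0; split; [exact: Ui0 | by rewrite p0 act_0 mul0mx |].
have -> : psii 0 = 0.
  by rewrite -[in LHS](scale0r (1 : U r)) iZ ?rmorph0 ?scale0r //; exact: Ui1.
by rewrite act_0 mul0mx; exact: below0.
Qed.

Lemma reachedD p (x y : V) : reached p x -> reached p y -> reached p (x + y).
Proof.
move=> [u [h [h1 <- h2]]] [u' [h' [h1' <- h2']]].
exists (u + u'), (`|h| + `|h'|); split; first exact: UiD.
  by rewrite pD actD mulmxDl.
rewrite iD; [|done|done]; rewrite actD mulmxDl; apply: (belowD LD).
  by apply: below_le h2; lia.
by apply: below_le h2'; lia.
Qed.

Lemma reached_sum p I (s : seq I) (P : pred I) (G : I -> V) :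
  (forall i, P i -> reached p (G i)) -> reached p (\sum_(i <- s | P i) G i).
Proof. by move=> h; elim/big_ind: _ => //; [exact: reached0 | exact: reachedD]. Qed.

Lemma reachedZ p c (x : V) : laurent q c -> reached p x -> reached p (c *: x).
Proof.
move=> lc [u [h [h1 <- h2]]]; have [lb cb] := laurent_qbar lc.
exists (qbar c *: u), h; split; first exact: UiZ.
  by rewrite pZ cb actZ scalemxAl.
by rewrite iZ; [|done]; rewrite cb actZ -scalemxAl; apply: (belowZ LZ).
Qed.

Lemma reached_same p p' (x : V) : same p p' -> reached p x -> reached p' x.
Proof.
move=> hp [u [h [h1 h2 [h3 h4]]]]; exists u, h; split=> //; split=> // nu /h4 [h5 h6].
by split=> //; exact: same_trans hp.
Qed.

(** [u] is replaced by [b * u]. As [b] is bar invariant, [psii (b * u)] is [b * psii u], and the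
    estimate for [b] is applied to each weight component of [psii u vl]; the returned estimate is
    the one for [psi b]. *)
Lemma reached_op j a p (x : V) : reached p x -> exists b : U r,
  reached (p + pa (alpha j) *+ a) (act M (psi b) *m x) /\
  forall nu (z : V), L z -> pr M nu *m z = z -> same (pa nu) p ->
    below L (pa (nu + alpha j *+ a)) (hgt nu + a%:Z)
      (act M (psi b) *m z - dp q (rE M j) a *m z).
Proof.
move=> [u [h [h1 <- [Ly hy]]]]; have [b [hb1 hb2 hb]] := leading_op j a p.
exists b; split; last by move=> nu z; exact: (hb false).
exists (b * u), (h + a%:Z); split; first exact: UiM.
  by rewrite pM actM mulmxA.
rewrite iM; [|done|done]; rewrite hb2 actM -mulmxA; set y := act M (psii u) *m vl in Ly hy *.
rewrite (sum_pr y) mulmx_sumr; apply: (below_sum L0 LD) => nu _.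
have [->|nz] := eqVneq (pr M nu *m y) 0; first by rewrite mulmx0; exact: below0.
have [e1 e2] := hy nu nz; have Lz : L (pr M nu *m y) by exact: Lpr.
have hs : same (pa (nu + alpha j *+ a)) (p + pa (alpha j) *+ a).
  by case: e1 => k e; exists k; rewrite pairingDr pairingMnr e; lia.
rewrite -[act M b *m _](subrK (dp q (rE M j) a *m (pr M nu *m y))); apply: (belowD LD).
  have [Lb hb'] := hb true nu _ Lz (pr_id nu y) e1; split; [exact: Lb | move=> mu /hb' [e3 e4]].
  by split; [exact: same_trans hs | lia].
apply: below_wt (w_dpE j a (pr_id nu y)) _ _ => //; first exact: LE.
by rewrite hgtD hgtMn hgt_alpha zmuln; lia.
Qed.

(** Outer induction on the height of [nu], inner induction on the generation of [x] in the
    lattice. *)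
Lemma lat_reached (x : V) nu : L x -> reached (pa nu) (pr M nu *m x).
Proof.
have [n] : exists n : nat, hgt nu < - (hbound M)%:Z + n%:Z.
  by exists (`|hgt nu| + hbound M + 1)%N; lia.
elim: n x nu => [|n IH] x nu hn Lx.
  rewrite (hgt_below (pr_id nu x)); first exact: reached0.
  by lia.
elim: Lx nu hn => {x} [nu _|nu _|x y _ hx _ hy nu hn|c x lc _ hx nu hn|i a x Lx hx nu hn].
- have [->|h] := eqVneq nu nl; last by rewrite (pr_neq h wl); exact: reached0.
  rewrite wl; exists 1, (hgt nl + 1); split; [exact: Ui1 | by rewrite p1 act1 mul1mx |].
  rewrite i1 act1 mul1mx; apply: below_wt wl _ _; [exact: lat_gen | exact: same_refl | lia].
- by rewrite mulmx0; exact: reached0.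
- by rewrite mulmxDr; apply: reachedD; [exact: hx | exact: hy].
- by rewrite -scalemxAr; apply: reachedZ => //; exact: hx.
case: a => [|a]; first by rewrite mul1mx; exact: hx.
pose mu := nu - alpha i *+ a.+1.
have hmu : hgt nu = hgt mu + a.+1%:Z.
  by rewrite /mu hgtD hgtN hgtMn hgt_alpha zmuln; lia.
have -> : pr M nu *m (dp q (rE M i) a.+1 *m x) = dp q (rE M i) a.+1 *m (pr M mu *m x).
  rewrite -[nu](subrK (alpha i *+ a.+1)) mulmxA; rewrite -/mu.
  by rewrite (@pr_dpX _ q r M (rE M) (@alpha r) (prE M) mu i a.+1) mulmxA.
set y := pr M mu *m x.
have Ly : L y by exact: Lpr.
have Ry : reached (pa mu) y by apply: hx; lia.
have [b [h1 h2]] := reached_op i a.+1 Ry.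
have pnu : pa mu + pa (alpha i) *+ a.+1 = pa nu.
  by rewrite -pairingMnr -pairingDr /mu subrK.
rewrite pnu in h1; have := h2 mu y Ly (pr_id mu x) (same_refl _).
rewrite /mu subrK -/mu -hmu; set z := _ - _ => -[Lz hz].
(* The divided power differs from the reached vector [psi b y] by [z], an element of [L] whose
   weight components have smaller height and the same parity: the outer induction applies to
   them. *)
have -> : dp q (rE M i) a.+1 *m y = act M (psi b) *m y - z by rewrite /z opprB addrC subrK.
apply: reachedD => //; rewrite -scaleN1r; apply: reachedZ; first exact: (laurent_intr _ (-1)).
rewrite (sum_pr z); apply: reached_sum => ka _.
have [->|nz] := eqVneq (pr M ka *m z) 0; first exact: reached0.
have [e1 e2] := hz ka nz; apply: reached_same e1 _; apply: IH => //.
by lia.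
Qed.

End LowestWeight.
End BarInvolutions.

End Integral.

(** * Weight components of the intertwiner *)

Section Components.
Variables (r : nat) (M : repn q r).
Local Notation m := (r.*2.+1).
Local Notation uw := (words (r := r) (@Fn r) m).
Local Notation V := 'cV[Qq]_(dim M).

Lemma weight0 : weight [ffun=> 0%N] = 0 :> lattice r.
Proof. by apply: big1 => i _; rewrite ffunE mulr0n. Qed.

(** Words are generated by multiplications on the left, so the induction must also record that
    [x vl] is a multiple of [vl], which the next [F_j] kills. *)
Lemma act_lowest (vl : V) nu x : (forall i, rF M i *m vl = 0) -> uw nu x ->
  nu != 0 -> act M x *m vl = 0.
Proof.
move=> Fvl hx n0; suff [c [e [/eqP|//]]] : exists c, act M x *m vl = c *: vl /\
    (nu = 0 \/ act M x *m vl = 0) by rewrite (negPf n0).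
elim: hx {n0} => {nu x} [nu|c|nu x y _ [c [e1 h1]] _ [d [e2 h2]]|j nu x jm _ [c [e1 _]]].
- by exists 0; rewrite act_0 mul0mx scale0r; split=> //; right.
- by exists c; rewrite actZ act1 scalemx1 mul_scalar_mx; split=> //; left.
- exists (c + d); rewrite actD mulmxDl e1 e2 scalerDl; split=> //.
  case: h1 h2 => [->|]; first by left.
  by rewrite e1 => -> [->|]; [left | rewrite e2 => ->; right; rewrite addr0].
- exists 0; have -> : act M (Fn r j * x) *m vl = 0; last by rewrite scale0r; split=> //; right.
  by rewrite actM actF -mulmxA e1 -scalemxAr Fvl scaler0.
Qed.

Lemma act_partial_sum (P : 'M_(dim M)) (z : V) (Y : NPi r -> U r) n mu : (ht mu <= n)%N ->
  (forall mu', mu' != mu -> P *m (act M (Y mu') *m z) = 0) ->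
  P *m (act M (partial_sum Y n) *m z) = P *m (act M (Y mu) *m z).
Proof.
move=> hn h; have mun i : (mu i < n.+1)%N.
  by rewrite ltnS (leq_trans _ hn) // /ht (bigD1 i) //= leq_addr.
pose m0 : {ffun idx r -> 'I_n.+1} := [ffun i => Ordinal (mun i)].
have m0E : [ffun i => m0 i : nat] = mu by apply/ffunP => i; rewrite !ffunE.
rewrite /partial_sum act_sumU mulmx_suml mulmx_sumr (bigD1 m0) ?m0E //=.
rewrite big1 ?addr0 // => m1 /andP [_ m10]; apply: h; apply: contra m10 => /eqP e.
by apply/eqP/ffunP => i; apply: val_inj; rewrite /= ffunE /= -e ffunE.
Qed.

End Components.

Theorem theorem4p18 (r : nat) (psi psii : U r -> U r) (Upsilon : NPi r -> U r)
  (hpsi : is_bar psi) (hpsii : is_bari psii)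
  (hUpsilon : is_intertwiner psi psii Upsilon) :
  forall mu : NPi r, UminusA (Upsilon mu).
Proof.
case: hUpsilon => Ywt Y0 YP mu.
have Yw mu' := Uminus_wt_words (Ywt mu').
(* The module is chosen for the given [mu]: faithfulness up to the height of [mu] is enough. *)
have [s faith] := faithful_words generic_q (@Fn_serre1 r) (@Fn_serre0 r) (@actD r) (@actZ r)
  (@actM r) (@act1 r) (fun M j _ => actF M (inord j)) (ht mu) (leqnn _).
set M := tmod r generic_q s in faith; pose vh := hvec r generic_q s; pose vl := lvec r generic_q s.
have [nh wh] : wv vh := wv_hvec r generic_q s.
have [nl wl] : wv vl := wv_lvec r generic_q s.
have Fvl i : rF M i *m vl = 0 by exact: rF_lvec.
have Evh i : rE M i *m vh = 0 by exact: rE_hvec.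
have hl : lat (rE M) vl vh by exact: hvec_lat.
have [u [h [Uu uvl [Lu _]]]] := lat_reached hpsi hpsii wl Fvl nh hl.
rewrite wh in uvl.
(* At this depth, the filtration acts by 0 on [M]. *)
have [n0 hn0] := YP u Uu (hbound M + hbound M).+1.
(* [n] is large enough for the intertwining relation to hold exactly on [vl] and for the partial sum
   to contain the component [mu]. *)
pose n := maxn n0 (ht mu); pose T := act M (partial_sum Upsilon n).
have Tvl : T *m vl = vl.
  rewrite -[LHS]mul1mx (act_partial_sum (mu := [ffun=> 0%N])).
  - by rewrite Y0 act1 !mul1mx.
  - by rewrite /ht big1 // => i _; rewrite ffunE.
  move=> mu' mu0; rewrite mul1mx; apply: (act_lowest Fvl (Yw mu')).
  by rewrite -weight0; apply: contra mu0 => /eqP /weight_inj ->.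
have LT : lat (rE M) vl (T *m vh).
  have := Ufilt_kills vl (ltnSn _) (hn0 n (leq_maxl _ _)).
  rewrite actD act_opp mulmxBl !actM -!mulmxA uvl -/T Tvl => /eqP.
  by rewrite subr_eq0 => /eqP <-.
(* The component of weight [nh - weight mu] of [T vh] is isolated: it comes from [Upsilon mu] alone,
   and it is also [y vh] with [y] integral. *)
have [y [yA yw ye]] := lat_UminusA wh
  ((latEF generic_q wh wl Evh Fvl hl (lvec_lat r generic_q s) _).1 LT) (weight mu).
suff /eqP : Upsilon mu - y = 0 by rewrite subr_eq0 => /eqP ->.
apply: (faith (weight mu)); rewrite ?hgt_weight //; first exact: uwB.
rewrite actD act_opp mulmxBl -ye (act_partial_sum (mu := mu)) ?leq_maxr //.
  by rewrite (uw_wt (Yw mu) wh) subrr.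
move=> mu' ne; apply: (pr_neq _ (uw_wt (Yw mu') wh)).
by apply: contra ne => /eqP /addrI /oppr_inj /weight_inj ->.
Qed.
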